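(* Let $(\xi,\eta)$ be a random vector in $\mathbb{R}^2$ with $\eta>0$. Suppose that $a:=\mathbb{E}\xi>0$ (finite), $0<\sigma^2:=\operatorname{Var}\xi<\infty$ and $\mathbb{E}\log^2(1+\eta)<\infty$. (1) The following weak convergence holds: $$\frac{\log D_n-an}{\sqrt{n\sigma^2}}\ \Rightarrow\ \mathcal{N}_{0,1}\quad\text{as }n\to\infty .$$ (2) If further the distribution of $\xi$ is nonlattice, then for any fixed $\Delta>0$ $$\mathbb{P}\{\log D_n\in(x,x+\Delta]\}=\frac{\Delta}{\sqrt{2\pi\sigma^2n}}\,e^{-(x-na)^2/(2n\sigma^2)}+o(1/\sqrt n)$$ as $n\to\infty$ uniformly in $x$. (3) The same results (1) and (2) hold with $\widetilde D_n$ in place of $D_n$.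
   Context: Let $(\xi_k,\eta_k)$, $k\ge1$, be independent copies of $(\xi,\eta)$ (the components $\xi$ and $\eta$ may be dependent), $S_0:=0$, $S_n:=\xi_1+\dots+\xi_n$. For $n\ge1$ define $$D_n:=\sum_{k=1}^n \eta_k e^{S_k},\qquad \widetilde D_n:=\sum_{k=1}^n \eta_k e^{S_{k-1}}.$$ $\mathcal{N}_{0,1}$ denotes the standard normal law and $\Rightarrow$ denotes weak convergence (convergence in distribution). *)

(* Defs.v *)
From HB Require Import structures.
From mathcomp Require Import all_boot all_order all_algebra finmap.
From mathcomp Require Import all_classical all_reals all_analysis.
From mathcomp Require Import measurable_realfun.

Set Implicit Arguments.
Unset Strict Implicit.
Unset Printing Implicit Defensive.

Import Order.TTheory GRing.Theory Num.Theory.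
Import numFieldNormedType.Exports.

Local Open Scope classical_set_scope.
Local Open Scope ring_scope.

(* Laws are compared on measurable sets only: the value of a measure outside
   its sigma-algebra is unconstrained in this library. *)
Definition same_law d d' (T : measurableType d) (T' : measurableType d')
    (R : realType) (P : probability T R) (X Y : {RV P >-> T'}) : Prop :=
  forall A : set T', measurable A -> distribution P X A = distribution P Y A.

Definition mutually_independent d d' (T : measurableType d)
    (T' : measurableType d') (R : realType) (P : probability T R)
    (I : choiceType) (X : I -> {RV P >-> T'}) : Prop :=
  forall (J : {fset I}) (A : I -> set T'), (forall i, measurable (A i)) ->
    P (\bigcap_(i in [set` J]) (X i @^-1` A i)) =
    (\prod_(i <- J) P (X i @^-1` A i))%E.

(* [R] and [measurableTypeR R] both carry the Borel sigma-algebra; they differ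
   only in the display, and [normal_prob] is a probability on the latter. *)
Definition weak_cvg (R : realType) (mu : nat -> probability R R)
    (nu : probability (measurableTypeR R) R) : Prop :=
  forall f : R -> R, continuous f -> bounded_fun f ->
    (\int[mu n]_x (f x)%:E)%E @[n --> \oo] --> (\int[nu]_x (f x)%:E)%E.

(* Nonlattice in the sense of local limit theorems: shifts are allowed, so
   concentration on any coset c + hZ, not only on hZ itself, is excluded. *)
Definition lattice (R : realType) (mu : probability R R) : Prop :=
  exists c h : R, 0 < h /\ mu [set c + h * k%:~R | k in [set: int]] = 1%E.

Definition nonlattice (R : realType) (mu : probability R R) : Prop :=
  ~ lattice mu.

Section random_vector.
Context d (T : measurableType d) (R : realType).

Definition random_vector (X Y : {mfun T >-> R}) : T -> R * R :=
  fun t => (X t, Y t).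

Lemma measurable_random_vector (X Y : {mfun T >-> R}) :
  measurable_fun [set: T] (random_vector X Y).
Proof. by apply/measurable_fun_pairP; split; exact: measurable_funPT. Qed.

HB.instance Definition _ (X Y : {mfun T >-> R}) :=
  isMeasurableFun.Build _ _ _ _ (random_vector X Y)
    (measurable_random_vector X Y).

Definition standardize (m s : R) (X : {mfun T >-> R}) : T -> R :=
  fun t => (X t - m) / s.

Lemma measurable_standardize (m s : R) (X : {mfun T >-> R}) :
  measurable_fun [set: T] (standardize m s X).
Proof.
apply: measurable_funM; last exact: measurable_cst.
by apply: measurable_funB; [exact: measurable_funPT|exact: measurable_cst].
Qed.

HB.instance Definition _ (m s : R) (X : {mfun T >-> R}) :=
  isMeasurableFun.Build _ _ _ _ (standardize m s X)
    (measurable_standardize m s X).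

End random_vector.

(* Sequences are indexed from 0, so that [xi k] and [eta k] stand for the
   vector (xi_{k+1}, eta_{k+1}); [walk n], [logD n] and [logDtilde n] keep the
   usual index n. [ln] vanishes on nonpositive reals, which matters only at
   n = 0 and on the null event where some eta is not positive. *)
Section perpetuity.
Context d (T : measurableType d) (R : realType).
Variables xi eta : nat -> {mfun T >-> R}.

Definition walk (n : nat) : T -> R := fun t => \sum_(k < n) xi k t.

Definition D (n : nat) : T -> R :=
  fun t => \sum_(k < n) eta k t * expR (walk k.+1 t).

Definition Dtilde (n : nat) : T -> R :=
  fun t => \sum_(k < n) eta k t * expR (walk k t).

Definition logD (n : nat) : T -> R := fun t => ln (D n t).

Definition logDtilde (n : nat) : T -> R := fun t => ln (Dtilde n t).

Lemma measurable_walk n : measurable_fun [set: T] (walk n).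
Proof. by apply: measurable_sum => k; exact: measurable_funPT. Qed.

Lemma measurable_D n : measurable_fun [set: T] (D n).
Proof.
apply: measurable_sum => k; apply: measurable_funM; first exact: measurable_funPT.
exact: measurableT_comp (measurable_walk _).
Qed.

Lemma measurable_Dtilde n : measurable_fun [set: T] (Dtilde n).
Proof.
apply: measurable_sum => k; apply: measurable_funM; first exact: measurable_funPT.
exact: measurableT_comp (measurable_walk _).
Qed.

Lemma measurable_logD n : measurable_fun [set: T] (logD n).
Proof. exact: measurableT_comp (measurable_D n). Qed.

Lemma measurable_logDtilde n : measurable_fun [set: T] (logDtilde n).
Proof. exact: measurableT_comp (measurable_Dtilde n). Qed.

HB.instance Definition _ n :=
  isMeasurableFun.Build _ _ _ _ (logD n) (measurable_logD n).
HB.instance Definition _ n :=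
  isMeasurableFun.Build _ _ _ _ (logDtilde n) (measurable_logDtilde n).

End perpetuity.

(* Main.v *)
From HB Require Import structures.
Require Import Defs.
From mathcomp Require Import all_boot all_order all_algebra finmap.
From mathcomp Require Import all_classical all_reals all_analysis.
From mathcomp Require Import measurable_realfun complex ring lra.

Set Implicit Arguments.
Unset Strict Implicit.
Unset Printing Implicit Defensive.

Import Order.TTheory GRing.Theory Num.Theory.
Import numFieldNormedType.Exports.

Local Open Scope classical_set_scope.
Local Open Scope ring_scope.

(**
  Limit theorems for the walk come from Fourier analysis: smoothing an interval
  probability with the Fejer kernel turns it into an integral of characteristic
  functions over a compact interval, and since the normal law charges intervals
  at most proportionally to their length, the smoothing can be undone with
  explicit errors.  The characteristic function of the centred step satisfies
  phi(t) - exp(-sigma^2 t^2 / 2) = o(t^2) at 0 and, in the nonlattice case,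
  |phi| < 1 off 0.

  To pass to the perpetuity, cut off a last block of length m ~ kappa n and
  write p = n - m.  Because a > 0, D_p is exponentially negligible against the
  rest of the sum, up to an event of probability O(1/n) = o(1/sqrt n).  Hence
  log D_n is, up to a small constant, the sum of S_p and of the logarithm of
  the perpetuity of the last block, which is independent of S_p and within
  a small multiple of sqrt n of a m with high probability.  The local limit
  theorem for S_p, integrated against this independent shift, gives the one
  for log D_n.

  Replacing eta by eta e^{-xi} turns D~ into D, whence (3).
*)

(** Two kinds of error are kept apart. An event that may move log D_n arbitrarily must have
    probability o(1/sqrt n). With second moments, Chebyshev and union bounds give O(1/n) for
    deviations of order n, and a block of length proportional to n has a drift that outweighs such
    deviations. An error in the independent shift, in contrast, is weighted by interval
    probabilities of S_p, which are already O(1/sqrt n); so the shift need only be within k sqrt n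
    of its centre with probability close to 1. Hence k and kappa are fixed after the target
    precision and before n, and S_p is compared directly with the normal law of variance n sigma^2,
    at a cost proportional to kappa.

    In the Fourier estimate a uniform bound on the difference of characteristic functions would lose
    the factor 1/sqrt n; the bound e / (1 + n t^2), whose integral is an arctangent, keeps it. Since
    eta has no quantitative lower bound, the block is bounded from below by using many of its last
    factors at once: that all are small is exponentially unlikely. *)

(** * Elementary inequalities for sine, cosine and the exponential *)

Section calculus.
Context {R : realType}.
Implicit Types (f df F : R -> R) (x y a b : R).

Lemma is_derive_continuous f df x : is_derive x 1 f (df x) -> {for x, continuous f}.
Proof. by move=> [fx _]; exact/differentiable_continuous/derivable1_diffP. Qed.

(** Mean value theorem. The Taylor bounds below apply it repeatedly: the derivative of each
    difference is nonnegative by the bound of one degree less. *)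
Lemma ge0_is_derive f df : (forall x, is_derive x 1 f (df x)) ->
  0 <= f 0 -> (forall x, 0 <= x -> 0 <= df x) -> forall x, 0 <= x -> 0 <= f x.
Proof.
move=> fdf f0 df0 x; rewrite le_eqVlt => /predU1P[<-//|x0].
have cf : {within `[0, x], continuous f}.
  by apply: continuous_subspaceT => y; exact: (is_derive_continuous (fdf y)).
have [c /[!in_itv]/= /andP[c0 _] fE] := MVT x0 (fun x _ => fdf x) cf.
rewrite -(subrK (f 0) (f x)) addr_ge0// fE subr0 mulr_ge0// ?df0 ?ltW//.
Qed.

Lemma is_derive_lipschitz f df k : (forall x, is_derive x 1 f (df x)) ->
  (forall x, `|df x| <= k) -> forall x y, `|f x - f y| <= k * `|x - y|.
Proof.
move=> fdf dfk.
suff H a b : a < b -> `|f b - f a| <= k * `|b - a|.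
  move=> x y; have [xy|yx|->] := ltgtP x y; last by rewrite !subrr normr0 mulr0.
    by rewrite distrC (distrC x) H.
  exact: H.
move=> ab.
have cf : {within `[a, b], continuous f}.
  by apply: continuous_subspaceT => y; exact: (is_derive_continuous (fdf y)).
have [c _ ->] := MVT ab (fun x _ => fdf x) cf.
by rewrite normrM ler_wpM2r.
Qed.

Lemma Rintegral_is_derive f F a b : a <= b -> continuous f ->
  (forall x, is_derive x 1 F (f x)) ->
  \int[lebesgue_measure]_(x in `[a, b]) f x = F b - F a.
Proof.
rewrite le_eqVlt => /predU1P[->|ab] cf dF.
  by rewrite set_itv1 Rintegral_set1 subrr.
rewrite /Rintegral (@continuous_FTC2 _ _ F)//.
- exact: continuous_subspaceT.
- have cF : continuous F by move=> x; exact: (is_derive_continuous (dF x)).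
  split; first by move=> x _; case: (dF x).
    exact: cvg_at_right_filter (cF a).
  exact: cvg_at_left_filter (cF b).
- by move=> x _; rewrite derive1E; exact: derive_val.
Qed.

Lemma normr_sinB_le x y : `|sin x - sin y| <= `|x - y|.
Proof.
rewrite -[leRHS]mul1r; apply: (@is_derive_lipschitz sin cos) => z.
by rewrite ler_norml cos_geN1 cos_le1.
Qed.

Lemma normr_cosB_le x y : `|cos x - cos y| <= `|x - y|.
Proof.
rewrite -[leRHS]mul1r; apply: (@is_derive_lipschitz cos (fun z => - sin z)) => z.
by rewrite normrN ler_norml sin_geN1 sin_le1.
Qed.

Lemma cos_ge_sqr x : 1 - x ^+ 2 / 2 <= cos x.
Proof.
wlog x0 : x / 0 <= x => [H|].
  by have [/H//|/ltW x0] := leP 0 x; rewrite -cosN -sqrrN H// oppr_ge0.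
rewrite -subr_ge0; move: x x0.
apply: (@ge0_is_derive (fun x => cos x - (1 - x ^+ 2 / 2)) (fun x => - sin x + x)).
- move=> x; apply: is_derive_eq; rewrite /= !scaler0 /GRing.scale/=.
  by field.
- by rewrite cos0 expr0n /= mul0r subr0 subrr.
- move=> x x0; have := normr_sinB_le x 0.
  by rewrite sin0 !subr0 (ger0_norm x0) => /(le_trans (ler_norm _)); lra.
Qed.

Lemma sin_cubic_bounds x : 0 <= x ->
  [/\ sin x <= x, x - x ^+ 2 / 2 <= sin x & x - x ^+ 3 / 6 <= sin x].
Proof.
move=> x0; split.
- have := normr_sinB_le x 0.
  by rewrite sin0 !subr0 (ger0_norm x0) => /(le_trans (ler_norm _)).
- rewrite -subr_ge0; move: x x0.
  apply: (@ge0_is_derive (fun x => sin x - (x - x ^+ 2 / 2))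
      (fun x => cos x - (1 - x))).
  + move=> x; apply: is_derive_eq; rewrite /= !scaler0 /GRing.scale/=.
    by field.
  + by rewrite sin0 expr0n /= mul0r subr0 subrr.
  + move=> x x0; have := normr_cosB_le x 0.
    by rewrite cos0 subr0 (ger0_norm x0) ler_norml => /andP[]; lra.
- rewrite -subr_ge0; move: x x0.
  apply: (@ge0_is_derive (fun x => sin x - (x - x ^+ 3 / 6))
      (fun x => cos x - (1 - x ^+ 2 / 2))).
  + move=> x; apply: is_derive_eq; rewrite /= !scaler0 /GRing.scale/=.
    by field.
  + by rewrite sin0 expr0n /= mul0r subr0 subrr.
  + by move=> x _; rewrite subr_ge0 cos_ge_sqr.
Qed.

Lemma cos_le_cubic x : 0 <= x -> cos x <= 1 - x ^+ 2 / 2 + x ^+ 3 / 6.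
Proof.
move=> x0; rewrite -subr_ge0; move: x x0.
apply: (@ge0_is_derive (fun x => 1 - x ^+ 2 / 2 + x ^+ 3 / 6 - cos x)
    (fun x => sin x - (x - x ^+ 2 / 2))).
- move=> x; apply: is_derive_eq; rewrite /= !scaler0 /GRing.scale/=.
  by field.
- by rewrite cos0 !expr0n /= !mul0r subr0 addr0 subrr.
- by move=> x /sin_cubic_bounds[_ ? _]; rewrite subr_ge0.
Qed.

(** The minimum suits a step with two moments: the square serves as the dominating function, the
    cube makes the remainder vanish pointwise after division by the squared frequency. *)
Lemma normr_cos_taylor x :
  `|cos x - (1 - x ^+ 2 / 2)| <= Num.min (x ^+ 2) (`|x| ^+ 3).
Proof.
wlog x0 : x / 0 <= x => [H|].
  have [/H//|/ltW x0] := leP 0 x; rewrite -cosN -sqrrN -(normrN x) H//.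
  by rewrite oppr_ge0.
rewrite ger0_norm ?subr_ge0 ?cos_ge_sqr// (ger0_norm x0).
rewrite le_min; apply/andP; split.
  by have := cos_le1 x; have := sqr_ge0 x; lra.
by have := cos_le_cubic x0; have := exprn_ge0 3 x0; lra.
Qed.

Lemma normr_sin_taylor x :
  `|sin x - x| <= Num.min (x ^+ 2) (`|x| ^+ 3).
Proof.
wlog x0 : x / 0 <= x => [H|].
  have [/H//|/ltW x0] := leP 0 x.
  rewrite (_ : sin x - x = - (sin (- x) - (- x))); last by rewrite sinN; ring.
  by rewrite normrN -sqrrN -(normrN x) H// oppr_ge0.
have [h1 h2 h3] := sin_cubic_bounds x0.
rewrite distrC ger0_norm ?subr_ge0// (ger0_norm x0).
rewrite le_min; apply/andP; split.
  by have := sqr_ge0 x; lra.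
by have := exprn_ge0 3 x0; lra.
Qed.

Lemma expR_ge_sqr x : 0 <= x -> 1 + x + x ^+ 2 / 2 <= expR x.
Proof.
move=> x0; rewrite -subr_ge0; move: x x0.
apply: (@ge0_is_derive (fun x => expR x - (1 + x + x ^+ 2 / 2))
    (fun x => expR x - (1 + x))).
- move=> x; apply: is_derive_eq; rewrite /= !scaler0 /GRing.scale/=.
  by field.
- by rewrite expR0 expr0n /= mul0r !addr0 subrr.
- by move=> x _; rewrite subr_ge0 expR_ge1Dx.
Qed.

Lemma expRN_le_sqr x : 0 <= x -> expR (- x) <= 1 - x + x ^+ 2 / 2.
Proof.
move=> x0; rewrite -subr_ge0; move: x x0.
apply: (@ge0_is_derive (fun x => 1 - x + x ^+ 2 / 2 - expR (- x))
    (fun x => expR (- x) - (1 - x))).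
- move=> x; apply: is_derive_eq; rewrite /= !scaler0 /GRing.scale/=.
  by field.
- by rewrite oppr0 expR0 expr0n /= mul0r !addr0 subrr.
- by move=> x _; rewrite subr_ge0 expR_ge1Dx.
Qed.

(** Turns exponential decay into the rational weight 1 / (1 + v), whose integral is an arctangent.
    After multiplying out, [expR_ge_sqr] at [c * v] supplies the terms v and v^2 with exactly these
    two constants. *)
Lemma mulr_expRN_le (c v : R) : 0 < c -> 0 <= v ->
  v * expR (- (c * v)) <= (c^-1 + 2 * c^-2) / (1 + v).
Proof.
move=> c0 v0; have cv0 : 0 <= c * v by rewrite mulr_ge0// ltW.
rewrite ler_pdivlMr ?ltr_wpDr// expRN mulrAC ler_pdivrMr ?expR_gt0//.
have ci0 : 0 <= c^-1 by rewrite invr_ge0 ltW.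
have cii0 : 0 <= c^-2 by rewrite invr_ge0 exprn_ge0 ?ltW.
have K0 : 0 <= c^-1 + 2 * c^-2 by rewrite addr_ge0// mulr_ge0.
apply: le_trans (ler_wpM2l K0 (expR_ge_sqr cv0)).
rewrite [leRHS](_ : _ = v * (1 + v) +
    (c^-1 + 2 * c^-2 + 2 * (c^-1 * v) + (v ^+ 2 * c) / 2)); last first.
  by field; rewrite gt_eqF.
have cv1 : 0 <= c^-1 * v by rewrite mulr_ge0.
have cv2 : 0 <= v ^+ 2 * c by apply: mulr_ge0; [exact: sqr_ge0|exact: ltW].
lra.
Qed.

End calculus.

(** * Fejer kernel and unsmoothing *)

Section fejer.
Context {R : realType}.
Implicit Types x y t : R.

(* The value at 0 is the limit: this kernel is the Fourier transform of the
   triangle function 1 - t on [0, 1], see [fejerE]. *)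
Definition fejer y : R := if y == 0 then 2^-1 else (1 - cos y) / y ^+ 2.

Lemma fejer_ge0 y : 0 <= fejer y.
Proof.
rewrite /fejer; case: ifP => _; first by rewrite invr_ge0.
by rewrite divr_ge0 ?sqr_ge0// subr_ge0 cos_le1.
Qed.

Lemma fejer_le_half y : fejer y <= 2^-1.
Proof.
rewrite /fejer; case: ifPn => // y0.
have y2 : 0 < y ^+ 2 by rewrite lt0r sqrf_eq0 y0 sqr_ge0.
by rewrite ler_pdivrMr//; have := cos_ge_sqr y; lra.
Qed.

(** At y = 0 the bound would read 0, the inverse of 0 being 0 by convention; that point is set
    apart. *)
Lemma fejer_le y : fejer y <= 2 * y ^- 2 \/ y = 0.
Proof.
rewrite /fejer; case: eqVneq => [|y0]; [by right|left].
by rewrite ler_wpM2r ?invr_ge0 ?sqr_ge0//; have := cos_geN1 y; lra.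
Qed.

Lemma fejer_ge y : `|y| <= 1 -> 4^-1 <= fejer y.
Proof.
wlog y0 : y / 0 <= y => [H|].
  have [/H//|/ltW y0] := leP 0 y; rewrite -normrN => /H.
  by rewrite oppr_ge0 => /(_ y0); rewrite /fejer oppr_eq0 cosN sqrrN.
rewrite (ger0_norm y0) /fejer => y1; case: ifPn => yn0; first by lra.
have y2 : 0 < y ^+ 2 by rewrite lt0r sqrf_eq0 yn0 sqr_ge0.
rewrite ler_pdivlMr//; have := cos_le_cubic y0.
have : y ^+ 3 <= y ^+ 2 by rewrite exprS ler_piMl// ltW.
lra.
Qed.

Lemma measurable_fejer : measurable_fun [set: R] fejer.
Proof.
apply: measurable_fun_if => //.
- by apply: measurable_fun_eqr; [exact: measurable_id|exact: measurable_cst].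
- rewrite setTI (_ : _ @^-1` _ = [set y : R | y != 0]); last first.
    by apply/seteqP; split => y /=; case: eqP.
  apply: open_continuous_measurable_fun; first exact: open_neq.
  move=> y; rewrite inE/= => y0; apply: cvgM.
    by apply: cvgB; [exact: cvg_cst|exact: continuous_cos].
  apply: cvgV; first by rewrite sqrf_eq0.
  exact: exprn_continuous.
Qed.

Lemma continuous_triangle_cos y : continuous (fun t : R => (1 - t) * cos (t * y)).
Proof.
move=> t; apply: cvgM; first by apply: cvgB; [exact: cvg_cst|exact: cvg_id].
apply: (cvg_comp (fun t : R => t * y) cos); last exact: continuous_cos.
by apply: cvgM; [exact: cvg_id|exact: cvg_cst].
Qed.

Lemma fejerE y :
  fejer y = \int[lebesgue_measure]_(t in `[0, 1]) ((1 - t) * cos (t * y)).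
Proof.
have FTC F (dF : forall t, is_derive t 1 F ((1 - t) * cos (t * y))) :=
  Rintegral_is_derive ler01 (@continuous_triangle_cos y) dF.
rewrite /fejer; case: eqVneq => [y0|y0].
  have /FTC -> : forall t, is_derive t 1 (fun t => t - t ^+ 2 / 2)
      ((1 - t) * cos (t * y)).
    move=> t; apply: is_derive_eq; rewrite y0 /= !scaler0 /GRing.scale/=.
    by rewrite mulr0 cos0; field.
  by rewrite !expr1n !expr0n/=; field.
have /FTC -> : forall t, is_derive t 1
    (fun t => (1 - t) * (sin (t * y) / y) - cos (t * y) / y ^+ 2)
    ((1 - t) * cos (t * y)).
  move=> t; apply: is_derive_eq; rewrite /= !scaler0 /GRing.scale/=.
  by field.
by rewrite !mul0r !mul1r sin0 cos0; field.
Qed.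

End fejer.

(** * Bounded integrands and exchange of integrals *)

Section bounded_integrals.
Context d (T : measurableType d) (R : realType) (P : probability T R).
Implicit Types f g : T -> R.

Lemma bounded_integrable f (M : R) : measurable_fun [set: T] f ->
  (forall x, `|f x| <= M) -> P.-integrable [set: T] (EFin \o f).
Proof.
move=> mf fM; apply: measurable_bounded_integrable => //.
  by rewrite (le_lt_trans (probability_le1 _ _))// ltry.
exists M; split; first exact: num_real.
by move=> K MK x _ /=; rewrite (le_trans (fM x))// ltW.
Qed.

Lemma Rintegral_probability_cst (r : R) : \int[P]_w r = r.
Proof. by rewrite Rintegral_cst// [X in fine X]probability_setT mulr1. Qed.

Lemma normr_Rintegral_le f (M : R) : measurable_fun [set: T] f ->
  (forall x, `|f x| <= M) -> `|\int[P]_w f w| <= M.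
Proof.
move=> mf fM; have fi := bounded_integrable mf fM.
apply: le_trans (le_normr_Rintegral measurableT fi) _.
rewrite -[leRHS]Rintegral_probability_cst; apply: le_Rintegral => //.
- exact: integrable_norm fi.
- exact: finite_measure_integrable_cst.
Qed.

Context d2 (T2 : measurableType d2) (mu : {sigma_finite_measure set T2 -> \bar R}).

(** Fubini: since P has mass 1, domination by an integrable function of t alone already gives
    integrability for the product measure. *)
Lemma dominated_swap (f : T2 * T -> R) (k : T2 -> R) :
  measurable_fun [set: T2 * T] f ->
  mu.-integrable [set: T2] (EFin \o k) ->
  (forall t w, `|f (t, w)| <= k t) ->
  mu.-integrable [set: T2] (fun t => (\int[P]_w f (t, w))%:E) /\
  \int[P]_w \int[mu]_t f (t, w) = \int[mu]_t \int[P]_w f (t, w).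
Proof.
move=> mf ki fk.
have mk : measurable_fun [set: T2] k by exact/measurable_EFinP/(measurable_int mu).
have k0 t : 0 <= k t by rewrite (le_trans _ (fk t point)).
have fi : (mu \x P)%E.-integrable [set: T2 * T] (EFin \o f).
  apply/integrable12ltyP; first exact/measurable_EFinP.
  apply: (@le_lt_trans _ _ (\int[mu]_t (k t)%:E)%E); last first.
    exact: integrable_lty ki.
  apply: ge0_le_integral => //=.
  - by move=> t _; exact: integral_ge0.
  - apply: (measurable_fun_fubini_tonelli_F (fun z => `|(f z)%:E|%E)) => //.
    by apply: measurableT_comp => //; exact/measurable_EFinP.
  - exact/measurable_EFinP.
  - move=> t _; apply: (@le_trans _ _ (\int[P]_w (k t)%:E)%E).
      apply: ge0_le_integral => //=.
      + apply/measurable_EFinP; apply: measurableT_comp => //.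
        exact: measurable_fun_pair2.
      + by move=> w _; rewrite lee_fin.
    by rewrite integral_cst// [X in (_ * X)%E]probability_setT mule1.
have iT t : P.-integrable [set: T] (fun w => (f (t, w))%:E).
  apply: (@bounded_integrable (fun w => f (t, w)) (k t)) => //.
  exact: measurable_fun_pair2.
have iT2 w : mu.-integrable [set: T2] (fun t => (f (t, w))%:E).
  apply: (le_integrable _ _ _ ki) => //.
    exact/measurable_EFinP/measurable_fun_pair1.
  by move=> t _ /=; rewrite lee_fin (le_trans (fk t w))// ler_norm.
have E1 t : (\int[P]_w f (t, w))%:E = (\int[P]_w (f (t, w))%:E)%E.
  by rewrite /Rintegral fineK//; exact: integrable_fin_num (iT t).
have E2 w : (\int[mu]_t f (t, w))%:E = (\int[mu]_t (f (t, w))%:E)%E.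
  by rewrite /Rintegral fineK//; exact: integrable_fin_num (iT2 w).
split.
  rewrite (_ : (fun t => _) = fubini_F P (EFin \o f)); last exact/funext/E1.
  exact: integrable_fubini_F.
rewrite /Rintegral; congr fine.
under eq_integral do rewrite E2.
under [RHS]eq_integral do rewrite E1.
exact: (esym (Fubini fi)).
Qed.

End bounded_integrals.

(** * Smoothed probabilities as Fourier integrals *)

Section fejer_expectation.
Context {R : realType}.
Local Notation leb := (@lebesgue_measure R).

(** [ecos] and [esin] are the real and imaginary parts of the characteristic function, kept apart so
    that all integrals stay real. *)
Definition ecos d (T : measurableType d) (P : probability T R) (X : T -> R) (t : R) : R :=
  \int[P]_w cos (t * X w).

Definition esin d (T : measurableType d) (P : probability T R) (X : T -> R) (t : R) : R :=
  \int[P]_w sin (t * X w).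

Context d (T : measurableType d) (P : probability T R) (X : T -> R).
Hypothesis mX : measurable_fun [set: T] X.

Lemma measurable_cosM t : measurable_fun [set: T] (fun w => cos (t * X w)).
Proof.
apply: (measurableT_comp (f := cos)); last exact: measurable_funM.
by apply: continuous_measurable_fun; exact: continuous_cos.
Qed.

Lemma measurable_sinM t : measurable_fun [set: T] (fun w => sin (t * X w)).
Proof.
apply: (measurableT_comp (f := sin)); last exact: measurable_funM.
by apply: continuous_measurable_fun; exact: continuous_sin.
Qed.

Lemma integrable_cosM t : P.-integrable [set: T] (EFin \o (fun w => cos (t * X w))).
Proof.
by apply: (@bounded_integrable _ _ _ _ _ 1); [exact: measurable_cosM|move=> w; exact: cos_max].
Qed.

Lemma integrable_sinM t : P.-integrable [set: T] (EFin \o (fun w => sin (t * X w))).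
Proof.
by apply: (@bounded_integrable _ _ _ _ _ 1); [exact: measurable_sinM|move=> w; exact: sin_max].
Qed.

Lemma expectation_cosB (t x : R) :
  \int[P]_w cos (t * (X w - x)) = cos (t * x) * ecos P X t + sin (t * x) * esin P X t.
Proof.
rewrite /ecos /esin -!RintegralZl//; [|exact: integrable_sinM|exact: integrable_cosM].
rewrite -RintegralD//.
- by apply: eq_Rintegral => w _; rewrite mulrBr cosB mulrC (mulrC (sin _)).
- exact: (integrableZl _ (cos (t * x)) (integrable_cosM t)).
- exact: (integrableZl _ (sin (t * x)) (integrable_sinM t)).
Qed.

(** Fubini applied to the triangle representation [fejerE]: smoothing at scale h sees only the
    frequencies up to 1 / h. *)
Lemma fejer_expectation (x h : R) :
  let g (t : R) : R := (1 - t) * (cos (t / h * x) * ecos P X (t / h) +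
                        sin (t / h * x) * esin P X (t / h)) in
  leb.-integrable `[0, 1] (EFin \o g) /\
  \int[P]_w fejer ((X w - x) / h) = \int[leb]_(t in `[0, 1]) g t.
Proof.
move=> g.
(* The triangle weight is extended by 0 so that [dominated_swap] applies over the whole line. *)
pose r : R -> R := (fun t : R => 1 - t : R) \_ `[0, 1]%classic.
have ri : leb.-integrable [set: R] (EFin \o r).
  rewrite /r -restrict_EFin.
  have /integrable_mkcond : leb.-integrable `[0, 1] (EFin \o (fun t : R => 1 - t : R)); last exact.
  apply: continuous_compact_integrable; first exact: segment_compact.
  apply: continuous_subspaceT => t.
  by apply: cvgB; [exact: cvg_cst|exact: cvg_id].
have mr : measurable_fun [set: R] r by have /measurable_int/measurable_EFinP := ri.
pose f (z : R * T) := r z.1 * cos (z.1 * ((X z.2 - x) / h)).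
have mf : measurable_fun [set: R * T] f.
  apply: measurable_funM; first exact: measurableT_comp.
  apply: (measurableT_comp (f := cos)).
    by apply: continuous_measurable_fun; exact: continuous_cos.
  apply: measurable_funM => //; apply: measurable_funM => //.
  by apply: measurable_funB => //; exact: measurableT_comp.
have [] := @dominated_swap _ _ _ P _ _ leb f (fun t => `|r t|) mf.
- exact: integrable_norm ri.
- by move=> t w; rewrite /f normrM ler_piMr// cos_max.
have fE t : \int[P]_w f (t, w) = (g \_ `[0, 1]) t.
  rewrite /f /r /= !patchE; case: ifPn => _; last first.
    by under eq_Rintegral do rewrite mul0r; rewrite Rintegral_probability_cst.
  rewrite RintegralZl//; first congr (_ * _).
    rewrite -expectation_cosB; apply: eq_Rintegral => w _.
    by rewrite mulrA mulrAC.
  apply: (@bounded_integrable _ _ _ _ _ 1) => [|w]; last exact: cos_max.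
  apply: (measurableT_comp (f := cos)).
    by apply: continuous_measurable_fun; exact: continuous_cos.
  by apply: measurable_funM => //; apply: measurable_funM => //; exact: measurable_funB.
move=> gi swap; split.
  apply/integrable_mkcond => //; rewrite restrict_EFin.
  by rewrite (_ : _ \o _ = fun t => (\int[P]_w f (t, w))%:E)//; apply/funext => t /=; rewrite fE.
rewrite [RHS]Rintegral_mkcond; under [RHS]eq_Rintegral do rewrite -fE.
rewrite -swap; apply: eq_Rintegral => w _.
rewrite fejerE Rintegral_mkcond; apply: eq_Rintegral => t _.
by rewrite /f /r /= !patchE; case: ifP => // _; rewrite mul0r.
Qed.

End fejer_expectation.

Section fejer_expectation_dist.
Context {R : realType}.
Local Notation leb := (@lebesgue_measure R).

Lemma continuous_inv1Dsqr (w : R) : continuous (fun t : R => (1 + (w * t) ^+ 2)^-1).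
Proof.
move=> t; apply: cvgV; first by rewrite gt_eqF// ltr_pwDl// sqr_ge0.
apply: cvgD; first exact: cvg_cst.
apply: (cvg_comp (fun t : R => w * t) (fun t => t ^+ 2)); last exact: exprn_continuous.
by apply: cvgM; [exact: cvg_cst|exact: cvg_id].
Qed.

Lemma Rintegral_inv1Dsqr_le (w : R) : 0 < w ->
  \int[leb]_(t in `[0, 1]) (1 + (w * t) ^+ 2)^-1 <= 2 / w.
Proof.
move=> w0.
have dF (t : R) : is_derive t 1 (fun t : R => atan (w * t) / w) (1 + (w * t) ^+ 2)^-1.
  apply: is_derive_eq; rewrite /= !scaler0 /GRing.scale/=.
  have d0 : 1 + (w * t) ^+ 2 != 0 by rewrite gt_eqF// ltr_pwDl// sqr_ge0.
  have wn0 : w != 0 by rewrite gt_eqF.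
  by field; rewrite ?d0 ?wn0.
rewrite (Rintegral_is_derive ler01 (@continuous_inv1Dsqr w) dF).
rewrite mulr0 atan0 mul0r subr0 mulr1 ler_pM2r ?invr_gt0//.
by apply: ltW; apply: lt_trans (atan_ltpi2 w) (pihalf_lt2 _).
Qed.

Context d1 (T1 : measurableType d1) (P1 : probability T1 R) (X : T1 -> R).
Context d2 (T2 : measurableType d2) (P2 : probability T2 R) (Y : T2 -> R).
Hypotheses (mX : measurable_fun [set: T1] X) (mY : measurable_fun [set: T2] Y).

(** The [e1] part is concentrated at t of order 1 / w and integrates to at most e1 pi / (2 w); the
    flat [e2] part serves frequencies away from 0. Cosine and sine together double both, and pi / 2
    is bounded by 2. *)
Lemma fejer_expectation_dist (h w e1 e2 : R) : 0 < w -> 0 <= e1 -> 0 <= e2 ->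
  (forall t, 0 <= t <= 1 ->
     `|ecos P1 X (t / h) - ecos P2 Y (t / h)| <= e1 / (1 + (w * t) ^+ 2) + e2) ->
  (forall t, 0 <= t <= 1 ->
     `|esin P1 X (t / h) - esin P2 Y (t / h)| <= e1 / (1 + (w * t) ^+ 2) + e2) ->
  forall x, `|\int[P1]_w fejer ((X w - x) / h) - \int[P2]_w fejer ((Y w - x) / h)|
            <= 4 * e1 / w + 2 * e2.
Proof.
move=> w0 e10 e20 hc hs x.
have [gi1 ->] := fejer_expectation P1 mX x h.
have [gi2 ->] := fejer_expectation P2 mY x h.
have bi : leb.-integrable `[0, 1]
    (EFin \o (fun t : R => 2 * (e1 * (1 + (w * t) ^+ 2)^-1 + e2))).
  apply: continuous_compact_integrable; first exact: segment_compact.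
  apply: continuous_subspaceT => t; apply: cvgM; first exact: cvg_cst.
  apply: cvgD; last exact: cvg_cst.
  by apply: cvgM; [exact: cvg_cst|exact: continuous_inv1Dsqr].
rewrite -RintegralB//.
apply: le_trans (le_normr_Rintegral _ _) _ => //; first exact: integrableB gi1 gi2.
apply: (@le_trans _ _ (\int[leb]_(t in `[0, 1]) (2 * (e1 * (1 + (w * t) ^+ 2)^-1 + e2)))).
  apply: le_Rintegral => //.
    exact: integrable_norm (integrableB _ gi1 gi2).
  move=> t /=; rewrite in_itv/= => t01; have /andP[t0 t1] := t01.
  rewrite -mulrBr normrM ger0_norm ?subr_ge0//.
  apply: (@le_trans _ _ (1 * (e1 / (1 + (w * t) ^+ 2) + e2 + (e1 / (1 + (w * t) ^+ 2) + e2)))).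
    apply: ler_pM => //; rewrite ?subr_ge0//; first by rewrite lerBlDr lerDl.
    rewrite opprD addrACA -!mulrBr; apply: le_trans (ler_normD _ _) _.
    apply: lerD; rewrite normrM -[leRHS]mul1r; apply: ler_pM => //.
    - exact: cos_max.
    - exact: hc.
    - exact: sin_max.
    - exact: hs.
  by rewrite mul1r mulr2n mulrDl !mul1r.
have ii : leb.-integrable `[0, 1] (EFin \o (fun t : R => (1 + (w * t) ^+ 2)^-1)).
  apply: continuous_compact_integrable; first exact: segment_compact.
  by apply: continuous_subspaceT; exact: continuous_inv1Dsqr.
have ic : leb.-integrable `[0, 1] (EFin \o (fun t : R => e2)).
  apply: continuous_compact_integrable; first exact: segment_compact.
  by apply: continuous_subspaceT => t; exact: cvg_cst.
have iei : leb.-integrable `[0, 1] (EFin \o (fun t : R => e1 * (1 + (w * t) ^+ 2)^-1)).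
  exact: (integrableZl _ e1 ii).
rewrite RintegralZl//; last exact: (integrableD _ iei ic).
rewrite RintegralD// RintegralZl// Rintegral_cst// [X in fine X]lebesgue_measure_itv/=.
rewrite lte_fin ltr01 oppr0 addr0 mulr1.
have := ler_wpM2l e10 (Rintegral_inv1Dsqr_le w0).
rewrite (_ : e1 * (2 / w) = 2 * (e1 / w)); last by ring.
rewrite (_ : 4 * e1 / w = 4 * (e1 / w)); last by ring.
lra.
Qed.

End fejer_expectation_dist.

(** * Mass of the Fejer kernel near 0 and in the tails *)

Section fejer_mass.
Context {R : realType}.
Local Notation leb := (@lebesgue_measure R).
Local Open Scope ereal_scope.

(** Lebesgue measure is determined by the lengths of intervals, and its image under x |-> c - x
    gives every interval the same length. *)
Lemma ge0_integral_reflect (f : R -> \bar R) (c : R) :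
  measurable_fun [set: R] f -> (forall x, 0 <= f x) ->
  \int[leb]_x f (c - x)%R = \int[leb]_x f x.
Proof.
move=> mf f0.
pose phi (x : measurableTypeR R) : measurableTypeR R := (c - x)%R.
have mphi : measurable_fun [set: measurableTypeR R] phi by exact: measurable_funB.
have phiE A : measurable A -> pushforward leb phi A = leb A.
  move=> mA; apply/esym/lebesgue_measure_unique => //= _ [[a b]] _ <-.
  rewrite /pushforward (_ : _ @^-1` _ = `[(c - b)%R, (c - a)%R[%classic); last first.
    apply/seteqP; split => x /=; rewrite !in_itv/= => /andP[h1 h2];
      apply/andP; split; rewrite /phi in h1 h2 *; lra.
  rewrite !lebesgue_measure_itv/= !lte_fin ltrD2l ltrN2.
  by case: ifP => // _; rewrite -!EFinB; congr EFin; ring.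
transitivity (\int[pushforward leb phi]_x f x); last first.
  by apply: eq_measure_integral => A mA _; exact/phiE.
by rewrite (ge0_integral_pushforward mphi).
Qed.

Lemma measurable_fejer_scale (h : R) :
  measurable_fun [set: R] (fun y : R => fejer (y / h)%R).
Proof. by apply: (measurableT_comp measurable_fejer); exact: measurable_funM. Qed.

Lemma integral_invsqr (a : R) : (0 < a)%R ->
  \int[leb]_(y in `[a, +oo[) (y ^- 2)%:E = (a^-1)%:E.
Proof.
move=> a0.
have cF (x : R) : (0 < x)%R -> {for x, continuous (fun y : R => - y^-1)%R}.
  by move=> x0; apply: cvgN; apply: cvgV; [rewrite gt_eqF|exact: cvg_id].
rewrite (@ge0_continuous_FTC2y _ _ (fun y => - y^-1)%R _ 0%R) ?opprK ?sub0e ?EFinN ?oppeK//.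
- by move=> x _; rewrite invr_ge0 sqr_ge0.
- apply: continuous_in_subspaceT => x; rewrite inE/= in_itv/= andbT => ax.
  apply: cvgV; last exact: exprn_continuous.
  by rewrite sqrf_eq0 gt_eqF// (lt_le_trans a0).
- rewrite -oppr0; apply: cvgN; apply/cvgrVy.
    by near=> x; rewrite invr_gt0; near: x; exact: (nbhs_pinfty_gt (num_real 0)).
  rewrite (_ : unstable.inv_fun _ = id); first exact: cvg_id.
  by apply/funext => x; exact: invrK.
- move=> x ax; have x0 : x != 0%R by rewrite gt_eqF// (lt_trans a0).
  by apply: derivableN; exact: derivableV.
- exact: cvg_at_right_filter (cF _ a0).
- move=> x; rewrite in_itv/= andbT => ax.
  have x0 : x != 0%R by rewrite gt_eqF// (lt_trans a0).
  rewrite derive1E deriveN; last exact: derivableV.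
  by rewrite deriveV// derive_id scaleNr opprK /GRing.scale/= mulr1.
Unshelve. all: by end_near. Qed.

Lemma measurable_invsqr : measurable_fun [set: R] (fun y : R => y ^- 2)%R.
Proof.
rewrite (_ : (fun y : R => _) = fun y : R => if y == 0%R then 0%R else (y ^- 2)%R); last first.
  by apply/funext => y; case: eqP => // ->; rewrite expr0n invr0.
apply: measurable_fun_if => //.
- by apply: measurable_fun_eqr; [exact: measurable_id|exact: measurable_cst].
- rewrite setTI (_ : _ @^-1` _ = [set y : R | y != 0%R]); last first.
    by apply/seteqP; split => y /=; case: eqP.
  apply: open_continuous_measurable_fun; first exact: open_neq.
  move=> y; rewrite inE/= => y0.
  by apply: cvgV; [rewrite sqrf_eq0|exact: exprn_continuous].
Qed.

Lemma fejer_tail_le (h dl : R) : (0 < h)%R -> (0 < dl)%R ->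
  \int[leb]_(y in ~` `[(- dl)%R, dl]) (fejer (y / h)%R)%:E <= (4 * h ^+ 2 / dl)%:E.
Proof.
move=> h0 dl0.
pose f (y : R) := ((2 * h ^+ 2) * y ^- 2)%R.
have f0 y : (0 <= f y)%R.
  by rewrite /f; apply: mulr_ge0; [rewrite mulr_ge0// sqr_ge0|rewrite invr_ge0 sqr_ge0].
have kf y : y != 0%R -> (fejer (y / h) <= f y)%R.
  move=> y0; have [|/eqP] := fejer_le (y / h)%R.
    move=> /le_trans; apply; rewrite /f exprMn exprVn invfM invrK.
    by rewrite mulrCA mulrC -mulrA (mulrC (h ^+ 2)%R).
  by rewrite mulf_eq0 (negbTE y0) invr_eq0 gt_eqF.
have mf : measurable_fun [set: R] f.
  by apply: measurable_funM => //; exact: measurable_invsqr.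
have i1 : \int[leb]_(y in `[dl, +oo[) (f y)%:E = (2 * h ^+ 2 / dl)%:E.
  rewrite /f; under eq_integral do rewrite EFinM.
  rewrite ge0_integralZl//.
  - by rewrite integral_invsqr.
  - by apply/measurable_EFinP; apply: measurable_funTS; exact: measurable_invsqr.
  - by move=> y _; rewrite lee_fin invr_ge0 sqr_ge0.
  - by rewrite lee_fin mulr_ge0// sqr_ge0.
have k1 : \int[leb]_(y in `[dl, +oo[) (fejer (y / h)%R)%:E <= (2 * h ^+ 2 / dl)%:E.
  rewrite -i1; apply: ge0_le_integral => //.
  - by move=> y _; rewrite lee_fin fejer_ge0.
  - by apply/measurable_EFinP; apply: measurable_funTS; exact: measurable_fejer_scale.
  - by apply/measurable_EFinP; exact: measurable_funTS.
  - move=> y /=; rewrite in_itv/= andbT => dy.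
    by rewrite lee_fin kf// gt_eqF// (lt_le_trans dl0).
(* [g] is the right half of the tail. The kernel is even, so g(y) + g(-y) covers both halves, and
   reflection invariance makes them equal. *)
pose g (y : R) := (fejer (y / h)%R * \1_`[dl, +oo[ y)%:E.
have mg : measurable_fun [set: R] g.
  apply/measurable_EFinP/measurable_funM; first exact: measurable_fejer_scale.
  by apply: measurable_indic.
have g0 y : 0 <= g y by rewrite lee_fin mulr_ge0// fejer_ge0.
have gE : \int[leb]_y g y = \int[leb]_(y in `[dl, +oo[) (fejer (y / h)%R)%:E.
  rewrite [RHS]integral_mkcond; apply: eq_integral => y _.
  by rewrite patchE /g indicE; case: ifP => _; rewrite ?mulr1 ?mulr0.
apply: (@le_trans _ _ (\int[leb]_y (g y + g (0 - y)%R))).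
  rewrite integral_mkcond; apply: ge0_le_integral => //.
  - move=> y _; rewrite patchE; case: ifP => // _.
    by rewrite lee_fin fejer_ge0.
  - apply/(measurable_restrictT _ _).1 => //; first exact: measurableC.
    by apply/measurable_EFinP; apply: measurable_funTS; exact: measurable_fejer_scale.
  - apply: emeasurable_funD => //; apply: (measurableT_comp mg).
    exact: measurable_funB.
  - move=> y _; rewrite patchE; case: ifPn; last by rewrite adde_ge0.
    rewrite inE/= in_itv/= => /negP; rewrite negb_and -!ltNge => hy.
    rewrite /g !indicE !mem_setE !in_itv/= !andbT sub0r mulNr -EFinD lee_fin.
    rewrite /fejer oppr_eq0 cosN sqrrN -/(fejer (y / h)).
    case/orP: hy => hy.
      rewrite (_ : (dl <= - y)%R); last by lra.
      rewrite [X in (_ <= _ * X + _)%R](_ : _ = 0%R).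
        by rewrite mulr0 add0r mulr1.
      by rewrite leNgt (_ : (y < dl)%R)//; lra.
    by rewrite (ltW hy) mulr1 lerDl mulr_ge0// fejer_ge0.
rewrite ge0_integralD//; last first.
  by apply: (measurableT_comp mg); exact: measurable_funB.
rewrite (ge0_integral_reflect 0 mg g0) gE.
apply: le_trans (leeD k1 k1) _.
by rewrite -EFinD lee_fin; lra.
Qed.

(** The kernel is at least 1/4 on [-h, h]. A lower bound on the core mass is what the unsmoothing
    asks for, as its inequalities are divided by that mass. *)
Lemma fejer_core_ge (h dl : R) : (0 < h)%R -> (h <= dl)%R ->
  (h / 2)%:E <= \int[leb]_(y in `[(- dl)%R, dl]) (fejer (y / h)%R)%:E.
Proof.
move=> h0 hdl.
apply: (@le_trans _ _ (\int[leb]_(y in `[(- h)%R, h]) (4^-1)%:E)).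
  rewrite integral_cst// [X in _ * X]lebesgue_measure_itv/= lte_fin ifT; last by lra.
  by rewrite -?EFinN -?EFinD -?EFinM lee_fin; lra.
apply: (@le_trans _ _ (\int[leb]_(y in `[(- h)%R, h]) (fejer (y / h)%R)%:E)).
  apply: ge0_le_integral => //.
  - by apply/measurable_EFinP; apply: measurable_funTS; exact: measurable_fejer_scale.
  - move=> y /=; rewrite in_itv/= => /andP[y1 y2].
    rewrite lee_fin fejer_ge// normrM normfV (gtr0_norm h0) ler_pdivrMr// mul1r.
    by rewrite ler_norml y1.
apply: ge0_subset_integral => //.
- by apply/measurable_EFinP; apply: measurable_funTS; exact: measurable_fejer_scale.
- by move=> y _; rewrite lee_fin fejer_ge0.
- by move=> y /=; rewrite !in_itv/= => /andP[y1 y2]; apply/andP; split; lra.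
Qed.

Lemma fejer_core_lty (h dl : R) : (0 < h)%R ->
  \int[leb]_(y in `[(- dl)%R, dl]) (fejer (y / h)%R)%:E < +oo.
Proof.
move=> h0; apply: (@le_lt_trans _ _ (\int[leb]_(y in `[(- dl)%R, dl]) (2^-1)%:E)).
  apply: ge0_le_integral => //.
  - by move=> y _; rewrite lee_fin fejer_ge0.
  - by apply/measurable_EFinP; apply: measurable_funTS; exact: measurable_fejer_scale.
  - by move=> y _; rewrite lee_fin fejer_le_half.
rewrite integral_cst// [X in _ * X]lebesgue_measure_itv/=; case: ifP => _.
  by rewrite -?EFinN -?EFinD -?EFinM ltry.
by rewrite mule0 ltry.
Qed.

End fejer_mass.

(** * Smoothed probabilities as averages over shifted intervals *)

Section smoothing.
Context {R : realType} d (T : measurableType d) (P : probability T R) (X : T -> R).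
Hypothesis mX : measurable_fun [set: T] X.
Local Notation leb := (@lebesgue_measure R).

Definition prob_itv (u v : R) : R := fine (P [set w | u < X w <= v]).

Lemma measurable_itv_event (u v : R) : measurable [set w | u < X w <= v].
Proof.
rewrite (_ : [set _ | _] = X @^-1` `]u, v]%classic).
  by rewrite -[X in measurable X]setTI; exact: mX.
by apply/seteqP; split => w /=; rewrite in_itv.
Qed.

Lemma prob_itvE (u v : R) : (prob_itv u v)%:E = P [set w | u < X w <= v].
Proof. by rewrite /prob_itv fineK// fin_num_measure//; exact: measurable_itv_event. Qed.

Lemma prob_itv_ge0 (u v : R) : 0 <= prob_itv u v.
Proof. by rewrite /prob_itv fine_ge0. Qed.

Lemma prob_itv_le1 (u v : R) : prob_itv u v <= 1.
Proof. by rewrite -lee_fin prob_itvE probability_le1//; exact: measurable_itv_event. Qed.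

Lemma le_prob_itv (u v u' v' : R) : u' <= u -> v <= v' -> prob_itv u v <= prob_itv u' v'.
Proof.
move=> u'u vv'; rewrite -lee_fin !prob_itvE.
apply: le_measure; rewrite ?inE; try exact: measurable_itv_event.
by move=> w /= /andP[h1 h2]; rewrite (le_lt_trans u'u)// (le_trans h2).
Qed.

Lemma prob_itvD (u v w : R) : u <= v -> v <= w -> prob_itv u w = prob_itv u v + prob_itv v w.
Proof.
move=> uv vw; apply/EFin_inj; rewrite EFinD !prob_itvE -measureU//.
- congr (P _); apply/seteqP; split => t /=.
    by have [h1|h1] := leP (X t) v => /andP[-> ->]; [left|right].
  by move=> [/andP[-> /le_trans->]|/andP[h ->]]//; rewrite (le_lt_trans uv h).
- exact: measurable_itv_event.
- exact: measurable_itv_event.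
- by apply/seteqP; split => t //= [/andP[_ h1] /andP[+ _]]; rewrite ltNge h1.
Qed.

Variables (h u v : R).
Hypothesis h0 : 0 < h.

Let F (z : R * T) : R := \1_(`]u, v]%classic) z.1 * fejer ((X z.2 - z.1) / h).
Let G (z : R * T) : R := \1_(`]u, v]%classic) (X z.2 - z.1) * fejer (z.1 / h).

Let mF : measurable_fun [set: R * T] F.
Proof.
apply: measurable_funM.
  by apply: measurableT_comp => //; exact: measurable_indic.
apply: (measurableT_comp (@measurable_fejer_scale R h)).
by apply: measurable_funB => //; exact: measurableT_comp.
Qed.

Let mG : measurable_fun [set: R * T] G.
Proof.
apply: measurable_funM.
  apply: (@measurableT_comp _ _ _ _ _ _ (\1_(`]u, v]%classic) : R -> R)).
    exact: measurable_indic.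
  by apply: measurable_funB => //; exact: measurableT_comp.
by apply: (measurableT_comp (@measurable_fejer_scale R h)).
Qed.

Let F0 z : 0 <= F z. Proof. by rewrite mulr_ge0// fejer_ge0. Qed.
Let G0 z : 0 <= G z. Proof. by rewrite mulr_ge0// fejer_ge0. Qed.

Let GE y : (\int[P]_w (G (y, w))%:E =
  (fejer (y / h))%:E * (prob_itv (u + y) (v + y))%:E)%E.
Proof.
rewrite prob_itvE /G/=.
transitivity (\int[P]_w ((fejer (y / h))%:E * (\1_[set w | (u + y < X w <= v + y)%R] w)%:E))%E.
  apply: eq_integral => w _; rewrite -EFinM mulrC; congr (_ * _)%:E.
  rewrite !indicE; congr (_%:R); congr nat_of_bool.
  apply/idP/idP; rewrite !inE/= in_itv/= => /andP[h1 h2]; apply/andP; split; lra.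
have mE := measurable_itv_event (u + y) (v + y).
rewrite ge0_integralZl//.
- by rewrite integral_indic// setIT.
- by apply/measurable_EFinP; exact: measurable_indic.
- by rewrite lee_fin fejer_ge0.
Qed.

Lemma measurable_prob_itv_shift : measurable_fun [set: R]
  (fun y => ((fejer (y / h))%:E * (prob_itv (u + y) (v + y))%:E)%E).
Proof.
rewrite (_ : (fun y => _) = fubini_F P (EFin \o G)).
  by apply: measurable_fun_fubini_tonelli_F => //; exact/measurable_EFinP.
by apply/funext => y; rewrite -GE.
Qed.

Lemma integrable_fejer_mean : leb.-integrable `]u, v]
  (EFin \o (fun x => \int[P]_w fejer ((X w - x) / h))).
Proof.
have mm : measurable_fun [set: R] (fun x => \int[P]_w fejer ((X w - x) / h)).
  apply: measurableT_comp => //.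
  pose f (z : R * T) := (fejer ((X z.2 - z.1) / h))%:E.
  apply: (@measurable_fun_fubini_tonelli_F _ _ _ _ _ P f).
    apply/measurable_EFinP.
    apply: (measurableT_comp (@measurable_fejer_scale R h)).
    by apply: measurable_funB => //; exact: measurableT_comp.
  by move=> z; rewrite lee_fin fejer_ge0.
apply: measurable_bounded_integrable => //.
- by rewrite [X in (X < _)%E]lebesgue_measure_itv/=; case: ifP => _; rewrite -?EFinD ltry.
- exact: measurable_funTS.
exists (2^-1); split; first exact: num_real.
move=> K hK x _ /=; apply: le_trans (ltW hK).
apply: normr_Rintegral_le.
  apply: (measurableT_comp (@measurable_fejer_scale R h)); exact: measurable_funB.
by move=> w; rewrite ger0_norm ?fejer_ge0 ?fejer_le_half.
Qed.

(** Tonelli and, for each w, the substitution x = X w - y, which turns [F] into [G]: integrating the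
    smoothed probability over a window averages the probabilities of the shifted windows against the
    kernel. *)
Lemma smoothing_swap :
  ((\int[leb]_(x in `]u, v]) \int[P]_w fejer ((X w - x) / h))%R%:E =
  \int[leb]_y ((fejer (y / h))%:E * (prob_itv (u + y) (v + y))%:E))%E.
Proof.
rewrite /Rintegral fineK; last first.
  by apply: integrable_fin_num => //; exact: integrable_fejer_mean.
have fE x : ((fine (\int[P]_w (fejer ((X w - x) / h))%:E))%:E =
    \int[P]_w (fejer ((X w - x) / h))%:E)%E.
  rewrite fineK//; apply: integrable_fin_num => //.
  apply: (@bounded_integrable _ _ _ _ (fun w => fejer ((X w - x) / h)) (2^-1)).
    by apply: (measurableT_comp (@measurable_fejer_scale R h)); exact: measurable_funB.
  by move=> w; rewrite ger0_norm ?fejer_ge0 ?fejer_le_half.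
under eq_integral do rewrite fE.
rewrite integral_mkcond.
transitivity (\int[leb]_x \int[P]_w (F (x, w))%:E)%E.
  apply: eq_integral => x _; rewrite patchE; case: ifPn => xJ.
    by apply: eq_integral => w _; rewrite /F/= indicE xJ mul1r.
  by rewrite integral0_eq// => w _; rewrite /F/= indicE (negbTE xJ) mul0r.
transitivity (\int[P]_w \int[leb]_x (F (x, w))%:E)%E.
  by apply: (@fubini_tonelli _ _ _ _ _ leb P (EFin \o F)) => //; exact/measurable_EFinP.
transitivity (\int[P]_w \int[leb]_y (G (y, w))%:E)%E.
  apply: eq_integral => w _.
  have mFw : measurable_fun [set: R] (fun x => (F (x, w))%:E).
    by apply/measurable_EFinP; exact: measurable_fun_pair1 mF.
  rewrite -(ge0_integral_reflect (X w) mFw); last by move=> x; rewrite lee_fin.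
  apply: eq_integral => y _; rewrite /F /G/=; congr (_ * fejer (_ / _))%:E.
  by rewrite opprB addrC subrK.
transitivity (\int[leb]_y \int[P]_w (G (y, w))%:E)%E.
  apply/esym.
  by apply: (@fubini_tonelli _ _ _ _ _ leb P (EFin \o G)) => //; exact/measurable_EFinP.
by apply: eq_integral => y _; rewrite -GE.
Qed.

Variables (dl M tau : R).
Hypotheses (dl0 : 0 < dl)
  (ME : (\int[leb]_(y in `[(- dl)%R, dl]) (fejer (y / h))%:E = M%:E)%E)
  (tauE : (\int[leb]_(y in ~` `[(- dl)%R, dl]) (fejer (y / h))%:E = tau%:E)%E).

Let s : R := \int[leb]_(x in `]u, v]) \int[P]_w fejer ((X w - x) / h).

Let mk (A : set R) : measurable A -> measurable_fun A (fun y => (fejer (y / h))%:E).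
Proof.
by move=> mA; apply/measurable_EFinP; apply: measurable_funTS; exact: measurable_fejer_scale.
Qed.

Lemma smoothing_ge (p : R) : 0 <= p ->
  (forall y, - dl <= y <= dl -> p <= prob_itv (u + y) (v + y)) -> M * p <= s.
Proof.
move=> p0 hp; rewrite -lee_fin /s smoothing_swap EFinM -ME.
rewrite muleC -ge0_integralZl//; last 2 first.
- exact: mk.
- by move=> y _; rewrite lee_fin fejer_ge0.
apply: (@le_trans _ _ (\int[leb]_(y in `[(- dl)%R, dl])
    ((fejer (y / h))%:E * (prob_itv (u + y) (v + y))%:E))%E).
  apply: ge0_le_integral => //.
  - by move=> y _; rewrite -EFinM lee_fin mulr_ge0// fejer_ge0.
  - by apply: emeasurable_funM => //; exact: mk.
  - apply: measurable_funTS; exact: measurable_prob_itv_shift.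
  - move=> y /=; rewrite in_itv/= => /hp hy.
    by rewrite -!EFinM lee_fin mulrC ler_wpM2l// fejer_ge0.
apply: ge0_subset_integral => //; first exact: measurable_prob_itv_shift.
by move=> y _; rewrite -EFinM lee_fin mulr_ge0// ?fejer_ge0// prob_itv_ge0.
Qed.

(** Shifts up to dl carry the sharp bound [p]; the others carry only the crude [q], weighted by the
    tail mass [tau]. *)
Lemma smoothing_le (p q : R) : 0 <= p -> 0 <= q ->
  (forall y, - dl <= y <= dl -> prob_itv (u + y) (v + y) <= p) ->
  (forall y, prob_itv (u + y) (v + y) <= q) -> s <= M * p + tau * q.
Proof.
move=> p0 q0 hp hq; rewrite -lee_fin /s smoothing_swap EFinD !EFinM -ME -tauE.
rewrite (muleC _ p%:E) (muleC _ q%:E).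
have mC : measurable (~` `[(- dl)%R, dl] : set R) by exact: measurableC.
rewrite -ge0_integralZl//; last 2 first.
- exact: mk.
- by move=> y _; rewrite lee_fin fejer_ge0.
rewrite -ge0_integralZl//; last 2 first.
- exact: mk.
- by move=> y _; rewrite lee_fin fejer_ge0.
rewrite -(setUv `[(- dl)%R, dl]%classic) ge0_integral_setU//; last 3 first.
- by rewrite setUv; exact: measurable_prob_itv_shift.
- by move=> y _; rewrite -EFinM lee_fin mulr_ge0// ?fejer_ge0// prob_itv_ge0.
- by rewrite disj_set2E setICr eqxx.
apply: leeD; apply: ge0_le_integral => //.
- by move=> y _; rewrite -EFinM lee_fin mulr_ge0// ?fejer_ge0// prob_itv_ge0.
- by apply: measurable_funTS; exact: measurable_prob_itv_shift.
- by apply: emeasurable_funM => //; exact: mk.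
- move=> y /=; rewrite in_itv/= => /hp hy.
  by rewrite -!EFinM lee_fin mulrC ler_wpM2r// fejer_ge0.
- by move=> y _; rewrite -EFinM lee_fin mulr_ge0// ?fejer_ge0// prob_itv_ge0.
- by apply: measurable_funTS; exact: measurable_prob_itv_shift.
- by apply: emeasurable_funM => //; exact: mk.
- by move=> y _; rewrite -!EFinM lee_fin mulrC ler_wpM2r// fejer_ge0.
Qed.

End smoothing.

Ltac nneg := repeat first [assumption | done | apply: mulr_ge0 | apply: addr_ge0].

(** * Recovering interval probabilities from smoothed ones *)

Section unsmoothing.
Context {R : realType}.
Local Notation leb := (@lebesgue_measure R).
Context d1 (T1 : measurableType d1) (P1 : probability T1 R) (X : T1 -> R).
Context d2 (T2 : measurableType d2) (P2 : probability T2 R) (G : T2 -> R).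
Hypotheses (mX : measurable_fun [set: T1] X) (mG : measurable_fun [set: T2] G).
Variables (c0 e dl h : R).
Hypotheses (c00 : 0 <= c0) (e0 : 0 <= e) (h0 : 0 < h) (hdl : h <= dl).
Hypothesis Gc : forall x L : R, 0 <= L -> prob_itv P2 G x (x + L) <= c0 * L.
Hypothesis XG : forall x,
  `|\int[P1]_w fejer ((X w - x) / h) - \int[P2]_w fejer ((G w - x) / h)| <= h * e.

Let dl0 : 0 < dl. Proof. exact: lt_le_trans h0 hdl. Qed.

(** These bounds make tau / M at most 8 h / dl, so a kernel narrow compared with dl leaks little.
    This is the origin of the factor 8 below, and of 72 once the concentration bound contributes
    9. *)
Let mass : exists M tau : R,
  [/\ (\int[leb]_(y in `[(- dl)%R, dl]) (fejer (y / h))%:E = M%:E)%E,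
      (\int[leb]_(y in ~` `[(- dl)%R, dl]) (fejer (y / h))%:E = tau%:E)%E,
      h / 2 <= M & 0 <= tau <= 4 * h ^+ 2 / dl].
Proof.
have M1 := fejer_core_ge h0 hdl.
have M2 := @fejer_core_lty R h dl h0.
have t1 := fejer_tail_le h0 dl0.
have Mf : (\int[leb]_(y in `[(- dl)%R, dl]) (fejer (y / h))%:E)%E \is a fin_num.
  by rewrite ge0_fin_numE// integral_ge0// => y _; rewrite lee_fin fejer_ge0.
have tge0 : (0 <= \int[leb]_(y in ~` `[(- dl)%R, dl]) (fejer (y / h))%:E)%E.
  by rewrite integral_ge0// => y _; rewrite lee_fin fejer_ge0.
have tf : (\int[leb]_(y in ~` `[(- dl)%R, dl]) (fejer (y / h))%:E)%E \is a fin_num.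
  by rewrite ge0_fin_numE// (le_lt_trans t1)// ltry.
exists (fine (\int[leb]_(y in `[(- dl)%R, dl]) (fejer (y / h))%:E)%E).
exists (fine (\int[leb]_(y in ~` `[(- dl)%R, dl]) (fejer (y / h))%:E)%E).
by split; rewrite -?lee_fin ?fineK// tge0.
Qed.

Let smooth_dist (u v : R) : u <= v ->
  `|\int[leb]_(x in `]u, v]) (\int[P1]_w fejer ((X w - x) / h)) -
    \int[leb]_(x in `]u, v]) (\int[P2]_w fejer ((G w - x) / h))| <= h * e * (v - u).
Proof.
move=> uv.
have i1 := @integrable_fejer_mean _ _ _ P1 X mX h u v.
have i2 := @integrable_fejer_mean _ _ _ P2 G mG h u v.
have lE : fine (leb `]u, v]%classic) = v - u.
  rewrite [X in fine X]lebesgue_measure_itv/= lte_fin.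
  by move: uv; rewrite le_eqVlt => /predU1P[->|->]//; rewrite ltxx subrr.
rewrite -RintegralB//; apply: le_trans (le_normr_Rintegral _ _) _ => //.
  exact: integrableB i1 i2.
rewrite -lE -(Rintegral_cst leb (measurable_itv `]u, v])).
apply: le_Rintegral => //.
- exact: integrable_norm (integrableB _ i1 i2).
- apply: measurable_bounded_integrable => //.
    by rewrite [X in (X < _)%E]lebesgue_measure_itv/=; case: ifP => _; rewrite -?EFinD ltry.
  exists (h * e); split; first exact: num_real.
  by move=> K hK x _ /=; rewrite ger0_norm ?mulr_ge0 ?(ltW h0)// ltW.
Qed.

Let pX := prob_itv P1 X.
Let pG := prob_itv P2 G.

(** The window is enlarged by dl on each side: shifted by at most dl, it still contains ]x, x + L]
    and stays inside ]x - 2 dl, x + L + 2 dl]. *)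
Lemma unsmooth_le (x L : R) : 0 <= L -> pX x (x + L) <=
  pG (x - 2 * dl) (x + L + 2 * dl) + (8 * (h / dl) * c0 + 2 * e) * (L + 2 * dl).
Proof.
move=> L0; have [M [tau [ME tauE hM /andP[tau0 taul]]]] := mass.
have M0 : 0 < M by apply: lt_le_trans hM; rewrite divr_gt0.
have L2 : 0 <= L + 2 * dl by have := ltW dl0; lra.
have := @smoothing_ge _ _ _ P1 X mX h (x - dl) (x + L + dl) dl M ME
  (pX x (x + L)) (prob_itv_ge0 _ _ _ _).
have H1 y : - dl <= y <= dl -> pX x (x + L) <= prob_itv P1 X (x - dl + y) (x + L + dl + y).
  by move=> /andP[y1 y2]; apply: le_prob_itv => //; lra.
move=> /(_ H1) sX.
have := @smoothing_le _ _ _ P2 G mG h (x - dl) (x + L + dl) dl M tau ME tauE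
  (pG (x - 2 * dl) (x + L + 2 * dl)) (c0 * (L + 2 * dl)) (prob_itv_ge0 _ _ _ _)
  (mulr_ge0 c00 L2).
have H2 y : - dl <= y <= dl ->
    prob_itv P2 G (x - dl + y) (x + L + dl + y) <= pG (x - 2 * dl) (x + L + 2 * dl).
  by move=> /andP[y1 y2]; apply: le_prob_itv => //; lra.
have H3 y : prob_itv P2 G (x - dl + y) (x + L + dl + y) <= c0 * (L + 2 * dl).
  have := @Gc (x - dl + y) (L + 2 * dl) L2.
  by congr (prob_itv _ _ _ _ <= _); ring.
move=> /(_ H2 H3) sG.
have uv : x - dl <= x + L + dl by have := ltW dl0; lra.
have := smooth_dist uv; rewrite ler_norml => /andP[_ sXG].
have key : M * pX x (x + L) <= M * (pG (x - 2 * dl) (x + L + 2 * dl) +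
    (8 * (h / dl) * c0 + 2 * e) * (L + 2 * dl)).
  apply: le_trans sX _.
  have E1 : tau * (c0 * (L + 2 * dl)) <= M * (8 * (h / dl)) * (c0 * (L + 2 * dl)).
    rewrite ler_wpM2r ?mulr_ge0//; apply: le_trans taul _.
    rewrite (_ : 4 * h ^+ 2 / dl = (h / 2) * (8 * (h / dl))); last by field; rewrite gt_eqF.
    by rewrite ler_wpM2r// !mulr_ge0// ?invr_ge0 ltW.
  have E2 : h * e * (x + L + dl - (x - dl)) <= M * (2 * e) * (L + 2 * dl).
    rewrite (_ : x + L + dl - (x - dl) = L + 2 * dl); last by ring.
    rewrite ler_wpM2r// mulrA ler_wpM2r//; lra.
  rewrite mulrDr; lra.
by rewrite -(ler_pM2l M0).
Qed.

(* The crude bound for X that controls the tail of the kernel in the lower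
   half of [unsmooth]. *)
Lemma unsmooth_concentration (x L : R) : 0 <= L ->
  pX x (x + L) <= 9 * (c0 + e) * (L + 4 * dl).
Proof.
move=> L0; apply: le_trans (unsmooth_le x L0) _.
have L4 : 0 <= L + 4 * dl by have := ltW dl0; lra.
have := @Gc (x - 2 * dl) (L + 4 * dl) L4.
rewrite (_ : x - 2 * dl + (L + 4 * dl) = x + L + 2 * dl); last by ring.
have hd : h / dl <= 1 by rewrite ler_pdivrMr// mul1r.
have : (8 * (h / dl) * c0 + 2 * e) * (L + 2 * dl) <= (8 * c0 + 2 * e) * (L + 4 * dl).
  apply: ler_pM.
  - by rewrite addr_ge0// !mulr_ge0// ?invr_ge0 ltW.
  - by have := ltW dl0; lra.
  - rewrite lerD2r ler_wpM2r// -[leRHS]mulr1 ler_wpM2l//.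
  - by have := ltW dl0; lra.
have : 0 <= e * (L + 4 * dl) by exact: mulr_ge0.
rewrite -/pG; lra.
Qed.

(** The upper half is [unsmooth_le], its margins charged to [Gc]. For the lower half the window is
    shrunk by dl on each side and the roles of [X] and [G] are exchanged. *)
Lemma unsmooth (x L : R) : 0 <= L -> `|pX x (x + L) - pG x (x + L)| <=
  4 * dl * c0 + 2 * e * (L + 2 * dl) + 72 * (h / dl) * (c0 + e) * (L + 4 * dl).
Proof.
move=> L0; have dl0' := ltW dl0.
have r0 : 0 <= h / dl by rewrite divr_ge0// ltW.
have ce0 : 0 <= c0 + e by rewrite addr_ge0.
have L4 : 0 <= L + 4 * dl by lra.
have L2 : 0 <= L + 2 * dl by lra.
have A1 : 0 <= 2 * e * (L + 2 * dl) by rewrite !mulr_ge0.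
have A2 : 0 <= 72 * (h / dl) * (c0 + e) * (L + 4 * dl).
  by nneg.
rewrite ler_norml; apply/andP; split; last first.
  rewrite lerBlDr; apply: le_trans (unsmooth_le x L0) _.
  have B1 : pG (x - 2 * dl) (x + L + 2 * dl) <= pG x (x + L) + 4 * dl * c0.
    rewrite /pG (@prob_itvD _ _ _ P2 G mG (x - 2 * dl) x); [|lra|lra].
    rewrite (@prob_itvD _ _ _ P2 G mG x (x + L)); [|lra|lra].
    have := @Gc (x - 2 * dl) (2 * dl); rewrite subrK => /(_ ltac:(lra)).
    have := @Gc (x + L) (2 * dl) ltac:(lra).
    lra.
  have B2 : 8 * (h / dl) * c0 * (L + 2 * dl) <= 72 * (h / dl) * (c0 + e) * (L + 4 * dl).
    apply: ler_pM; [nneg|nneg| |lra].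
    apply: ler_pM; [nneg|nneg| |by rewrite lerDl].
    by apply: ler_wpM2r => //; lra.
  lra.
rewrite lerBrDr.
(* For a short interval ]x + 2 dl, x + L - 2 dl] may be empty; there the term 4 dl c0 alone bounds
   the probability for [G]. *)
have [L4d|L4d] := leP L (4 * dl).
  have : pG x (x + L) <= 4 * dl * c0.
    apply: le_trans (Gc x L0) _.
    by rewrite mulrC ler_wpM2r.
  have := prob_itv_ge0 P1 X x (x + L); rewrite -/(pX _ _); lra.
have [M [tau [ME tauE hM /andP[tau0 taul]]]] := mass.
have M0 : 0 < M by apply: lt_le_trans hM; rewrite divr_gt0.
have := @smoothing_ge _ _ _ P2 G mG h (x + dl) (x + L - dl) dl M ME
  (pG (x + 2 * dl) (x + L - 2 * dl)) (prob_itv_ge0 _ _ _ _).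
have H1 y : - dl <= y <= dl ->
    pG (x + 2 * dl) (x + L - 2 * dl) <= prob_itv P2 G (x + dl + y) (x + L - dl + y).
  by move=> /andP[y1 y2]; apply: le_prob_itv => //; lra.
move=> /(_ H1) sG.
have q0 : 0 <= 9 * (c0 + e) * (L + 4 * dl) by nneg.
have := @smoothing_le _ _ _ P1 X mX h (x + dl) (x + L - dl) dl M tau ME tauE
  (pX x (x + L)) (9 * (c0 + e) * (L + 4 * dl)) (prob_itv_ge0 _ _ _ _) q0.
have H2 y : - dl <= y <= dl ->
    prob_itv P1 X (x + dl + y) (x + L - dl + y) <= pX x (x + L).
  by move=> /andP[y1 y2]; apply: le_prob_itv => //; lra.
have H3 y : prob_itv P1 X (x + dl + y) (x + L - dl + y) <= 9 * (c0 + e) * (L + 4 * dl).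
  apply: le_trans (_ : pX (x + dl + y) (x + dl + y + L) <= _).
    by apply: le_prob_itv => //; lra.
  exact: unsmooth_concentration.
move=> /(_ H2 H3) sX.
have uv : x + dl <= x + L - dl by lra.
have := smooth_dist uv; rewrite ler_norml => /andP[sXG _].
have B1 : pG x (x + L) <= pG (x + 2 * dl) (x + L - 2 * dl) + 4 * dl * c0.
  rewrite /pG (@prob_itvD _ _ _ P2 G mG x (x + 2 * dl)); [|lra|lra].
  rewrite (@prob_itvD _ _ _ P2 G mG (x + 2 * dl) (x + L - 2 * dl)); [|lra|lra].
  have := @Gc x (2 * dl) ltac:(lra).
  have := @Gc (x + L - 2 * dl) (2 * dl); rewrite subrK => /(_ ltac:(lra)).
  lra.
have key : M * pG (x + 2 * dl) (x + L - 2 * dl) <= M * (pX x (x + L) +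
    2 * e * (L + 2 * dl) + 72 * (h / dl) * (c0 + e) * (L + 4 * dl)).
  apply: le_trans sG _.
  have E1 : tau * (9 * (c0 + e) * (L + 4 * dl)) <=
      M * (72 * (h / dl) * (c0 + e) * (L + 4 * dl)).
    rewrite (_ : M * _ = M * (8 * (h / dl)) * (9 * (c0 + e) * (L + 4 * dl))); last by ring.
    rewrite ler_wpM2r//; apply: le_trans taul _.
    rewrite (_ : 4 * h ^+ 2 / dl = (h / 2) * (8 * (h / dl))); last by field; rewrite gt_eqF.
    by apply: ler_wpM2r => //; nneg.
  have E2 : h * e * (x + L - dl - (x + dl)) <= M * (2 * e * (L + 2 * dl)).
    rewrite (_ : M * _ = M * (2 * e) * (L + 2 * dl)); last by ring.
    apply: ler_pM; [by apply: mulr_ge0 => //; exact: ltW|lra| |lra].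
    by rewrite mulrA ler_wpM2r//; lra.
  rewrite !mulrDr; lra.
rewrite ler_pM2l// in key.
lra.
Qed.

End unsmoothing.

(** * Independence and the random walk *)

Section independence.
Context d (T : measurableType d) d' (T' : measurableType d') (R : realType).
Context (P : probability T R) (Z : nat -> {RV P >-> T'}).

(* Cylinders over the coordinates in J; padding with setT keeps the
   intersection over all of nat. *)
Definition cylinders (J : set nat) : set (set T) := [set E | exists A : nat -> set T',
  [/\ forall k, measurable (A k), forall k, ~ J k -> A k = setT,
      exists n, forall k, (n <= k)%N -> A k = setT &
      E = \bigcap_k (Z k @^-1` A k)]].

(* [f] is a function of the coordinates [Z k], [k] in [J], only. *)
Definition known d2 (T2 : measurableType d2) (J : set nat) (f : T -> T2) :=
  @measurable_fun _ _ (g_sigma_algebraType (cylinders J)) T2 [set: T] f.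

Let mZ k (A : set T') : measurable A -> measurable (Z k @^-1` A).
Proof. by move=> mA; rewrite -[X in measurable X]setTI; exact: measurable_funPT. Qed.

Lemma cylinders_measurable J : cylinders J `<=` measurable.
Proof.
move=> _ [A [mA _ _ ->]]; apply: bigcapT_measurable => k; exact: mZ.
Qed.

Lemma cylinders_setI J : setI_closed (cylinders J).
Proof.
move=> _ _ [A [mA AJ [n An] ->]] [B [mB BJ [m Bm] ->]].
exists (fun k => A k `&` B k); split.
- by move=> k; exact: measurableI.
- by move=> k Jk; rewrite AJ// BJ// setTI.
- exists (maxn n m) => k; rewrite geq_max => /andP[nk mk].
  by rewrite An// Bm// setTI.
- by rewrite -bigcapI; apply: eq_bigcapr => k _; rewrite preimage_setI.
Qed.

Lemma cylinders_setT J : cylinders J setT.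
Proof.
exists (fun _ => setT); split => //; first by exists 0%N.
by apply/esym; rewrite bigcapT// => k _; exact: preimage_setT.
Qed.

Lemma cylinders_sub J K : J `<=` K -> cylinders J `<=` cylinders K.
Proof.
move=> JK _ [A [mA AJ An ->]]; exists A; split => // k Kk.
by apply: AJ => /JK.
Qed.

Lemma sigma_cylinders_measurable J : <<s cylinders J >> `<=` measurable.
Proof.
apply: smallest_sub; first exact: sigma_algebra_measurable.
exact: cylinders_measurable.
Qed.

Lemma known_preimage d2 (T2 : measurableType d2) (J : set nat) (f : T -> T2) A :
  known J f -> measurable A -> <<s cylinders J >> (f @^-1` A).
Proof. by move=> kf mA; rewrite -[X in <<s _ >> X]setTI; exact: kf. Qed.

Lemma known_measurable d2 (T2 : measurableType d2) (J : set nat) (f : T -> T2) :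
  known J f -> measurable_fun [set: T] f.
Proof.
move=> kf _ A mA; rewrite setTI.
by apply: (@sigma_cylinders_measurable J); exact: known_preimage.
Qed.

Lemma known_Z J k : J k -> known J (Z k).
Proof.
move=> Jk _ A mA; rewrite setTI; apply: sub_sigma_algebra.
exists (fun i => if i == k then A else setT); split.
- by move=> i; case: ifP.
- by move=> i Ji; case: eqP => // ik; rewrite ik in Ji.
- by exists k.+1 => i ki; case: eqP => // ik; rewrite ik ltnn in ki.
- apply/seteqP; split => w /=.
    by move=> Aw i _ /=; case: eqP => // ->.
  by move=> /(_ k Logic.I) /=; rewrite eqxx.
Qed.

Hypothesis indepZ : mutually_independent Z.

Let prob_cylinder (A : nat -> set T') n : (forall k, measurable (A k)) ->
  (forall k, (n <= k)%N -> A k = setT) ->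
  P (\bigcap_k (Z k @^-1` A k)) = (\prod_(k <- iota 0 n) P (Z k @^-1` A k))%E.
Proof.
move=> mA An.
transitivity (P (\bigcap_(i in [set` [fset k in iota 0 n]%fset]) (Z i @^-1` A i))).
  congr (P _); apply/seteqP; split => w /= Aw i; first by move=> _; exact: Aw.
  move=> _ /=; have [ni|ni] := leqP n i; first by rewrite An.
  by apply: Aw => /=; rewrite in_fset mem_iota.
rewrite indepZ//; apply: perm_big; apply: uniq_perm => //.
  exact: iota_uniq.
by move=> k; rewrite in_fset.
Qed.

Lemma cylinders_indep (J K : set nat) E F : J `&` K = set0 ->
  cylinders J E -> cylinders K F -> P (E `&` F) = (P E * P F)%E.
Proof.
move=> JK [A [mA AJ [n An] ->]] [B [mB BJ [m Bm] ->]].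
have nA k : (maxn n m <= k)%N -> A k = setT by rewrite geq_max => /andP[/An].
have nB k : (maxn n m <= k)%N -> B k = setT by rewrite geq_max => /andP[_ /Bm].
rewrite (prob_cylinder mA nA) (prob_cylinder mB nB) -big_split/= -bigcapI.
rewrite (@eq_bigcapr _ _ _ _ (fun k => Z k @^-1` (A k `&` B k))); last first.
  by move=> k _; rewrite preimage_setI.
rewrite (@prob_cylinder (fun k => A k `&` B k) (maxn n m)); last 2 first.
- by move=> k; exact: measurableI.
- by move=> k nk; rewrite nA// nB// setTI.
apply: eq_bigr => k _.
have [Jk|Jk] := pselect (J k).
  rewrite (BJ k) ?setIT ?preimage_setT ?[X in (_ * X)%E]probability_setT ?mule1//.
  by move=> Kk; have : (J `&` K) k by []; rewrite JK.
by rewrite (AJ k)// setTI preimage_setT [X in (X * _)%E]probability_setT mul1e.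
Qed.

(** For fixed F, both sides are finite measures in E that agree on the cylinders, a family stable
    under intersection; hence they agree on the generated sigma-algebra. *)
Let indep_ext (J : set nat) (F : set T) : measurable F ->
  (forall E, cylinders J E -> P (E `&` F) = (P E * P F)%E) ->
  forall E, <<s cylinders J >> E -> P (E `&` F) = (P E * P F)%E.
Proof.
move=> mF H E sE.
have PF0 : 0 <= fine (P F) by rewrite fine_ge0.
pose m2 := mscale (NngNum PF0) P.
have m2E A : m2 A = (P A * P F)%E.
  by rewrite /m2 /mscale/= fineK ?fin_num_measure// muleC.
have cov : \bigcup_(k : nat) setT = setT :> set T by rewrite bigcup_const//; exists 0%N.
have -> : P (E `&` F) = mrestr P mF E by [].
rewrite (@g_sigma_algebra_measure_unique _ R T (cylinders J) (@cylinders_measurable J)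
  (fun _ => setT) (fun _ => cylinders_setT J) cov (mrestr P mF) m2 (@cylinders_setI J))//.
- by move=> A /H HA; exact: (etrans HA (esym (m2E A))).
- by move=> k; rewrite /= /mrestr setTI (le_lt_trans (probability_le1 _ _))// ltry.
Qed.

Lemma sigma_cylinders_indep (J K : set nat) E F : J `&` K = set0 ->
  <<s cylinders J >> E -> <<s cylinders K >> F -> P (E `&` F) = (P E * P F)%E.
Proof.
move=> JK sE sF.
apply: (indep_ext (sigma_cylinders_measurable sF) _ sE) => {sE}E cE.
rewrite setIC muleC.
apply: (indep_ext (cylinders_measurable cE) _ sF) => {sF}F cF.
by rewrite setIC muleC; exact: cylinders_indep cE cF.
Qed.

Lemma known_indep d2 (T2 : measurableType d2) d3 (T3 : measurableType d3)
    (J K : set nat) (X : T -> T2) (Y : T -> T3) A B :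
  J `&` K = set0 -> known J X -> known K Y -> measurable A -> measurable B ->
  P (X @^-1` A `&` Y @^-1` B) = (P (X @^-1` A) * P (Y @^-1` B))%E.
Proof.
by move=> JK kX kY mA mB; apply: sigma_cylinders_indep JK _ _; exact: known_preimage.
Qed.

End independence.

(** * Expectations and sums of independent pairs *)

Section pair_law.
Context {R : realType} d (T : measurableType d) (P : probability T R).

Definition indep2 (X Y : T -> R) := forall A B : set R, measurable A -> measurable B ->
  P (X @^-1` A `&` Y @^-1` B) = (P (X @^-1` A) * P (Y @^-1` B))%E.

(** Independence makes the law of the pair agree with the product of the laws on rectangles, hence
    everywhere; the rest is Tonelli. *)
Let ge0_integral_rv (X Y : {RV P >-> R}) (f : R * R -> \bar R) : indep2 X Y ->
  measurable_fun [set: R * R] f -> (forall z, (0 <= f z)%E) ->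
  (\int[P]_w f (X w, Y w) = \int[P]_w' \int[P]_w f (X w, Y w'))%E.
Proof.
move=> XY mf f0.
pose W : {RV P >-> (R * R)%type} := random_vector X Y.
transitivity (\int[distribution P W]_z f z)%E.
  by rewrite ge0_integral_distribution.
transitivity (\int[distribution P X \x distribution P Y]_z f z)%E.
  apply: eq_measure_integral => A mA _; apply/esym.
  exact: product_measure_unique.
rewrite (fubini_tonelli2 f)//.
rewrite ge0_integral_distribution//; last 2 first.
- exact: measurable_fun_fubini_tonelli_G.
- by move=> y; exact: integral_ge0.
apply: eq_integral => w' _ /=.
rewrite /fubini_G ge0_integral_distribution//.
exact: measurable_fun_pair1.
Qed.

(** Tonelli for |XY| gives integrability, after which Fubini under the product law factors the
    expectation. *)
Let RintegralM_rv (X Y : {RV P >-> R}) : indep2 X Y ->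
  P.-integrable [set: T] (EFin \o X) -> P.-integrable [set: T] (EFin \o Y) ->
  P.-integrable [set: T] (EFin \o (fun w => X w * Y w)) /\
  \int[P]_w (X w * Y w) = (\int[P]_w X w) * (\int[P]_w Y w).
Proof.
move=> XY iX iY.
pose f (z : R * R) : \bar R := (z.1 * z.2)%:E.
have mf : measurable_fun [set: R * R] f.
  by apply/measurable_EFinP; exact: measurable_funM.
have iXY : P.-integrable [set: T] (EFin \o (fun w => X w * Y w)).
  apply/integrableP; split.
    by apply/measurable_EFinP; exact: measurable_funM.
  have := @ge0_integral_rv X Y (fun z => `|f z|)%E XY (measurableT_comp _ mf) (fun=> abse_ge0 _).
  move=> -> //.
  under eq_integral => w' _.
    under eq_integral do rewrite /f/= normrM EFinM muleC.
    rewrite ge0_integralZl//; last first.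
      by apply/measurable_EFinP; apply: measurableT_comp.
    over.
  rewrite ge0_integralZr//; last 2 first.
  - by apply/measurable_EFinP; apply: measurableT_comp.
  - exact: integral_ge0.
  move/integrableP : iX => [_ iX]; move/integrableP : iY => [_ iY].
  by apply: lte_mul_pinfty => //; [exact: integral_ge0|rewrite ge0_fin_numE//; exact: integral_ge0].
split=> //.
pose W : {RV P >-> (R * R)%type} := random_vector X Y.
have iXd : (distribution P X).-integrable [set: R] (EFin \o id).
  apply/integrableP; split; first exact/measurable_EFinP.
  rewrite ge0_integral_distribution//; last by apply/measurable_EFinP; exact: measurableT_comp.
  by move/integrableP : iX => [].
have iYd : (distribution P Y).-integrable [set: R] (EFin \o id).
  apply/integrableP; split; first exact/measurable_EFinP.
  rewrite ge0_integral_distribution//; last by apply/measurable_EFinP; exact: measurableT_comp.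
  by move/integrableP : iY => [].
have eqm (g : R * R -> \bar R) : (\int[distribution P W]_z g z =
    \int[distribution P X \x distribution P Y]_z g z)%E.
  apply: eq_measure_integral => A mA _; apply/esym.
  exact: product_measure_unique.
have iW : (distribution P X \x distribution P Y)%E.-integrable [set: R * R] f.
  apply/integrableP; split => //.
  rewrite -eqm ge0_integral_distribution//; last exact: measurableT_comp.
  by move/integrableP : iXY => [].
apply/EFin_inj; rewrite /Rintegral.
rewrite fineK; last exact: integrable_fin_num iXY.
rewrite EFinM !fineK; [|exact: integrable_fin_num iY|exact: integrable_fin_num iX].
transitivity (\int[distribution P W]_z f z)%E.
  by rewrite integral_distribution.
have EYE : (\int[distribution P Y]_y y%:E)%E = (fine (\int[P]_w (Y w)%:E))%:E.
  rewrite fineK; last exact: integrable_fin_num iY.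
  by rewrite (@integral_distribution _ _ _ _ _ P Y EFin)//; exact/measurable_EFinP.
rewrite eqm -integral12_prod_meas1//.
transitivity (\int[distribution P X]_x ((fine (\int[P]_w (Y w)%:E))%:E * x%:E))%E.
  apply: eq_integral => x _; rewrite /fubini_F /f/=.
  by rewrite -EYE muleC -integralZl.
rewrite integralZl// muleC fineK; last exact: integrable_fin_num iY.
congr (_ * _)%E.
by rewrite (@integral_distribution _ _ _ _ _ P X EFin)//; exact/measurable_EFinP.
Qed.

Variables X Y : T -> R.
Hypotheses (mX : measurable_fun [set: T] X) (mY : measurable_fun [set: T] Y).
Hypothesis XY : indep2 X Y.

Lemma indep2_ge0_integral (f : R * R -> \bar R) :
  measurable_fun [set: R * R] f -> (forall z, (0 <= f z)%E) ->
  (\int[P]_w f (X w, Y w) = \int[P]_w' \int[P]_w f (X w, Y w'))%E.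
Proof.
pose X' : {RV P >-> R} := mfun_Sub (mem_set mX).
pose Y' : {RV P >-> R} := mfun_Sub (mem_set mY).
exact: (@ge0_integral_rv X' Y' f XY).
Qed.

Lemma indep2_RintegralM :
  P.-integrable [set: T] (EFin \o X) -> P.-integrable [set: T] (EFin \o Y) ->
  P.-integrable [set: T] (EFin \o (fun w => X w * Y w)) /\
  \int[P]_w (X w * Y w) = (\int[P]_w X w) * (\int[P]_w Y w).
Proof.
pose X' : {RV P >-> R} := mfun_Sub (mem_set mX).
pose Y' : {RV P >-> R} := mfun_Sub (mem_set mY).
exact: (@RintegralM_rv X' Y' XY).
Qed.

Let f (u v : R) (z : R * R) : \bar R :=
  (\1_(`]u, v]%classic) (z.1 + z.2))%:E.

Let mf u v : measurable_fun [set: R * R] (f u v).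
Proof.
apply/measurable_EFinP.
apply: (@measurableT_comp _ _ _ _ _ _ (\1_(`]u, v]%classic) : R -> R)).
  exact: measurable_indic.
exact: measurable_funD.
Qed.

Let fE u v w' : (\int[P]_w f u v (X w, Y w') = (prob_itv P X (u - Y w') (v - Y w'))%:E)%E.
Proof.
rewrite prob_itvE// -(setIT [set w | _]) -integral_indic//; last exact: measurable_itv_event.
apply: eq_integral => w _; rewrite /f/= !indicE; congr (_%:R%:E); congr nat_of_bool.
by apply/idP/idP; rewrite !inE/= in_itv/= => /andP[h1 h2]; apply/andP; split; lra.
Qed.

Lemma measurable_prob_itv_sub (u v : R) :
  measurable_fun [set: T] (fun w' => prob_itv P X (u - Y w') (v - Y w')).
Proof.
apply/measurable_EFinP.
rewrite (_ : _ \o _ = fubini_G P (fun z : T * T => f u v (X z.1, Y z.2))); last first.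
  by apply/funext => w' /=; rewrite -fE.
apply: measurable_fun_fubini_tonelli_G => [|z]; last by rewrite lee_fin.
apply: (measurableT_comp (mf u v)).
by apply: measurable_fun_pair; exact: measurableT_comp.
Qed.

(** Conditioning on Y. An estimate for the intervals of X that is uniform in position can thus be
    integrated against an independent shift. *)
Lemma prob_itv_sum (u v : R) : prob_itv P (fun w => X w + Y w) u v =
  \int[P]_w' prob_itv P X (u - Y w') (v - Y w').
Proof.
apply/EFin_inj; rewrite prob_itvE; last exact: measurable_funD.
rewrite /Rintegral fineK; last first.
  apply: integrable_fin_num => //; apply: (@bounded_integrable _ _ _ _ _ 1).
    exact: measurable_prob_itv_sub.
  by move=> w; rewrite ger0_norm ?prob_itv_ge0// prob_itv_le1.
under [RHS]eq_integral do rewrite -fE.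
rewrite -indep2_ge0_integral//; last by move=> z; rewrite lee_fin.
rewrite -(setIT [set w | _]) -integral_indic//.
exact: (measurable_itv_event (measurable_funD mX mY)).
Qed.

End pair_law.

(** * Real-valued probabilities and Chebyshev's inequality *)

Section fine_probability.
Context d (T : measurableType d) (R : realType) (P : probability T R).
Implicit Types A B : set T.

Definition pr A : R := fine (P A).

Lemma prE A : measurable A -> (pr A)%:E = P A.
Proof. by move=> mA; rewrite /pr fineK// fin_num_measure. Qed.

Lemma pr_ge0 A : 0 <= pr A. Proof. by rewrite /pr fine_ge0. Qed.

Lemma pr_le1 A : measurable A -> pr A <= 1.
Proof. by move=> mA; rewrite -lee_fin prE// probability_le1. Qed.

Lemma pr0 : pr set0 = 0. Proof. by rewrite /pr measure0. Qed.

Lemma le_pr A B : measurable A -> measurable B -> A `<=` B -> pr A <= pr B.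
Proof. by move=> mA mB AB; rewrite -lee_fin !prE//; apply: le_measure; rewrite ?inE. Qed.

Lemma prU A B : measurable A -> measurable B -> A `&` B = set0 ->
  pr (A `|` B) = pr A + pr B.
Proof.
move=> mA mB AB; apply/EFin_inj; rewrite EFinD !prE//; last exact: measurableU.
by rewrite measureU.
Qed.

Lemma prU_le A B : measurable A -> measurable B -> pr (A `|` B) <= pr A + pr B.
Proof.
move=> mA mB; rewrite -lee_fin EFinD !prE//; last exact: measurableU.
exact: measureU2.
Qed.

Lemma prC A : measurable A -> pr (~` A) = 1 - pr A.
Proof.
move=> mA; apply/EFin_inj; rewrite EFinB !prE//; last exact: measurableC.
by rewrite probability_setC.
Qed.

Lemma pr_bigU_le n (A : nat -> set T) : (forall i, measurable (A i)) ->
  pr (\bigcup_(i < n) A i) <= \sum_(i < n) pr (A i).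
Proof.
move=> mA; elim: n => [|n IH].
  by rewrite bigcup_mkord !big_ord0 pr0.
rewrite big_ord_recr/=; apply: le_trans (lerD IH (lexx _)).
rewrite bigcup_mkord big_ord_recr/= -bigcup_mkord.
by apply: prU_le => //; apply: bigcup_measurable.
Qed.

Lemma pr_Rintegral A : measurable A -> \int[P]_w (\1_A w : R) = pr A.
Proof. by move=> mA; rewrite /Rintegral integral_indic// setIT. Qed.

Lemma measurable_gt_norm (X : T -> R) c : measurable_fun [set: T] X ->
  measurable [set w | c < `|X w|].
Proof.
move=> mX; rewrite -[X in measurable X]setTI.
apply: measurable_fun_ltr => //; exact: measurableT_comp.
Qed.

Lemma pr_chebyshev (X : T -> R) (L : R) : measurable_fun [set: T] X -> 0 < L ->
  P.-integrable [set: T] (EFin \o (fun w => X w ^+ 2)) ->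
  pr [set w | L < `|X w|] <= (\int[P]_w (X w ^+ 2)) / L ^+ 2.
Proof.
move=> mX L0 iX2; rewrite ler_pdivlMr ?exprn_gt0//.
have mE := measurable_gt_norm L mX.
rewrite -pr_Rintegral// -RintegralZr//; last first.
  apply: (@bounded_integrable _ _ _ _ _ 1); first exact: measurable_indic.
  by move=> w; rewrite indicE; case: (_ \in _); rewrite ?normr1 ?normr0.
apply: le_Rintegral => //.
  apply: (@bounded_integrable _ _ _ _ _ (L ^+ 2)).
    by apply: measurable_funM => //; exact: measurable_indic.
  move=> w; rewrite indicE normrM (ger0_norm (sqr_ge0 L)).
  by case: (_ \in _); rewrite ?normr1 ?normr0 ?mul1r ?mul0r ?sqr_ge0.
move=> w _; rewrite indicE.
have [wE|_] := boolP (w \in [set w | L < `|X w|]); last by rewrite mul0r sqr_ge0.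
move: wE; rewrite inE/= mul1r -(real_normK (num_real (X w))) => Lw.
by rewrite ler_pXn2r// ?nnegrE ltW.
Qed.

End fine_probability.

(** * Moments and a maximal inequality for the walk *)

Section random_walk.
Context d (T : measurableType d) d' (T' : measurableType d') (R : realType).
Context (P : probability T R) (Z : nat -> {RV P >-> T'}).
Hypothesis indepZ : mutually_independent Z.
Variable Y : nat -> T -> R.
Hypothesis kY : forall k (J : set nat), J k -> known Z J (Y k).

Local Notation pr := (pr P).

Definition psum (p m : nat) (w : T) : R := \sum_(i < m) Y (p + i) w.

Definition block (p m : nat) : set nat := [set k | (p <= k < p + m)%N].

Lemma block_disj p m k : block p m `&` block (p + m) k = set0.
Proof.
apply/seteqP; split => i //= [/andP[_ h1] /andP[h2 _]].
by rewrite ltnNge h2 in h1.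
Qed.

Lemma psumS p m w : psum p m.+1 w = psum p m w + Y (p + m) w.
Proof. by rewrite /psum big_ord_recr. Qed.

Lemma psum0 p w : psum p 0 w = 0. Proof. by rewrite /psum big_ord0. Qed.

Lemma psumD p m k w : psum p (m + k) w = psum p m w + psum (p + m) k w.
Proof. by rewrite /psum big_split_ord/=; congr (_ + _); apply: eq_bigr => i _; rewrite addnA. Qed.

Lemma known_psum p m (J : set nat) : block p m `<=` J -> known Z J (psum p m).
Proof.
move=> bJ; apply: measurable_sum => i; apply: kY; apply: bJ.
by rewrite /block/= leq_addr ltn_add2l ltn_ord.
Qed.

Lemma measurable_psum p m : measurable_fun [set: T] (psum p m).
Proof. exact: known_measurable (known_psum (@subset_refl _ (block p m))). Qed.

Lemma known_indep2 (J K : set nat) (A B : T -> R) : J `&` K = set0 ->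
  known Z J A -> known Z K B -> indep2 P A B.
Proof. by move=> JK kA kB C D mC mD; exact: (known_indep indepZ JK kA kB mC mD). Qed.

Section moments.
Variable s2 : R.
Hypotheses (iY : forall k, P.-integrable [set: T] (EFin \o Y k))
  (iY2 : forall k, P.-integrable [set: T] (EFin \o (fun w => Y k w ^+ 2)))
  (EY : forall k, \int[P]_w Y k w = 0) (EY2 : forall k, \int[P]_w (Y k w ^+ 2) = s2).

(** Induction on m; independence makes the cross term of the square vanish, both means being 0. *)
Lemma psum_moments p m :
  [/\ P.-integrable [set: T] (EFin \o psum p m),
      P.-integrable [set: T] (EFin \o (fun w => psum p m w ^+ 2)),
      \int[P]_w psum p m w = 0 & \int[P]_w (psum p m w ^+ 2) = m%:R * s2].
Proof.
elim: m => [|m [i1 i2 e1 e2]].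
  have E0 : psum p 0 = cst 0 by apply/funext => w; rewrite psum0.
  rewrite E0; split.
  - exact: finite_measure_integrable_cst.
  - rewrite (_ : _ \o _ = EFin \o cst 0); last by apply/funext => w /=; rewrite expr0n.
    exact: finite_measure_integrable_cst.
  - exact: Rintegral_probability_cst.
  - by under eq_Rintegral do rewrite expr0n/=; rewrite Rintegral_probability_cst mul0r.
have ind : indep2 P (psum p m) (Y (p + m)).
  apply: (@known_indep2 (block p m) (block (p + m) 1)); first exact: block_disj.
    exact: known_psum.
  by apply: kY; rewrite /block/= leqnn addn1 ltnSn.
have [i12 e12] := indep2_RintegralM (measurable_psum p m)
  (known_measurable (kY (J := setT) (k := p + m) Logic.I)) ind i1 (iY _).
rewrite e1 mul0r in e12.
have S1 : psum p m.+1 = fun w => psum p m w + Y (p + m) w.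
  by apply/funext => w; rewrite psumS.
have S2 w : psum p m.+1 w ^+ 2 =
    psum p m w ^+ 2 + (2 * (psum p m w * Y (p + m) w) + Y (p + m) w ^+ 2).
  by rewrite psumS; ring.
have i212 : P.-integrable [set: T] (EFin \o (fun w => 2 * (psum p m w * Y (p + m) w))).
  exact: (integrableZl _ 2 i12).
have i3 : P.-integrable [set: T]
    (EFin \o (fun w => 2 * (psum p m w * Y (p + m) w) + Y (p + m) w ^+ 2)).
  exact: (integrableD _ i212 (iY2 _)).
split.
- by rewrite S1; exact: (integrableD _ i1 (iY _)).
- rewrite (_ : _ \o _ = EFin \o (fun w => psum p m w ^+ 2 +
    (2 * (psum p m w * Y (p + m) w) + Y (p + m) w ^+ 2))).
    exact: (integrableD _ i2 i3).
  by apply/funext => w /=; rewrite S2.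
- by rewrite S1 RintegralD// e1 EY addr0.
- under eq_Rintegral do rewrite S2.
  by rewrite !RintegralD// RintegralZl// e2 e12 EY2 mulr0 add0r -natr1 mulrDl mul1r.
Qed.

Lemma psum_chebyshev p m L : 0 < L -> pr [set w | L < `|psum p m w|] <= m%:R * s2 / L ^+ 2.
Proof.
move=> L0; have [_ i2 _ <-] := psum_moments p m.
by apply: pr_chebyshev => //; exact: measurable_psum.
Qed.

Definition exceed (c : R) p n : set T := [set w | exists2 k, (k <= n)%N & c < `|psum p k w|].

Lemma exceed0 c p : 0 <= c -> exceed c p 0 = set0.
Proof.
move=> c0; apply/seteqP; split => w //= [k].
by rewrite leqn0 => /eqP ->; rewrite psum0 normr0 ltNge c0.
Qed.

Lemma exceedS c p n : exceed c p n.+1 = exceed c p n `|` [set w | c < `|psum p n.+1 w|].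
Proof.
apply/seteqP; split => w /=.
  move=> [k]; rewrite leq_eqVlt => /predU1P[->|kn] h; [by right|left].
  by exists k.
by move=> [[k kn h]|h]; [exists k => //; exact: leqW|exists n.+1].
Qed.

Lemma known_gt_norm (J : set nat) (X : T -> R) c : known Z J X ->
  <<s cylinders Z J >> [set w | c < `|X w|].
Proof. by move=> kX; exact: (@measurable_gt_norm _ (g_sigma_algebraType (cylinders Z J)) R X c kX). Qed.

Lemma exceed_sigma c p n : 0 <= c -> <<s cylinders Z (block p n) >> (exceed c p n).
Proof.
move=> c0; elim: n => [|n IH].
  rewrite exceed0//; exact: (@measurable0 _ (g_sigma_algebraType (cylinders Z (block p 0)))).
rewrite exceedS; apply: (@measurableU _ (g_sigma_algebraType (cylinders Z (block p n.+1)))).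
  apply: sub_sigma_algebra2 IH; apply: cylinders_sub => k; rewrite /block/= => /andP[-> /leq_trans]; apply.
  by rewrite leq_add2l.
by apply: known_gt_norm; exact: known_psum.
Qed.

Lemma measurable_exceed c p n : 0 <= c -> measurable (exceed c p n).
Proof. by move=> c0; apply: sigma_cylinders_measurable; exact: exceed_sigma. Qed.

(** Ottaviani's inequality. Split by the first index at which the absolute sum exceeds 2 L. The
    later increment is independent of the past and, by Chebyshev, at most L with probability at
    least 1/2; in that case the final sum still exceeds L. *)
Lemma ottaviani (L : R) p m : 0 < L -> m%:R * s2 / L ^+ 2 <= 2^-1 ->
  pr (exceed (2 * L) p m) <= 2 * (m%:R * s2 / L ^+ 2).
Proof.
move=> L0 hm; have L20 : 0 <= 2 * L by rewrite mulr_ge0// ltW.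
have s20 : 0 <= s2 by rewrite -(EY2 0); apply: Rintegral_ge0 => w _; exact: sqr_ge0.
pose D := [set w | L < `|psum p m w|].
have mD : measurable D by apply: measurable_gt_norm; exact: measurable_psum.
(* Intersecting with the final event [D] keeps the right-hand side additive over the disjoint
   first-passage events. *)
have H n : (n <= m)%N -> pr (exceed (2 * L) p n) <= 2 * pr (exceed (2 * L) p n `&` D).
  elim: n => [|n IH] nm; first by rewrite exceed0// set0I pr0 mulr0.
  (* First passage at index n + 1; this event depends only on the first n + 1 steps of the block. *)
  pose A := [set w | 2 * L < `|psum p n.+1 w|] `\` exceed (2 * L) p n.
  have sE : <<s cylinders Z (block p n.+1) >> (exceed (2 * L) p n).
    apply: sub_sigma_algebra2 (@exceed_sigma _ p n L20).
    by apply: cylinders_sub => k; rewrite /block/= => /andP[-> /leq_trans]; apply; rewrite leq_add2l.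
  have sA : <<s cylinders Z (block p n.+1) >> A.
    apply: (@measurableD _ (g_sigma_algebraType (cylinders Z (block p n.+1)))).
      by apply: known_gt_norm; exact: known_psum.
    exact: sE.
  have mA := sigma_cylinders_measurable sA.
  have mE := measurable_exceed p n L20.
  have ES : exceed (2 * L) p n.+1 = exceed (2 * L) p n `|` A.
    rewrite exceedS; apply/seteqP; split => w; last by case=> [|[]]; [left|right].
    by case=> h; [left|have [e|e] := pselect (exceed (2 * L) p n w); [left|right]].
  have EA : exceed (2 * L) p n `&` A = set0 by apply/seteqP; split => w //= [h [_ /(_ h)]].
  rewrite ES setIUl !prU//; last 3 first.
  - exact: measurableI.
  - exact: measurableI.
  - by rewrite setIACA EA set0I.
  rewrite mulrDr; apply: lerD; first by apply: IH; exact: ltnW.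
  pose B := ~` [set w | L < `|psum (p + n.+1) (m - n.+1) w|].
  have sB' : <<s cylinders Z (block (p + n.+1) (m - n.+1)) >>
      [set w | L < `|psum (p + n.+1) (m - n.+1) w|].
    by apply: known_gt_norm; exact: known_psum.
  have sB : <<s cylinders Z (block (p + n.+1) (m - n.+1)) >> B.
    exact: (@measurableC _ (g_sigma_algebraType (cylinders Z (block (p + n.+1) (m - n.+1))))).
  have PB : 2^-1 <= pr B.
    rewrite prC; last exact: sigma_cylinders_measurable sB'.
    have := psum_chebyshev (p + n.+1) (m - n.+1) L0.
    have : (m - n.+1)%:R * s2 / L ^+ 2 <= m%:R * s2 / L ^+ 2.
      by rewrite ler_wpM2r ?invr_ge0 ?sqr_ge0// ler_wpM2r// ler_nat leq_subr.
    lra.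
  have PAB : pr (A `&` B) = pr A * pr B.
    have mB := sigma_cylinders_measurable sB.
    apply/EFin_inj; rewrite EFinM !prE//; last exact: measurableI.
    apply: (sigma_cylinders_indep indepZ _ sA sB).
    exact: block_disj.
  have ABD : pr (A `&` B) <= pr (A `&` D).
    apply: le_pr; [|exact: measurableI|].
      by apply: measurableI => //; exact: sigma_cylinders_measurable sB.
    move=> w [Aw] /= /negP; rewrite -leNgt => Bw; split => //.
    case: Aw => /= Aw _.
    rewrite /D/= -(subnKC nm) psumD.
    have := lerB_normD (psum p n.+1 w) (psum (p + n.+1) (m - n.+1) w).
    lra.
  have : pr A * 2^-1 <= pr A * pr B by rewrite ler_wpM2l// pr_ge0.
  lra.
apply: le_trans (H m (leqnn _)) _; rewrite ler_pM2l//.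
apply: le_trans (psum_chebyshev p m L0).
by apply: le_pr => //; apply: measurableI => //; exact: measurable_exceed.
Qed.

End moments.
End random_walk.

(** * Characteristic functions *)

Section normal_density_integrals.
Context {R : realType}.
Local Notation leb := (@lebesgue_measure R).

(** The fundamental theorem of calculus on [-n, n], carried to the whole line by dominated
    convergence. *)
Lemma Rintegral_derive_vanishing (H k : R -> R) :
  (forall x : R, is_derive x 1 H (k x)) -> continuous k ->
  leb.-integrable [set: R] (EFin \o k) ->
  H n%:R - H (- n%:R) @[n --> \oo] --> 0 -> \int[leb]_x k x = 0.
Proof.
move=> dH ck ik H0.
pose kn (n : nat) := k \_ `[- n%:R, n%:R]%classic.
have mk : measurable_fun [set: R] k by exact: continuous_measurable_fun.
have h1 n : measurable_fun [set: R] (fun x => (kn n x)%:E).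
  apply/measurable_EFinP.
  by apply/(measurable_restrictT _ _).1 => //; exact: measurable_funTS.
have h2 : {ae leb, forall x : R, [set: R] x -> (kn n x)%:E @[n --> \oo] --> (k x)%:E}.
  apply: aeW => x _; apply: cvg_near_cst; near=> n => /=.
  rewrite /kn patchE mem_set//= in_itv/= -ler_norml.
  by near: n; exact: nbhs_infty_ger.
have h3 : {ae leb, forall (x : R) n, [set: R] x -> (`|(kn n x)%:E| <= `|(k x)%:E|)%E}.
  apply: aeW => x n _ /=; rewrite lee_fin /kn patchE; case: ifP => // _.
  by rewrite normr0.
have [_ _ hcvg] := @dominated_convergence _ _ _ leb setT measurableT _ _ _ h1
  (measurable_int _ ik) h2 (integrable_abse ik) h3.
have knE n : (\int[leb]_x (kn n x)%:E)%E = (H n%:R - H (- n%:R))%:E.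
  have nn : - n%:R <= n%:R :> R by rewrite -subr_ge0 opprK addr_ge0.
  rewrite -(Rintegral_is_derive nn ck dH).
  rewrite /Rintegral fineK.
    by rewrite [RHS]integral_mkcond restrict_EFin.
  apply: integrable_fin_num => //.
  by apply: continuous_compact_integrable; [exact: segment_compact|exact: continuous_subspaceT].
have c1 : (H n%:R - H (- n%:R))%:E @[n --> \oo] --> (\int[leb]_x (k x)%:E)%E.
  by under eq_fun do rewrite -knE.
have c2 : (H n%:R - H (- n%:R))%:E @[n --> \oo] --> (0%:E : \bar R).
  by apply: cvg_EFin; [exact: nearW|exact: H0].
have E := cvg_unique _ c1 c2.
by rewrite /Rintegral E.
Unshelve. all: by end_near. Qed.

(** The Radon-Nikodym derivative of the normal law agrees almost everywhere with the density, both
    having the same integral over every measurable set. *)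
Lemma normal_expectation (s : R) (f : R -> R) (M : R) : s != 0 ->
  measurable_fun [set: R] f -> (forall x, `|f x| <= M) ->
  \int[normal_prob 0 s]_x f x = \int[leb]_x (f x * normal_pdf 0 s x).
Proof.
move=> s0 mf fM; rewrite /Rintegral; congr fine.
pose nu : {finite_measure set (measurableTypeR R) -> \bar R} := normal_prob 0 s.
have ifn : nu.-integrable [set: R] (EFin \o f).
  exact: (@bounded_integrable _ _ _ (normal_prob 0 s) f M mf fM).
have numu : nu `<< leb := normal_prob_dominates 0 s.
rewrite -(Radon_Nikodym_change_of_variables numu measurableT ifn).
pose g : measurableTypeR R -> \bar R := fun x => (normal_pdf 0 s x)%:E.
have mg : measurable_fun [set: R] g.
  by apply/measurable_EFinP; exact: measurable_normal_pdf.
have irn := @Radon_Nikodym_integrable _ _ _ (charge_of_finite_measure nu) leb numu.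
transitivity (\int[leb]_x ((EFin \o f) \* g) x)%E => //.
apply: ae_eq_integral => //.
- apply: emeasurable_funM; first exact/measurable_EFinP.
  exact: measurable_int irn.
- by apply: emeasurable_funM => //; exact/measurable_EFinP.
apply: ae_eqe_mul2l; apply: integral_ae_eq => //.
by move=> A _ mA; rewrite -Radon_Nikodym_integral.
Qed.

End normal_density_integrals.

(** * Characteristic function of the normal law *)

Section normal_chf.
Context {R : realType}.
Local Notation leb := (@lebesgue_measure R).
Variable s : R.
Hypothesis s0 : 0 < s.
Local Notation g := (normal_pdf 0 s).

Lemma normal_pdf0E (x : R) : g x = normal_peak s * expR (- (x ^+ 2 / (s ^+ 2 *+ 2))).
Proof.
by rewrite /normal_pdf gt_eqF// /normal_fun subr0 mulNr.
Qed.

Lemma is_derive_normal_pdf (x : R) : is_derive x 1 g (- x / s ^+ 2 * g x).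
Proof.
rewrite (_ : g = fun x => normal_peak s * expR (- (x ^+ 2 / (s ^+ 2 *+ 2)))); last first.
  by apply/funext => y; exact: normal_pdf0E.
apply: is_derive_eq; rewrite /= !scaler0 /GRing.scale/=.
by field; rewrite gt_eqF.
Qed.

Lemma normr_expR_quarter (x : R) : `|x| <= expR (x ^+ 2 / 4).
Proof.
apply: le_trans (expR_ge1Dx _).
rewrite -(real_normK (num_real x)).
rewrite -subr_ge0 (_ : 1 + _ - _ = (1 - `|x| / 2) ^+ 2); last by field.
exact: sqr_ge0.
Qed.

Let s2 := Num.sqrt 2 * s.
Let s20 : 0 < s2. Proof. by rewrite mulr_gt0// sqrtr_gt0. Qed.

(** Half of the Gaussian exponent absorbs the factor |x|. What remains is proportional to the
    density of deviation sqrt 2 s, so |x| g(x) is bounded and integrable. *)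
Lemma normr_normal_pdf_le (x : R) :
  `|x| * g x <= s * normal_peak s * expR (- (x ^+ 2 / (s2 ^+ 2 *+ 2))).
Proof.
rewrite normal_pdf0E mulrCA [leRHS](_ : _ = normal_peak s *
  (s * expR (- (x ^+ 2 / (s2 ^+ 2 *+ 2)))) ); last by rewrite mulrCA mulrA.
apply: ler_wpM2l; first exact: normal_peak_ge0.
have := normr_expR_quarter (x / s); rewrite normrM normfV (gtr0_norm s0).
rewrite ler_pdivrMr// => h; apply: le_trans (ler_wpM2r (expR_ge0 _) h) _.
rewrite mulrAC -expRD mulrC ler_pM2l// ler_expR.
rewrite (_ : s2 ^+ 2 = 2 * s ^+ 2); last by rewrite exprMn sqr_sqrtr.
rewrite (_ : (x / s) ^+ 2 / 4 - x ^+ 2 / (s ^+ 2 *+ 2) = - (x ^+ 2 / (2 * s ^+ 2 *+ 2)))//.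
by field; rewrite gt_eqF.
Qed.

Lemma normr_normal_pdf_bounded (x : R) : `|x| * g x <= s * normal_peak s.
Proof.
apply: le_trans (normr_normal_pdf_le x) _.
rewrite ler_piMr ?mulr_ge0 ?normal_peak_ge0 ?(ltW s0)//.
rewrite -expR0 ler_expR oppr_le0 mulr_ge0 ?sqr_ge0// invr_ge0.
by rewrite mulrn_wge0// sqr_ge0.
Qed.

Let integrable_by (f : R -> R) : measurable_fun [set: R] f -> (forall x, `|f x| <= g x) ->
  leb.-integrable [set: R] (EFin \o f).
Proof.
move=> mf fg; apply: (le_integrable measurableT _ _ (integrable_normal_pdf 0 s)).
  exact/measurable_EFinP.
by move=> x _ /=; rewrite lee_fin (le_trans (fg x))// ler_norm.
Qed.

Let integrable_by_norm (f : R -> R) : measurable_fun [set: R] f ->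
  (forall x, `|f x| <= `|x| * g x) -> leb.-integrable [set: R] (EFin \o f).
Proof.
move=> mf fg.
pose K := s * normal_peak s / normal_peak s2.
have iK := integrableZl measurableT K (integrable_normal_pdf 0 s2).
apply: (le_integrable measurableT _ _ iK); first exact/measurable_EFinP.
move=> x _ /=; rewrite lee_fin (le_trans (fg x))//.
apply: le_trans (normr_normal_pdf_le x) _; apply: le_trans (ler_norm _).
rewrite /normal_pdf gt_eqF// /normal_fun subr0 mulNr /K.
rewrite mulrA divfK// gt_eqF// normal_peak_gt0// gt_eqF//.
Qed.

Let mg : measurable_fun [set: R] g. Proof. exact: measurable_normal_pdf. Qed.
Let g0 (x : R) : 0 <= g x. Proof. exact: normal_pdf_ge0. Qed.

Section trig_pair.
Variables c c' : R -> R.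
Hypotheses (dc : forall x : R, is_derive x 1 c (c' x))
  (dc' : forall x : R, is_derive x 1 c' (- c x))
  (c1 : forall x, `|c x| <= 1) (c'1 : forall x, `|c' x| <= 1).

Let cc : continuous c. Proof. by move=> x; exact: (is_derive_continuous (dc x)). Qed.
Let cc' : continuous c'. Proof. by move=> x; exact: (is_derive_continuous (df := fun x => - c x) (dc' x)). Qed.

Let contM (f : R -> R) (t : R) : continuous f -> continuous (fun x => f (t * x)).
Proof.
move=> cf x; apply: (cvg_comp (fun x : R => t * x) f); last exact: cf.
by apply: cvgM; [exact: cvg_cst|exact: cvg_id].
Qed.

(** [c] stands for the cosine or the sine: both satisfy c'' = -c with c and c' bounded by 1, so one
    computation gives the real and the imaginary part of the normal characteristic function. *)
Let U t := \int[leb]_x (c (t * x) * g x).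

Let iU t : leb.-integrable [set: R] (EFin \o (fun x => c (t * x) * g x)).
Proof.
apply: integrable_by.
  apply: measurable_funM => //.
  by apply: continuous_measurable_fun; exact: contM.
by move=> x; rewrite normrM (ger0_norm (g0 x)) ler_piMl.
Qed.

Let iU' t : leb.-integrable [set: R] (EFin \o (fun x => c' (t * x) * (x * g x))).
Proof.
apply: integrable_by_norm.
  apply: measurable_funM; last exact: measurable_funM.
  by apply: continuous_measurable_fun; exact: contM.
by move=> x; rewrite !normrM (ger0_norm (g0 x)) ler_piMl// mulr_ge0.
Qed.

(** Integration by parts: since g' = -x g / s^2, the derivative of c'(t x) g(x) combines the two
    integrands, and the boundary terms vanish. *)
Let ibp t : \int[leb]_x (c' (t * x) * (x * g x)) = - (t * s ^+ 2 * U t).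
Proof.
pose k (x : R) : R := - t * (c (t * x) * g x) - (s ^+ 2)^-1 * (c' (t * x) * (x * g x)).
have dH (x : R) : is_derive x 1 (fun x : R => c' (t * x) * g x) (k x).
  have dg := is_derive_normal_pdf x.
  have dct : is_derive x 1 (fun x : R => c' (t * x)) (- c (t * x) * t).
    apply: (@is_derive1_comp _ c' (fun x : R => t * x) x).
    by apply: is_derive_eq; rewrite ?scaler0 /GRing.scale/= ?mulr1 ?mulr0 ?addr0 ?add0r.
  apply: is_derive_eq; rewrite /k /GRing.scale/=; ring.
have ik1 := integrableZl measurableT (- t) (iU t).
have ik2 := integrableZl measurableT ((s ^+ 2)^-1) (iU' t).
have ik : leb.-integrable [set: R] (EFin \o k) by exact: (integrableB _ ik1 ik2).
have cg : continuous g by apply: continuous_normal_pdf; rewrite gt_eqF.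
have ck : continuous k.
  move=> x; apply: cvgB; (apply: cvgM; first exact: cvg_cst); apply: cvgM.
  - exact: contM.
  - exact: cg.
  - exact: contM.
  - by apply: cvgM; [exact: cvg_id|exact: cg].
have vanish : c' (t * n%:R) * g n%:R - c' (t * - n%:R) * g (- n%:R) @[n --> \oo] --> 0.
  apply: norm_cvg0.
  (* Both n g(n) and g(n) are bounded, so g(n) is at most K / (n + 1), which is decay enough. *)
  pose K := s * normal_peak s + normal_peak s.
  apply: (@squeeze_cvgr _ _ _ _ (fun=> 0) (fun n => 2 * (K * harmonic n))).
  - apply: nearW => n; rewrite normr_ge0/=.
    have gK : g n%:R <= K * harmonic n.
      rewrite ler_pdivlMr// -natr1 mulrDr mulr1 mulrC lerD//.
        by rewrite -[X in X * _ <= _](ger0_norm (ler0n _ _)); exact: normr_normal_pdf_bounded.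
      by apply: normal_pdf_ub; rewrite gt_eqF.
    have gN : g (- n%:R) = g n%:R by rewrite !normal_pdf0E sqrrN.
    rewrite gN; apply: le_trans (ler_normB _ _) _.
    rewrite mulr_natl mulr2n; apply: lerD; rewrite normrM (ger0_norm (g0 _));
      apply: le_trans gK; rewrite ler_piMl//.
  - exact: cvg_cst.
  - have -> : (0 : R) = 2 * (K * 0) by rewrite !mulr0.
    apply: cvgM; first exact: cvg_cst.
    by apply: cvgM; [exact: cvg_cst|exact: cvg_harmonic].
have := Rintegral_derive_vanishing dH ck ik vanish.
rewrite RintegralB// !RintegralZl//.
move=> h; have : (s ^+ 2)^-1 * \int[leb]_x (c' (t * x) * (x * g x)) = - t * U t.
  by rewrite /U; lra.
move=> /(congr1 (fun z => s ^+ 2 * z)); rewrite mulrA divff ?mul1r => [->|].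
  by ring.
by rewrite gt_eqF// exprn_gt0.
Qed.

(** Differentiation under the integral, dominated by |x| g(x); [ibp] then expresses the result
    through U. *)
Let dU (t : R) : is_derive t 1 U (- (t * s ^+ 2 * U t)).
Proof.
have dcx (x y : R) : is_derive y 1 (fun y : R => c (y * x) * g x) (c' (y * x) * (x * g x)).
  have dct : is_derive y 1 (fun y : R => c (y * x)) (c' (y * x) * x).
    apply: (@is_derive1_comp _ c (fun y : R => y * x) y).
    by apply: is_derive_eq; rewrite ?scaler0 /GRing.scale/= ?mulr1 ?mulr0 ?addr0 ?add0r.
  apply: is_derive_eq; rewrite /GRing.scale/=; ring.
pose f (y x : R) : R := c (y * x) * g x.
have h1 y : `]t - 1, t + 1[%classic y -> leb.-integrable [set: R] (EFin \o f y).
  by move=> _; exact: iU.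
have h2 y x : `]t - 1, t + 1[%classic y -> [set: R] x -> derivable (f ^~ x) y 1.
  by move=> _ _; case: (dcx x y).
have h3 x : 0 <= `|x| * g x by exact: mulr_ge0.
have h4 : leb.-integrable [set: R] (EFin \o (fun x => `|x| * g x)).
  apply: integrable_by_norm.
    by apply: measurable_funM => //; exact: measurableT_comp.
  by move=> x; rewrite ger0_norm.
have pE y x : partial1of2 f y x = c' (y * x) * (x * g x).
  by rewrite partial1of2E; have := dcx x y => /@derive_val.
have h5 y x : `]t - 1, t + 1[%classic y -> [set: R] x ->
    `|partial1of2 f y x| <= `|x| * g x.
  by move=> _ _; rewrite pE !normrM (ger0_norm (g0 x)) ler_piMl.
have It : `]t - 1, t + 1[%classic t by rewrite /= in_itv/=; apply/andP; split; lra.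
have D1 := derivable_under_integral measurableT It h1 h2 h3 h4 h5.
have D2 := differentiation_under_integral measurableT It h1 h2 h3 h4 h5.
split; first exact: D1.
rewrite -derive1E [LHS]D2 -ibp; apply: eq_Rintegral => x _.
exact: pE.
Qed.

(* By [dU], U solves the linear equation U' = - s^2 t U. *)
Lemma normal_trig_integral t : U t = U 0 * expR (- (s ^+ 2 * t ^+ 2 / 2)).
Proof.
pose V (t : R) := U t * expR (s ^+ 2 * t ^+ 2 / 2).
have dV (u : R) : is_derive u 1 V 0.
  have dUu := dU u.
  have dE : is_derive u 1 (fun t : R => expR (s ^+ 2 * t ^+ 2 / 2))
      (s ^+ 2 * u * expR (s ^+ 2 * u ^+ 2 / 2)).
    by apply: is_derive_eq; rewrite /= !scaler0 /GRing.scale/=; field.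
  by apply: is_derive_eq; rewrite /GRing.scale/=; ring.
have := is_derive_0_is_cst t 0 dV.
rewrite /V expr0n/= mulr0 mul0r expR0 mulr1 => <-.
by rewrite -mulrA -expRD subrr expR0 mulr1.
Qed.

End trig_pair.

Lemma ecos_normal t : ecos (normal_prob 0 s) id t = expR (- (s ^+ 2 * t ^+ 2 / 2)).
Proof.
rewrite /ecos (normal_expectation (M := 1)); last 3 first.
- by rewrite gt_eqF.
- exact: measurable_cosM.
- by move=> x; exact: cos_max.
rewrite (@normal_trig_integral cos (fun x => - sin x)).
- under eq_Rintegral do rewrite mul0r cos0 mul1r.
  by rewrite /Rintegral integral_normal_pdf mul1r.
- by move=> x; exact: cos_max.
- by move=> x; rewrite normrN; exact: sin_max.
Qed.

Lemma esin_normal t : esin (normal_prob 0 s) id t = 0.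
Proof.
rewrite /esin (normal_expectation (M := 1)); last 3 first.
- by rewrite gt_eqF.
- exact: measurable_sinM.
- by move=> x; exact: sin_max.
rewrite (@normal_trig_integral sin cos).
- under eq_Rintegral do rewrite mul0r sin0 mul0r.
  by rewrite Rintegral_cst// mul0r mul0r.
- by move=> x; exact: sin_max.
- by move=> x; exact: cos_max.
Qed.

End normal_chf.

Notation normc := Normc.normc.

(** * Modulus of complex numbers and differences of powers *)

Section complex_modulus.
Context {R : realType}.
Implicit Types z w : R[i].
Local Open Scope complex_scope.

Lemma normc_ge0 z : 0 <= normc z.
Proof. by case: z => a b; exact: sqrtr_ge0. Qed.

Lemma normcD_le z w : normc (z + w) <= normc z + normc w.
Proof. exact: (@le_normcD R z w). Qed.

Lemma normr_Re_le z : `|complex.Re z| <= normc z.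
Proof.
case: z => a b /=; rewrite -sqrtr_sqr ler_wsqrtr// lerDl sqr_ge0//.
Qed.

Lemma normr_Im_le z : `|complex.Im z| <= normc z.
Proof.
case: z => a b /=; rewrite -sqrtr_sqr ler_wsqrtr// lerDr sqr_ge0//.
Qed.

Lemma normc_real (x : R) : normc x%:C = `|x|.
Proof. by rewrite /= expr0n/= addr0 sqrtr_sqr. Qed.

Lemma normc_le_ReIm z : normc z <= `|complex.Re z| + `|complex.Im z|.
Proof.
case: z => a b.
rewrite (_ : a +i* b = a%:C + 'i * b%:C); last by simpc.
apply: le_trans (normcD_le _ _) _.
rewrite Normc.normcM !normc_real /= expr0n/= expr1n add0r sqrtr1 mul1r.
by simpc.
Qed.

Lemma normcX z n : normc (z ^+ n) = normc z ^+ n.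
Proof.
elim: n => [|n IH]; first by rewrite !expr0 Normc.normc1.
by rewrite !exprS Normc.normcM IH.
Qed.

(** Telescoping. For n = 0 the truncated exponent [n.-1] is harmless, as the factor n vanishes. *)
Lemma normc_expB_le z w (M : R) n : normc z <= M -> normc w <= M ->
  normc (z ^+ n - w ^+ n) <= n%:R * normc (z - w) * M ^+ n.-1.
Proof.
move=> zM wM; have M0 : 0 <= M := le_trans (normc_ge0 z) zM.
elim: n => [|n IH].
  by rewrite !expr0 subrr Normc.normc0 !mul0r.
rewrite (_ : z ^+ n.+1 - w ^+ n.+1 = z * (z ^+ n - w ^+ n) + (z - w) * w ^+ n); last first.
  by rewrite !exprS; ring.
apply: le_trans (normcD_le _ _) _; rewrite !Normc.normcM normcX /=.
apply: (@le_trans _ _ (M * (n%:R * normc (z - w) * M ^+ n.-1) + normc (z - w) * M ^+ n)).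
  apply: lerD; first by apply: ler_pM => //; exact: normc_ge0.
  by apply: ler_wpM2l; [exact: normc_ge0|apply: lerXn2r => //; rewrite nnegrE// normc_ge0].
rewrite -natr1; case: n {IH} => [|n]; first by rewrite !mul0r mulr0 expr0; lra.
by rewrite /= exprS; lra.
Qed.

End complex_modulus.

(** * Characteristic functions of independent sums *)

Section chf.
Context {R : realType}.
Local Open Scope complex_scope.

Definition chf d (T : measurableType d) (P : probability T R) (X : T -> R) (t : R) : R[i] :=
  ecos P X t +i* esin P X t.

Context d (T : measurableType d) (P : probability T R).

Lemma indep2_comp (X Y : T -> R) (f g : R -> R) : indep2 P X Y ->
  measurable_fun [set: R] f -> measurable_fun [set: R] g -> indep2 P (f \o X) (g \o Y).
Proof.
move=> XY mf mg A B mA mB; apply: (XY (f @^-1` A) (g @^-1` B)).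
  by rewrite -[X in measurable X]setTI; exact: mf.
by rewrite -[X in measurable X]setTI; exact: mg.
Qed.

Lemma chfD (X Y : T -> R) t : measurable_fun [set: T] X -> measurable_fun [set: T] Y ->
  indep2 P X Y -> chf P (fun w => X w + Y w) t = chf P X t * chf P Y t.
Proof.
move=> mX mY XY.
have mc : measurable_fun [set: R] (fun x => cos (t * x)) by apply: (@measurable_cosM _ _ _ (fun x : R => x)); exact: measurable_id.
have ms : measurable_fun [set: R] (fun x => sin (t * x)) by apply: (@measurable_sinM _ _ _ (fun x : R => x)); exact: measurable_id.
have cX := measurable_cosM mX t; have sX := measurable_sinM mX t.
have cY := measurable_cosM mY t; have sY := measurable_sinM mY t.
have icX := integrable_cosM P mX t; have isX := integrable_sinM P mX t.
have icY := integrable_cosM P mY t; have isY := integrable_sinM P mY t.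
have [i1 e1] := indep2_RintegralM cX cY (indep2_comp XY mc mc) icX icY.
have [i2 e2] := indep2_RintegralM sX sY (indep2_comp XY ms ms) isX isY.
have [i3 e3] := indep2_RintegralM sX cY (indep2_comp XY ms mc) isX icY.
have [i4 e4] := indep2_RintegralM cX sY (indep2_comp XY mc ms) icX isY.
rewrite /chf /GRing.mul/=; congr (_ +i* _).
  rewrite /ecos /esin -e1 -e2 -RintegralB//.
  by apply: eq_Rintegral => w _; rewrite mulrDr cosD.
rewrite /ecos /esin -e4 -e3 -RintegralD//.
by apply: eq_Rintegral => w _; rewrite mulrDr sinD addrC.
Qed.

Lemma chf0 t : chf P (fun=> 0) t = 1.
Proof.
rewrite /chf /ecos /esin.
under eq_Rintegral do rewrite mulr0 cos0.
rewrite Rintegral_probability_cst.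
under eq_Rintegral do rewrite mulr0 sin0.
by rewrite Rintegral_probability_cst.
Qed.

End chf.

Section chf_psum.
Context d (T : measurableType d) d' (T' : measurableType d') (R : realType).
Context (P : probability T R) (Z : nat -> {RV P >-> T'}).
Hypothesis indepZ : mutually_independent Z.
Variable Y : nat -> T -> R.
Hypothesis kY : forall k (J : set nat), J k -> known Z J (Y k).

Lemma chf_psum (phi : R[i]) (t : R) p m : (forall k, chf P (Y k) t = phi) ->
  chf P (psum Y p m) t = phi ^+ m.
Proof.
move=> h; elim: m => [|m IH].
  rewrite (_ : psum Y p 0 = fun=> 0) ?chf0//.
  by apply/funext => w; rewrite psum0.
rewrite (_ : psum Y p m.+1 = fun w => psum Y p m w + Y (p + m)%N w); last first.
  by apply/funext => w; rewrite psumS.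
rewrite chfD ?IH ?h ?exprSr//.
- exact: (measurable_psum kY).
- exact: (known_measurable (kY (J := setT) Logic.I)).
- apply: (@known_indep2 _ _ _ _ _ _ _ indepZ (block p m) (block (p + m)%N 1)).
  + exact: block_disj.
  + exact: known_psum.
  + by apply: kY; rewrite /block/= leqnn addn1 ltnSn.
Qed.

End chf_psum.

(** * Second-order expansion of the characteristic function at 0 *)

Section chf_small.
Context {R : realType} d (T : measurableType d) (P : probability T R) (Y : T -> R) (s : R).
Local Open Scope complex_scope.
Hypotheses (mY : measurable_fun [set: T] Y)
  (iY : P.-integrable [set: T] (EFin \o Y))
  (iY2 : P.-integrable [set: T] (EFin \o (fun w => Y w ^+ 2)))
  (EY : \int[P]_w Y w = 0) (EY2 : \int[P]_w (Y w ^+ 2) = s ^+ 2).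

(** With u = |t| this is the Taylor remainder bound divided by t^2. It is dominated by Y^2 and tends
    to 0 with u, so dominated convergence yields o(t^2) from the second moment. *)
Let rem (u : R) w : R := Num.min (Y w ^+ 2) (u * `|Y w| ^+ 3).

Let mrem u : measurable_fun [set: T] (rem u).
Proof.
apply: measurable_minr; first exact: measurable_funX.
by apply: measurable_funM => //; apply: measurable_funX; exact: measurableT_comp.
Qed.

Let rem_ge0 u w : 0 <= u -> 0 <= rem u w.
Proof. by move=> u0; rewrite le_min sqr_ge0/= mulr_ge0// exprn_ge0. Qed.

Let irem u : 0 <= u -> P.-integrable [set: T] (EFin \o rem u).
Proof.
move=> u0; apply: (le_integrable measurableT _ _ iY2); first exact/measurable_EFinP.
move=> w _ /=; rewrite lee_fin !ger0_norm ?sqr_ge0 ?rem_ge0//.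
by rewrite /rem ge_min lexx.
Qed.

Let rem_cvg0 (e : R) : 0 < e -> exists2 u : R, 0 < u & \int[P]_w rem u w <= e.
Proof.
move=> e0.
have h1 n : measurable_fun [set: T] (fun w => (rem (harmonic n) w)%:E).
  exact/measurable_EFinP.
have h2 : {ae P, forall w, [set: T] w -> (rem (harmonic n) w)%:E @[n --> \oo] --> (0:R)%:E}.
  apply: aeW => w _; apply: cvg_EFin; first exact: nearW.
  apply: (@squeeze_cvgr _ _ _ _ (fun=> 0) (fun n => `|Y w| ^+ 3 * harmonic n)).
  - apply: nearW => n; rewrite /= rem_ge0 ?harmonic_ge0//=.
    by rewrite /rem ge_min mulrC lexx orbT.
  - exact: cvg_cst.
  - have -> : (0 : R) = `|Y w| ^+ 3 * 0 by rewrite mulr0.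
    by apply: cvgM; [exact: cvg_cst|exact: cvg_harmonic].
have h3 : {ae P, forall w n, [set: T] w -> (`|(rem (harmonic n) w)%:E| <= (Y w ^+ 2)%:E)%E}.
  apply: aeW => w n _ /=; rewrite lee_fin ger0_norm ?rem_ge0 ?harmonic_ge0//.
  by rewrite /rem ge_min lexx.
have [_ _] := @dominated_convergence _ _ _ P setT measurableT _ (cst 0%E) _ h1
  (measurable_cst _) h2 iY2 h3.
rewrite integral0 => /fine_cvgP[_ /cvgr0Pnorm_lt/(_ _ e0)[N _ /(_ N (leqnn N))/= hN]].
exists (harmonic N); first exact: harmonic_gt0.
by apply: ltW; apply: le_lt_trans hN; exact: ler_norm.
Qed.

Let min_rem t w : Num.min ((t * Y w) ^+ 2) (`|t * Y w| ^+ 3) = t ^+ 2 * rem `|t| w.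
Proof.
rewrite /rem -(real_normK (num_real t)) minr_pMr ?sqr_ge0//; congr Num.min.
  by rewrite exprMn real_normK// num_real.
by rewrite normrM exprMn; ring.
Qed.

Let trig_bound (f : R -> R) t : measurable_fun [set: R] f ->
  P.-integrable [set: T] (EFin \o (fun w => f (t * Y w))) ->
  (forall x, `|f x| <= Num.min (x ^+ 2) (`|x| ^+ 3)) ->
  `|\int[P]_w f (t * Y w)| <= t ^+ 2 * \int[P]_w rem `|t| w.
Proof.
move=> mf ifY hf; apply: le_trans (le_normr_Rintegral measurableT ifY) _.
rewrite -RintegralZl//; last exact: irem.
apply: le_Rintegral => //.
- exact: integrable_norm ifY.
- exact: (integrableZl _ (t ^+ 2) (irem (normr_ge0 t))).
- by move=> w _; rewrite -min_rem; exact: hf.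
Qed.

Lemma chf_small (e : R) : 0 < e -> exists2 r : R, 0 < r & forall t, `|t| <= r ->
  normc (chf P Y t - (expR (- (s ^+ 2 * t ^+ 2 / 2)))%:C) <= e * t ^+ 2.
Proof.
move=> e0; have e40 : 0 < e / 4 by rewrite divr_gt0.
have [u u0 hu] := rem_cvg0 e40.
have K0 : 0 < s ^+ 4 / 4 + 1 by rewrite ltr_wpDl// divr_ge0// exprn_even_ge0.
(* The last two entries control the error of the exponential, which is at most (s^2 t^2 / 2)^2 / 2 =
   t^2 (s^4 / 4) t^2 / 2, where t^2 <= |t|. Adding 1 keeps the denominator positive. *)
pose r := Num.min u (Num.min 1 (e / (s ^+ 4 / 4 + 1))).
exists r; first by rewrite !lt_min u0 ltr01 divr_gt0.
move=> t; rewrite !le_min => /and3P[tu t1 te].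
have remt : \int[P]_w rem `|t| w <= e / 4.
  apply: le_trans hu; apply: le_Rintegral => //; [exact: irem|by apply: irem; exact: ltW|].
  move=> w _; rewrite /rem le_min ge_min lexx/= ge_min; apply/orP; right.
  by rewrite ler_wpM2r// exprn_ge0.
have ic := integrable_cosM P mY t; have is_ := integrable_sinM P mY t.
have itY : P.-integrable [set: T] (EFin \o (fun w => t * Y w)).
  exact: (integrableZl _ t iY).
have it2 : P.-integrable [set: T] (EFin \o (fun w => t ^+ 2 / 2 * Y w ^+ 2)).
  exact: (integrableZl _ (t ^+ 2 / 2) iY2).
have i1 : P.-integrable [set: T] (EFin \o cst 1) by exact: finite_measure_integrable_cst.
have i12 : P.-integrable [set: T] (EFin \o (fun w => 1 - t ^+ 2 / 2 * Y w ^+ 2)).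
  exact: (integrableB _ i1 it2).
have E1 : `|ecos P Y t - (1 - s ^+ 2 * t ^+ 2 / 2)| <= t ^+ 2 * (e / 4).
  have -> : ecos P Y t - (1 - s ^+ 2 * t ^+ 2 / 2) =
      \int[P]_w (cos (t * Y w) - (1 - (t * Y w) ^+ 2 / 2)).
    transitivity (\int[P]_w (cos (t * Y w) - (1 - t ^+ 2 / 2 * Y w ^+ 2))).
      rewrite [RHS]RintegralB// [X in _ = _ - X]RintegralB// RintegralZl// EY2.
      by rewrite Rintegral_probability_cst /ecos; ring.
    by apply: eq_Rintegral => w _; rewrite exprMn; ring.
  apply: le_trans (ler_wpM2l (sqr_ge0 t) remt).
  apply: (@trig_bound (fun x => cos x - (1 - x ^+ 2 / 2))).
  - apply: measurable_funB; first by apply: continuous_measurable_fun; exact: continuous_cos.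
    apply: measurable_funB => //; apply: measurable_funM => //.
  - rewrite (_ : _ \o _ = EFin \o (fun w => cos (t * Y w) - (1 - t ^+ 2 / 2 * Y w ^+ 2))).
      exact: (integrableB _ ic i12).
    by apply/funext => w /=; congr EFin; rewrite exprMn; ring.
  - exact: normr_cos_taylor.
have E2 : `|esin P Y t| <= t ^+ 2 * (e / 4).
  have -> : esin P Y t = \int[P]_w (sin (t * Y w) - t * Y w).
    by rewrite RintegralB// RintegralZl// EY mulr0 subr0.
  apply: le_trans (ler_wpM2l (sqr_ge0 t) remt).
  apply: (@trig_bound (fun x => sin x - x)).
  - by apply: measurable_funB => //; apply: continuous_measurable_fun; exact: continuous_sin.
  - exact: (integrableB _ is_ itY).
  - exact: normr_sin_taylor.
have x0 : 0 <= s ^+ 2 * t ^+ 2 / 2 by rewrite divr_ge0// mulr_ge0// sqr_ge0.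
have E3 : `|1 - s ^+ 2 * t ^+ 2 / 2 - expR (- (s ^+ 2 * t ^+ 2 / 2))| <= t ^+ 2 * (e / 4 + e / 4).
  have h1 := expRN_le_sqr x0; have h2 := expR_ge1Dx (- (s ^+ 2 * t ^+ 2 / 2)).
  rewrite distrC ger0_norm; last by lra.
  have : (s ^+ 2 * t ^+ 2 / 2) ^+ 2 / 2 <= t ^+ 2 * (e / 4 + e / 4).
    have -> : (s ^+ 2 * t ^+ 2 / 2) ^+ 2 / 2 = t ^+ 2 * (s ^+ 4 / 4 * t ^+ 2 / 2) by field.
    rewrite ler_wpM2l ?sqr_ge0//.
    have : s ^+ 4 / 4 * t ^+ 2 <= e.
      apply: (@le_trans _ _ ((s ^+ 4 / 4 + 1) * `|t|)); last by rewrite mulrC -ler_pdivlMr.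
      apply: ler_pM; rewrite ?sqr_ge0 ?lerDl// ?divr_ge0 ?exprn_even_ge0//.
      by rewrite -(real_normK (num_real t)) expr2 ler_piMl.
    lra.
  lra.
apply: le_trans (normc_le_ReIm _) _.
rewrite /chf /= oppr0 addr0.
have -> : ecos P Y t - expR (- (s ^+ 2 * t ^+ 2 / 2)) =
  (ecos P Y t - (1 - s ^+ 2 * t ^+ 2 / 2)) +
  (1 - s ^+ 2 * t ^+ 2 / 2 - expR (- (s ^+ 2 * t ^+ 2 / 2))) by ring.
have := ler_normD (ecos P Y t - (1 - s ^+ 2 * t ^+ 2 / 2))
  (1 - s ^+ 2 * t ^+ 2 / 2 - expR (- (s ^+ 2 * t ^+ 2 / 2))).
lra.
Qed.

End chf_small.

(** * Powers of the characteristic function near 0 *)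

Section chf_power.
Context {R : realType}.
Local Open Scope complex_scope.
Variables (phi : R -> R[i]) (s : R).
Hypothesis s0 : 0 < s.
Let psi (t : R) : R := expR (- (s ^+ 2 * t ^+ 2 / 2)).
Hypothesis phi_small : forall e : R, 0 < e -> exists2 r : R, 0 < r & forall t, `|t| <= r ->
  normc (phi t - (psi t)%:C) <= e * t ^+ 2.

(* The powers p and n differ so that a shortened walk S_p can be compared
   directly with the normal law of variance n s^2. *)
Lemma chf_power_dist (e : R) : 0 < e -> exists2 r : R, 0 < r & exists2 kappa : R, 0 < kappa &
  \forall n \near \oo, forall p, (p <= n)%N -> (n - p)%:R <= kappa * n%:R ->
  forall t, `|t| <= r ->
  normc (phi t ^+ p - (psi t ^+ n)%:C) <= e / (1 + n%:R * t ^+ 2).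
Proof.
move=> e0.
(* For |t| <= r both |phi| and psi are at most exp(-c t^2), and the exponents that occur are at
   least n / 4, whence c' = c / 4. *)
pose c := s ^+ 2 / 8; have c0 : 0 < c by rewrite divr_gt0// exprn_gt0.
pose c' := c / 4; have c'0 : 0 < c' by rewrite divr_gt0.
pose K := c'^-1 + 2 * c'^-2.
have K0 : 0 < K by apply: addr_gt0; [rewrite invr_gt0|rewrite mulr_gt0// invr_gt0 exprn_gt0].
(* The first bound preserves the decay of phi; the second makes the replacement of phi^p by psi^p
   cost at most half of the error. *)
pose e1 := Num.min (s ^+ 2 / 4) (e / (2 * K)).
have e10 : 0 < e1 by rewrite lt_min !divr_gt0 ?exprn_gt0 ?mulr_gt0.
have e1s : e1 <= s ^+ 2 / 4 by rewrite ge_min lexx.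
have e1K : e1 * K <= e / 2.
  have : e1 <= e / (2 * K) by rewrite ge_min lexx orbT.
  by rewrite ler_pdivlMr ?mulr_gt0//; lra.
(* The first bound keeps p at least n / 2; the second pays for replacing psi^p by psi^n. *)
pose kappa := Num.min 2^-1 (e / (8 * c * K)).
have kap0 : 0 < kappa by rewrite lt_min invr_gt0 ltr0n divr_gt0// !mulr_gt0.
have kap2 : kappa <= 2^-1 by rewrite ge_min lexx.
have kapK : kappa * (4 * c * K) <= e / 2.
  have : kappa <= e / (8 * c * K) by rewrite ge_min lexx orbT.
  by rewrite ler_pdivlMr ?mulr_gt0//; lra.
have [r1 r10 hr1] := phi_small e10.
(* |t| <= 1 / s makes x = s^2 t^2 / 2 at most 1/2, so that the square in exp(-x) <= 1 - x + x^2 / 2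
   is absorbed by the linear term. *)
exists (Num.min r1 s^-1); first by rewrite lt_min r10 invr_gt0.
exists kappa => //; near=> n => p pn npk t; rewrite le_min => /andP[/hr1 ht ts].
have n4 : 4 <= n%:R :> R by near: n; exact: nbhs_infty_ger.
have pn4 : n%:R / 4 <= p%:R - 1 :> R.
  have : n%:R - p%:R <= 2^-1 * n%:R :> R.
    by rewrite -natrB// (le_trans npk)// ler_wpM2r.
  lra.
have p1 : (0 < p)%N by rewrite -(ltr_nat R); lra.
have pE : p.-1%:R = p%:R - 1 :> R by rewrite -subn1 natrB.
pose x := s ^+ 2 * t ^+ 2 / 2.
have x0 : 0 <= x by rewrite divr_ge0// mulr_ge0// sqr_ge0.
have x1 : x <= 2^-1.
  have : `|s * t| <= 1 by rewrite normrM (gtr0_norm s0) mulrC -ler_pdivlMr ?div1r.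
  have := sqr_ge0 (s * t); rewrite -(real_normK (num_real (s * t))) => h1 h2.
  have : `|s * t| ^+ 2 <= 1 by rewrite expr_le1.
  by rewrite (real_normK (num_real (s * t))) exprMn /x; lra.
have xc : c * t ^+ 2 = x / 4 by rewrite /c /x; field.
pose M := expR (- (c * t ^+ 2)).
have psiM : psi t <= M by rewrite ler_expR lerN2 xc -/x; lra.
have normpsi : normc (psi t)%:C = psi t by rewrite normc_real ger0_norm// expR_ge0.
have phiM : normc (phi t) <= M.
  rewrite -(subrK (psi t)%:C (phi t)); apply: le_trans (normcD_le _ _) _.
  rewrite normpsi.
  have := expRN_le_sqr x0; rewrite -/(psi t) => h1.
  have h2 : 1 - c * t ^+ 2 <= M by have := expR_ge1Dx (- (c * t ^+ 2)).
  have h3 : e1 * t ^+ 2 <= x / 2.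
    rewrite (_ : x / 2 = s ^+ 2 / 4 * t ^+ 2); last by rewrite /x; field.
    by rewrite ler_wpM2r// sqr_ge0.
  have h4 : x ^+ 2 / 2 <= x / 4 by rewrite expr2; have := ler_wpM2l x0 x1; lra.
  lra.
pose v := n%:R * t ^+ 2.
have v0 : 0 <= v by rewrite mulr_ge0// sqr_ge0.
have decay q : n%:R / 4 <= q%:R :> R -> M ^+ q <= expR (- (c' * v)).
  move=> hq; rewrite /M -expRM_natl ler_expR mulrN lerN2 /c' /v.
  rewrite (_ : c / 4 * _ = (n%:R / 4) * (c * t ^+ 2)); last by ring.
  by rewrite ler_wpM2r// mulr_ge0 ?sqr_ge0// ltW.
have vdecay : v * expR (- (c' * v)) <= K / (1 + v) by exact: mulr_expRN_le.
have A1 : normc (phi t ^+ p - (psi t ^+ p)%:C) <= e1 * (K / (1 + v)).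
  rewrite rmorphXn/=; apply: le_trans (normc_expB_le _ phiM _) _.
    by rewrite normpsi.
  apply: (@le_trans _ _ (n%:R * (e1 * t ^+ 2) * expR (- (c' * v)))); last first.
    apply: le_trans (ler_wpM2l (ltW e10) vdecay); rewrite /v; lra.
  apply: ler_pM.
  - by rewrite mulr_ge0// normc_ge0.
  - by rewrite exprn_ge0// expR_ge0.
  - by apply: ler_pM => //; [exact: normc_ge0|rewrite ler_nat].
  - by apply: decay; rewrite pE.
have A2 : normc ((psi t ^+ p)%:C - (psi t ^+ n)%:C) <= kappa * (4 * c) * (K / (1 + v)).
  rewrite -rmorphB normc_real -(subnKC pn) exprD -{1}[psi t ^+ p]mulr1 -mulrBr normrM.
  rewrite ger0_norm ?exprn_ge0 ?expR_ge0//.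
  have h1 : psi t ^+ p <= expR (- (c' * v)).
    apply: le_trans (_ : M ^+ p <= _).
      by apply: lerXn2r => //; rewrite nnegrE expR_ge0.
    by apply: decay; lra.
  have h2 : `|1 - psi t ^+ (n - p)| <= kappa * (4 * c) * v.
    rewrite /psi -expRM_natl mulrN.
    have y0 : 0 <= (n - p)%:R * (s ^+ 2 * t ^+ 2 / 2) by rewrite mulr_ge0.
    have := expR_ge1Dx (- ((n - p)%:R * (s ^+ 2 * t ^+ 2 / 2))) => h.
    rewrite ger0_norm; last by rewrite subr_ge0 -[leRHS]expR0 ler_expR oppr_le0.
    apply: (@le_trans _ _ ((n - p)%:R * (s ^+ 2 * t ^+ 2 / 2))); first by lra.
    rewrite (_ : kappa * _ * v = kappa * n%:R * (s ^+ 2 * t ^+ 2 / 2)); last by rewrite /c /v; field.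
    by rewrite ler_wpM2r.
  apply: (@le_trans _ _ (expR (- (c' * v)) * (kappa * (4 * c) * v))).
    by apply: ler_pM => //; rewrite exprn_ge0// expR_ge0.
  rewrite [leLHS](_ : _ = kappa * (4 * c) * (v * expR (- (c' * v)))); last by ring.
  by apply: ler_wpM2l => //; rewrite !mulr_ge0// ltW.
rewrite -(subrK (psi t ^+ p)%:C (phi t ^+ p)) -addrA.
apply: le_trans (normcD_le _ _) _.
apply: le_trans (lerD A1 A2) _.
rewrite (_ : _ + _ = (e1 * K + kappa * (4 * c * K)) / (1 + v)); last by ring.
by rewrite ler_wpM2r ?invr_ge0 ?addr_ge0//; lra.
Unshelve. all: by end_near. Qed.

End chf_power.

(** * Limit theorems for the walk *)

Section normal_intervals.
Context {R : realType}.
Local Notation leb := (@lebesgue_measure R).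
Variable s : R.
Hypothesis s0 : 0 < s.
Local Notation g := (normal_pdf 0 s).

Lemma normal_peak_le : normal_peak s <= s^-1.
Proof.
rewrite /normal_peak lef_pV2 ?posrE ?sqrtr_gt0 ?mulrn_wgt0 ?mulr_gt0 ?pi_gt0 ?exprn_gt0//.
rewrite -[leLHS](gtr0_norm s0) -sqrtr_sqr ler_wsqrtr//.
have := pi_ge2 R => pi2; rewrite -mulrnAr ler_peMr ?sqr_ge0// mulr2n; lra.
Qed.

(** The derivative is -x g / s^2, and |x| g is at most s times the peak, hence at most 1. *)
Lemma normal_pdf_lipschitz (x y : R) : `|g x - g y| <= s^-2 * `|x - y|.
Proof.
apply: (@is_derive_lipschitz _ _ (fun x => - x / s ^+ 2 * g x)).
  by move=> z; exact: is_derive_normal_pdf.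
move=> z; rewrite normrM normrM normrN (ger0_norm (normal_pdf_ge0 _ _ _)).
rewrite (@ger0_norm _ (s ^- 2)) ?invr_ge0 ?sqr_ge0// mulrAC mulrC.
rewrite ler_piMr ?invr_ge0 ?sqr_ge0//.
apply: le_trans (normr_normal_pdf_bounded s0 z) _.
by rewrite mulrC -ler_pdivlMr// div1r; exact: normal_peak_le.
Qed.

Lemma prob_itv_normal (x L : R) :
  prob_itv (normal_prob 0 s) id x (x + L) = \int[leb]_(y in `]x, x + L]) g y.
Proof.
by rewrite /prob_itv /Rintegral /normal_prob; congr fine; congr (integral _ _ _).
Qed.

Let leb_itv (x L : R) : 0 <= L -> fine (leb `]x, x + L]%classic) = L.
Proof.
move=> L0; rewrite [X in fine X]lebesgue_measure_itv/= lte_fin ltrDl.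
by move: L0; rewrite le_eqVlt => /predU1P[<-|L0]; rewrite ?ltxx// L0/=; ring.
Qed.

Let ig (x L : R) : leb.-integrable `]x, x + L] (EFin \o g).
Proof.
apply: (integrableS measurableT) => //; exact: (integrable_normal_pdf 0 s).
Qed.

Let icst (x L c : R) : leb.-integrable `]x, x + L] (EFin \o (fun=> c)).
Proof.
apply: measurable_bounded_integrable => //.
  by rewrite [X in (X < _)%E]lebesgue_measure_itv/=; case: ifP => _; rewrite -?EFinD ltry.
exists `|c|; split; first exact: num_real.
by move=> K hK y _ /=; rewrite ltW.
Qed.

Lemma prob_itv_normal_le (x L : R) : 0 <= L ->
  prob_itv (normal_prob 0 s) id x (x + L) <= s^-1 * L.
Proof.
move=> L0; rewrite prob_itv_normal -[in leRHS](leb_itv x L0) -Rintegral_cst//.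
apply: le_Rintegral => // y _.
by apply: le_trans normal_peak_le; apply: normal_pdf_ub; rewrite gt_eqF.
Qed.

Lemma prob_itv_normal_dist (x L v : R) : 0 <= L ->
  `|prob_itv (normal_prob 0 s) id x (x + L) - L * g v| <= L * ((`|x - v| + L) * s^-2).
Proof.
move=> L0; rewrite prob_itv_normal mulrC -[X in _ * X](leb_itv x L0) -Rintegral_cst//.
rewrite -RintegralB//.
apply: le_trans (le_normr_Rintegral _ _) _ => //; first exact: integrableB (ig x L) (icst _ _ _).
rewrite [leRHS]mulrC -[X in _ <= _ * X](leb_itv x L0) -Rintegral_cst//.
apply: le_Rintegral => //.
  exact: integrable_norm (integrableB _ (ig x L) (icst _ _ _)).
move=> y /=; rewrite in_itv/= => /andP[xy yL].
apply: le_trans (normal_pdf_lipschitz y v) _.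
rewrite mulrC ler_wpM2r ?invr_ge0 ?sqr_ge0//.
have -> : y - v = (x - v) + (y - x) by ring.
by apply: le_trans (ler_normD _ _) _; rewrite lerD2l ger0_norm; lra.
Qed.

End normal_intervals.

(** * Rescaled standard normal variables *)

Section scaled_normal.
Context {R : realType}.
Variable c : R.
Hypothesis c0 : 0 < c.

Lemma prob_itv_scale d (T : measurableType d) (P : probability T R) (X : T -> R) (u v : R) :
  prob_itv P (fun w => c * X w) u v = prob_itv P X (c^-1 * u) (c^-1 * v).
Proof.
rewrite /prob_itv; congr (fine (P _)); apply/seteqP; split => w /=;
  by rewrite ![c^-1 * _]mulrC ltr_pdivrMr// ler_pdivlMr// mulrC.
Qed.

Let mulD (x L : R) : c^-1 * (x + L) = c^-1 * x + c^-1 * L. Proof. exact: mulrDr. Qed.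

Let ci0 : 0 <= c^-1. Proof. by rewrite invr_ge0 ltW. Qed.

(** The normal law of deviation c is represented as c times a standard normal variable, so that one
    fixed law serves every n. *)
Lemma prob_itv_scaled_normal_le (x L : R) : 0 <= L ->
  prob_itv (normal_prob 0 1) (fun z => c * z) x (x + L) <= c^-1 * L.
Proof.
move=> L0; rewrite prob_itv_scale mulD.
have := @prob_itv_normal_le R 1 ltr01 (c^-1 * x) (c^-1 * L) (mulr_ge0 ci0 L0).
by rewrite invr1 mul1r.
Qed.

Lemma prob_itv_scaled_normal_dist (x L v : R) : 0 <= L ->
  `|prob_itv (normal_prob 0 1) (fun z => c * z) x (x + L) -
    c^-1 * L * normal_pdf 0 1 (c^-1 * v)| <= c^-2 * L * (`|x - v| + L).
Proof.
move=> L0; rewrite prob_itv_scale mulD.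
have := @prob_itv_normal_dist R 1 ltr01 (c^-1 * x) (c^-1 * L) (c^-1 * v) (mulr_ge0 ci0 L0).
move=> /le_trans; apply.
rewrite expr1n invr1 mulr1 -mulrBr normrM (ger0_norm ci0) -exprVn.
by rewrite le_eqVlt; apply/orP; left; apply/eqP; ring.
Qed.

End scaled_normal.

(** * Central and local limit theorems for the walk *)

Section psum_limit.
Context d (T : measurableType d) d' (T' : measurableType d') (R : realType).
Context (P : probability T R) (Z : nat -> {RV P >-> T'}).
Hypothesis indepZ : mutually_independent Z.
Variable Y : nat -> T -> R.
Hypothesis kY : forall k (J : set nat), J k -> known Z J (Y k).
Variables (phi : R -> R[i]) (s : R).
Hypothesis s0 : 0 < s.
Hypothesis chfY : forall k t, chf P (Y k) t = phi t.
Local Open Scope complex_scope.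
Let psi (t : R) : R := expR (- (s ^+ 2 * t ^+ 2 / 2)).
Hypothesis phi_small : forall e : R, 0 < e -> exists2 r : R, 0 < r & forall t, `|t| <= r ->
  normc (phi t - (psi t)%:C) <= e * t ^+ 2.

Local Notation G n := (fun x : measurableTypeR R => s * Num.sqrt n%:R * x).
Local Notation N01 := (normal_prob (0 : R) 1).

Let chf_N n t : (0 < n)%N -> chf N01 (G n) t = (psi t ^+ n)%:C.
Proof.
move=> n0; have -> : chf N01 (G n) t = chf N01 id (t * (s * Num.sqrt n%:R)).
  by rewrite /chf /ecos /esin; congr (_ +i* _); apply: eq_Rintegral => x _; rewrite mulrA.
rewrite /chf ecos_normal ?esin_normal//.
rewrite /psi -expRM_natl !exprMn sqr_sqrtr//; congr (expR _ +i* _); ring.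
Qed.

(** Smoothing followed by unsmoothing. Rescaling t by h turns 1 + n t^2 into 1 + (w t)^2 with w =
    sqrt n / h, so the [e1] part gains the factor 1 / sqrt n; [c] bounds the comparison density. *)
Lemma psum_normal_dist n p (h dl e1 e2 x L : R) : (0 < n)%N -> 0 < h -> h <= dl ->
  0 <= e1 -> 0 <= e2 -> 0 <= L ->
  (forall t, 0 <= t <= h^-1 ->
    normc (phi t ^+ p - (psi t ^+ n)%:C) <= e1 / (1 + n%:R * t ^+ 2) + e2) ->
  forall e c : R, e = 4 * e1 / Num.sqrt n%:R + 2 * e2 / h -> c = (s * Num.sqrt n%:R)^-1 ->
  `|prob_itv P (psum Y 0 p) x (x + L) - prob_itv N01 (G n) x (x + L)| <=
    4 * dl * c + 2 * e * (L + 2 * dl) + 72 * (h / dl) * (c + e) * (L + 4 * dl).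
Proof.
move=> n0 h0 hdl e10 e20 L0 hphi e c eE cE.
have sn0 : 0 < Num.sqrt (n%:R : R) by rewrite sqrtr_gt0 ltr0n.
have ssn0 : 0 < s * Num.sqrt n%:R by rewrite mulr_gt0.
have c0 : 0 <= c by rewrite cE invr_ge0 ltW.
have e0 : 0 <= e by rewrite eE; nneg; rewrite invr_ge0 ltW.
have mS : measurable_fun [set: T] (psum Y 0 p) := measurable_psum kY 0 p.
have mid : measurable_fun [set: measurableTypeR R] (G n) by exact: measurable_funM.
apply: (unsmooth mS mid c0 e0 h0 hdl _ _ _ L0).
- by move=> y l l0; rewrite cE; exact: prob_itv_scaled_normal_le.
- move=> y.
  have w0 : 0 < Num.sqrt n%:R / h by rewrite divr_gt0.
  have hb t : 0 <= t <= 1 -> normc (chf P (psum Y 0 p) (t / h) - chf N01 (G n) (t / h)) <=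
      e1 / (1 + (Num.sqrt n%:R / h * t) ^+ 2) + e2.
    move=> /andP[t0 t1]; rewrite (chf_psum indepZ kY _ _ (fun k => chfY k (t / h))) chf_N//.
    have := hphi (t / h); rewrite divr_ge0 ?(ltW h0)//= ler_pdivrMr// mulVf ?gt_eqF// t1.
    move=> /(_ isT) /le_trans; apply.
    by rewrite !exprMn sqr_sqrtr// exprVn mulrAC mulrA.
  have -> : h * e = 4 * e1 / (Num.sqrt n%:R / h) + 2 * e2.
    by rewrite eE; field; rewrite !gt_eqF.
  apply: fejer_expectation_dist => // t /hb; apply: le_trans.
    exact: (@normr_Re_le _ (chf P (psum Y 0 p) (t / h) - chf N01 (G n) (t / h))).
  exact: (@normr_Im_le _ (chf P (psum Y 0 p) (t / h) - chf N01 (G n) (t / h))).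
Qed.

(** The order of choice: dl for the margins, then kap = h / dl for the tail of the kernel, then eta
    for the difference of characteristic functions; each term takes at most e / 4. Lengths are
    rescaled by sqrt n for the central limit theorem; for the local one only the errors are. *)
Let pick_parameters (L e : R) : 0 <= L -> 0 < e -> exists dl kap eta : R,
  [/\ 0 < dl, 0 < kap, kap <= 1, 0 < eta & forall e', 0 <= e' <= eta ->
    4 * dl * s^-1 + 2 * e' * (L + 2 * dl) + 72 * kap * (s^-1 + e') * (L + 4 * dl) <= e].
Proof.
move=> L0 e0.
pose dl := e * s / 16.
have dl0 : 0 < dl by rewrite divr_gt0// mulr_gt0.
have A0 : 0 < L + 4 * dl by rewrite ltr_wpDl// mulr_gt0.
have si0 : 0 < s^-1 by rewrite invr_gt0.
pose kap := Num.min 1 (e / (288 * (s^-1 + 1) * (L + 4 * dl))).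
have B0 : 0 < 288 * (s^-1 + 1) * (L + 4 * dl).
  by rewrite mulr_gt0// mulr_gt0 ?(ltr0n R 288) ?addr_gt0.
pose eta := Num.min 1 (e / (8 * (L + 4 * dl))).
exists dl, kap, eta; split => //.
- by rewrite lt_min ltr01 divr_gt0.
- by rewrite ge_min lexx.
- by rewrite lt_min ltr01 divr_gt0// mulr_gt0.
move=> e' /andP[e'0]; rewrite le_min => /andP[e'1 e'e].
have h1 : 4 * dl * s^-1 = e / 4 by rewrite /dl; field; rewrite gt_eqF.
have h2 : 2 * e' * (L + 2 * dl) <= e / 4.
  apply: (@le_trans _ _ (2 * e' * (L + 4 * dl))).
    by rewrite ler_wpM2l ?mulr_ge0//; lra.
  by move: e'e; rewrite ler_pdivlMr ?mulr_gt0//; lra.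
have h3 : 72 * kap * (s^-1 + e') * (L + 4 * dl) <= e / 4.
  have k0 : 0 <= kap by rewrite le_min ler01 divr_ge0 ?ltW.
  apply: (@le_trans _ _ (72 * kap * (s^-1 + 1) * (L + 4 * dl))).
    rewrite ler_wpM2r ?(ltW A0)// ler_wpM2l ?mulr_ge0// lerD2l//.
  have : kap <= e / (288 * (s^-1 + 1) * (L + 4 * dl)) by rewrite ge_min lexx orbT.
  by rewrite ler_pdivlMr//; lra.
lra.
Qed.

(** Here the kernel width h grows like sqrt n, so the frequencies up to 1 / h shrink to 0 and
    eventually lie where [chf_power_dist] applies. *)
Lemma psum_clt (L e : R) : 0 <= L -> 0 < e -> \forall n \near \oo, forall x,
  `|prob_itv P (psum Y 0 n) x (x + L * Num.sqrt n%:R) -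
    prob_itv N01 (G n) x (x + L * Num.sqrt n%:R)| <= e.
Proof.
move=> L0 e0; have [dl [kap [eta [dl0 kap0 kap1 eta0 hpick]]]] := pick_parameters L0 e0.
have eta4 : 0 < eta / 4 by rewrite divr_gt0.
have [r r0 [kappa k0 hr]] := chf_power_dist s0 phi_small eta4.
near=> n => x.
have n0 : (0 < n)%N by near: n; exact: nbhs_infty_gt.
have sn0 : 0 < Num.sqrt (n%:R : R) by rewrite sqrtr_gt0 ltr0n.
pose h := kap * dl * Num.sqrt n%:R.
have h0 : 0 < h by rewrite !mulr_gt0.
have rh : h^-1 <= r.
  rewrite invf_ple// /h mulrC -ler_pdivrMr ?mulr_gt0//.
  have -> : r^-1 / (kap * dl) = Num.sqrt ((r^-1 / (kap * dl)) ^+ 2).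
    by rewrite sqrtr_sqr ger0_norm// mulr_ge0 ?invr_ge0 ?(ltW r0)// mulr_ge0 ?ltW.
  by apply: ler_wsqrtr; near: n; exact: nbhs_infty_ger.
have hdl : h <= dl * Num.sqrt n%:R.
  by rewrite /h -mulrA ler_piMl// mulr_ge0 ?ltW.
have hb t : 0 <= t <= h^-1 -> normc (phi t ^+ n - (psi t ^+ n)%:C) <=
    (eta / 4) / (1 + n%:R * t ^+ 2) + 0.
  move=> /andP[t0 th]; rewrite addr0.
  have near_hr : forall p, (p <= n)%N -> (n - p)%:R <= kappa * n%:R ->
    forall t, `|t| <= r -> normc (phi t ^+ p - (psi t ^+ n)%:C) <= (eta / 4) / (1 + n%:R * t ^+ 2).
    by near: n.
  apply: near_hr => //; first by rewrite subnn mulr_ge0// ltW.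
  by rewrite ger0_norm// (le_trans th).
have := psum_normal_dist x n0 h0 hdl (ltW eta4) (lexx 0) (mulr_ge0 L0 (ltW sn0)) hb erefl erefl.
move=> /le_trans; apply.
have := hpick eta; rewrite (ltW eta0) lexx => /(_ isT); apply: le_trans.
rewrite /h le_eqVlt; apply/orP; left; apply/eqP.
by field; rewrite !gt_eqF.
Unshelve. all: by end_near. Qed.

Hypothesis phi_off0 : forall r b : R, 0 < r -> r <= b ->
  exists2 lam : R, 0 < lam & forall t, r <= t <= b -> normc (phi t) <= expR (- lam).

(** The kernel width is now fixed. Frequencies below r are treated as in the central limit theorem;
    between r and 1 / h both powers decay exponentially by [phi_off0]. *)
Lemma psum_llt (L e : R) : 0 <= L -> 0 < e -> exists2 kappa : R, 0 < kappa &
  \forall n \near \oo, forall p, (p <= n)%N -> (n - p)%:R <= kappa * n%:R -> forall x,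
  `|prob_itv P (psum Y 0 p) x (x + L) - prob_itv N01 (G n) x (x + L)| <= e / Num.sqrt n%:R.
Proof.
move=> L0 e0; have [dl [kap [eta [dl0 kap0 kap1 eta0 hpick]]]] := pick_parameters L0 e0.
have eta8 : 0 < eta / 8 by rewrite divr_gt0.
have [r r0 [kappa k0 hr]] := chf_power_dist s0 phi_small eta8.
pose h := kap * dl; have h0 : 0 < h by rewrite mulr_gt0.
have hdl : h <= dl by rewrite ler_piMl// ltW.
(* The maximum ensures r <= b even when 1 / h is smaller than r. *)
pose b := Num.max r h^-1.
have [lam0 lam00 hlam0] := @phi_off0 r b r0 ltac:(by rewrite le_max lexx).
(* A common decay rate for phi and for psi beyond r. *)
pose lam := Num.min lam0 (s ^+ 2 * r ^+ 2 / 2).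
have lamp : 0 < lam by rewrite lt_min lam00 divr_gt0// mulr_gt0 ?exprn_gt0.
exists (Num.min kappa 2^-1); first by rewrite lt_min k0 invr_gt0 ltr0n.
near=> n => p pn npk x.
have n0 : (0 < n)%N by near: n; exact: nbhs_infty_gt.
have nR0 : 0 < n%:R :> R by rewrite ltr0n.
have sn0 : 0 < Num.sqrt (n%:R : R) by rewrite sqrtr_gt0 ltr0n.
have npk1 : (n - p)%:R <= kappa * n%:R.
  by apply: le_trans npk _; rewrite ler_wpM2r// ge_min lexx.
have pn2 : n%:R / 2 <= p%:R :> R.
  have : (n - p)%:R <= 2^-1 * n%:R :> R.
    by apply: le_trans npk _; rewrite ler_wpM2r// ge_min lexx orbT.
  by rewrite natrB//; lra.
(* Exponential decay at powers of at least n / 2 is weakened to order 1 / n, which still vanishes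
   after multiplication by sqrt n. Each of phi^p and psi^n takes half of [e2]. *)
pose e2 := 4 / (lam * n%:R).
have e20 : 0 <= e2 by rewrite divr_ge0// mulr_ge0// ltW.
have small q (z : R) : n%:R / 2 <= q%:R :> R -> 0 <= z -> z <= expR (- lam) -> z ^+ q <= e2 / 2.
  move=> hq z0 hz; apply: (@le_trans _ _ (expR (- lam) ^+ q)).
    by apply: lerXn2r => //; rewrite nnegrE ?expR_ge0.
  rewrite -expRM_natl mulrN expRN.
  have lq0 : 0 < q%:R * lam by rewrite mulr_gt0//; lra.
  apply: (@le_trans _ _ ((q%:R * lam)^-1)).
    rewrite lef_pV2 ?posrE ?expR_gt0//.
    by have := expR_ge1Dx (q%:R * lam); lra.
  rewrite (_ : e2 / 2 = ((n%:R / 2) * lam)^-1); last first.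
    by rewrite /e2; field; rewrite !gt_eqF.
  have nl0 : 0 < n%:R / 2 * lam by rewrite mulr_gt0// divr_gt0.
  by rewrite lef_pV2 ?posrE//; apply: ler_wpM2r => //; exact: ltW.
have hb t : 0 <= t <= h^-1 -> normc (phi t ^+ p - (psi t ^+ n)%:C) <=
    (eta / 8) / (1 + n%:R * t ^+ 2) + e2.
  move=> /andP[t0 th]; have [tr|rt] := leP t r.
    have near_hr : forall p, (p <= n)%N -> (n - p)%:R <= kappa * n%:R ->
      forall t, `|t| <= r -> normc (phi t ^+ p - (psi t ^+ n)%:C) <= (eta / 8) / (1 + n%:R * t ^+ 2).
      by near: n.
    apply: le_trans (near_hr p pn npk1 t _) _; first by rewrite ger0_norm.
    by rewrite lerDl.
  apply: (@le_trans _ _ (e2 / 2 + e2 / 2)); last first.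
    rewrite -[leLHS]add0r -splitr lerD2r divr_ge0 ?(ltW eta8)// addr_ge0//.
    by rewrite mulr_ge0// sqr_ge0.
  apply: le_trans (normcD_le _ _) _; rewrite normcN normc_real normrX normcX.
  apply: lerD.
    apply: small => //; first exact: normc_ge0.
    apply: (@le_trans _ _ (expR (- lam0))).
      by apply: hlam0; rewrite (ltW rt)/= le_max th orbT.
    by rewrite ler_expR lerN2 ge_min lexx.
  rewrite ger0_norm ?expR_ge0//; apply: small; rewrite ?expR_ge0//; first by lra.
  rewrite /psi ler_expR lerN2 /lam ge_min; apply/orP; right.
  rewrite ler_pM2r// ler_pM2l ?exprn_gt0//.
  by apply: lerXn2r; rewrite ?nnegrE//; exact: ltW.
have := psum_normal_dist x n0 h0 hdl (ltW eta8) e20 L0 hb erefl erefl.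
move=> /le_trans; apply.
rewrite ler_pdivlMr//.
pose e' := 4 * (eta / 8) + 2 * e2 / h * Num.sqrt n%:R.
have e'0 : 0 <= e'.
  by rewrite /e'; nneg; rewrite ?invr_ge0 ltW.
have e'eta : e' <= eta.
  have : 2 * e2 / h * Num.sqrt n%:R <= eta / 2.
    have -> : 2 * e2 / h * Num.sqrt n%:R = (8 / (lam * h)) / Num.sqrt n%:R.
      rewrite /e2 -{1}(sqr_sqrtr (ler0n R n)); field; rewrite !gt_eqF//.
    rewrite ler_pdivrMr// [leRHS]mulrC -ler_pdivrMr ?divr_gt0//.
    rewrite -[leLHS]ger0_norm; last by rewrite !divr_ge0 ?mulr_ge0// ltW.
    rewrite -sqrtr_sqr; apply: ler_wsqrtr; near: n; exact: nbhs_infty_ger.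
  rewrite /e'; lra.
have := hpick e'; rewrite e'0 e'eta => /(_ isT); apply: le_trans.
rewrite le_eqVlt; apply/orP; left; apply/eqP.
rewrite /e' /h; field.
by rewrite !gt_eqF.
Unshelve. all: by end_near. Qed.

End psum_limit.

(** * Characteristic functions of nonlattice laws *)

Section nonlattice_chf.
Context {R : realType} d (T : measurableType d) (P : probability T R).

(** Reduce to [0, 2 pi[ by the integer part; there injectivity of the cosine on [0, pi] decides,
    after reflection at pi for the upper half. *)
Lemma cos_eq1_2pi (x : R) : cos x = 1 -> exists k : int, x = k%:~R * (pi *+ 2).
Proof.
move=> cx.
have p0 : 0 < pi *+ 2 :> R by rewrite mulrn_wgt0// pi_gt0.
pose k := Num.floor (x / (pi *+ 2)); exists k.
pose y := x - k%:~R * (pi *+ 2).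
have /andP[y0 y1] : 0 <= y < pi *+ 2.
  have /andP[h1 h2] := floor_itv (x / (pi *+ 2)).
  rewrite ler_pdivlMr// in h1; rewrite ltr_pdivrMr// intrD mulrDl mul1r in h2.
  by rewrite /y; apply/andP; split; lra.
have cy : cos y = 1.
  rewrite -cx; case: (k) @y {y0 y1} => n y; rewrite /y.
    have := periodicn (@cosD2pi R) n (x - n%:Z%:~R * (pi *+ 2)) => <-; congr cos.
    by rewrite -mulr_natl -pmulrn; ring.
  have := periodicn (@cosD2pi R) n.+1 x => <-; congr cos.
  by rewrite NegzE intrN mulNr opprK -[_ *+ n.+1]mulr_natl -pmulrn.
suff y00 : y = 0 by rewrite -[LHS](subrK (k%:~R * (pi *+ 2))) -/y y00 add0r.
have [ypi|piy] := leP y pi.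
  apply: cos_inj; first by rewrite in_itv/= y0.
    by rewrite in_itv/= lexx pi_ge0.
  by rewrite cos0.
have cy' : cos (pi *+ 2 - y) = cos 0.
  by rewrite cos0 -cy -(cosN y) addrC -(@cosD2pi R (- y)).
have : pi *+ 2 - y = 0.
  apply: cos_inj cy'; rewrite in_itv/= ?lexx ?pi_ge0//.
  by apply/andP; split; rewrite mulr2n; rewrite mulr2n in y1; lra.
lra.
Qed.

Lemma polar (a b : R) : exists th : R,
  a = Num.sqrt (a ^+ 2 + b ^+ 2) * cos th /\ b = Num.sqrt (a ^+ 2 + b ^+ 2) * sin th.
Proof.
set rho := Num.sqrt _.
have ab0 : 0 <= a ^+ 2 + b ^+ 2 by rewrite addr_ge0 ?sqr_ge0.
have rho2 : rho ^+ 2 = a ^+ 2 + b ^+ 2 by rewrite sqr_sqrtr.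
have [r0|rn0] := eqVneq rho 0.
  exists 0; rewrite r0 !mul0r.
  move: rho2; rewrite r0 expr0n/= => /esym/eqP.
  by rewrite paddr_eq0 ?sqr_ge0// !sqrf_eq0 => /andP[/eqP-> /eqP->].
have r0 : 0 < rho by rewrite lt0r rn0 sqrtr_ge0.
have c1 : -1 <= a / rho <= 1.
  rewrite ler_pdivlMr// ler_pdivrMr// mulN1r mul1r -ler_norml -sqrtr_sqr ler_wsqrtr//.
  by rewrite lerDl sqr_ge0.
have ca : rho * cos (acos (a / rho)) = a by rewrite acosK ?in_itv// mulrC divfK.
have sa : rho * sin (acos (a / rho)) = `|b|.
  rewrite sin_acos// -[X in X * _](gtr0_norm r0) -sqrtr_sqr -sqrtrM ?sqr_ge0//.
  rewrite -sqrtr_sqr; congr Num.sqrt.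
  rewrite mulrBr mulr1 -exprMn mulrC divfK//.
  by rewrite rho2; ring.
have [b0|b0] := leP 0 b.
  by exists (acos (a / rho)); rewrite ca sa ger0_norm.
by exists (- acos (a / rho)); rewrite cosN sinN mulrN ca sa ltr0_norm// opprK.
Qed.

Variable Y : T -> R.
Hypotheses (mY : measurable_fun [set: T] Y) (iY : P.-integrable [set: T] (EFin \o Y)).

(** Rotating by its argument th makes the value of the characteristic function real and
    nonnegative. *)
Let modulus t : exists th : R,
  normc (chf P Y t) = \int[P]_w cos (t * Y w - th).
Proof.
have [th [h1 h2]] := polar (ecos P Y t) (esin P Y t).
exists th; rewrite /chf/=; set rho := Num.sqrt _ in h1 h2 *.
have ic := integrable_cosM P mY t; have is_ := integrable_sinM P mY t.
transitivity (\int[P]_w (cos th * cos (t * Y w) + sin th * sin (t * Y w))).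
  rewrite RintegralD//; [|exact: (integrableZl _ _ ic)|exact: (integrableZl _ _ is_)].
  rewrite !RintegralZl// -/(ecos P Y t) -/(esin P Y t) h1 h2.
  rewrite -[LHS]mulr1 -(cos2Dsin2 th); ring.
by apply: eq_Rintegral => w _; rewrite cosB mulrC (mulrC (sin th)).
Qed.

Let mcos t th : measurable_fun [set: T] (fun w => cos (t * Y w - th)).
Proof.
apply: (measurableT_comp (f := cos)).
  by apply: continuous_measurable_fun; exact: continuous_cos.
by apply: measurable_funB => //; exact: measurable_funM.
Qed.

Let icos t th : P.-integrable [set: T] (EFin \o (fun w => cos (t * Y w - th))).
Proof. by apply: (@bounded_integrable _ _ _ _ _ 1) => // w; exact: cos_max. Qed.

Lemma normc_chf_le1 t : normc (chf P Y t) <= 1.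
Proof.
have [th ->] := modulus t.
apply: le_trans (ler_norm _) _.
by apply: normr_Rintegral_le => // w; exact: cos_max.
Qed.

(** Cosine and sine are 1-Lipschitz, so both parts are Lipschitz in t with constant E|Y|. *)
Lemma continuous_normc_chf : continuous (fun t : R => normc (chf P Y t)).
Proof.
have inY : P.-integrable [set: T] (EFin \o (fun w => `|Y w|)) by exact: integrable_norm iY.
have lip (f : R -> R) (mf : forall t, P.-integrable [set: T] (EFin \o (fun w => f (t * Y w)))) :
    (forall x y, `|f x - f y| <= `|x - y|) ->
    continuous (fun t : R => \int[P]_w f (t * Y w)).
  move=> fl t; apply/cvgrPdist_le => e e0.
  pose K := \int[P]_w `|Y w| + 1.
  have K0 : 0 < K by rewrite ltr_wpDl// Rintegral_ge0.
  near=> u.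
  rewrite -RintegralB//; apply: le_trans (le_normr_Rintegral _ _) _ => //.
    exact: (integrableB _ (mf t) (mf u)).
  apply: (@le_trans _ _ (`|t - u| * \int[P]_w `|Y w|)).
    rewrite -RintegralZl//; apply: le_Rintegral => //.
    - exact: integrable_norm (integrableB _ (mf t) (mf u)).
    - exact: (integrableZl _ _ inY).
    - by move=> w _; rewrite -normrM mulrBl.
  apply: (@le_trans _ _ (`|t - u| * K)); first by rewrite ler_wpM2l// lerDl.
  rewrite -ler_pdivlMr//.
  near: u; apply: (@cvgr_dist_le _ _ _ _ _ id); [exact: cvg_id|exact: divr_gt0].
move=> t; rewrite /chf/=.
apply: (cvg_comp (fun t : R => ecos P Y t ^+ 2 + esin P Y t ^+ 2) Num.sqrt); last exact: sqrt_continuous.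
apply: cvgD.
  apply: (cvg_comp (ecos P Y) (fun x => x ^+ 2)); last exact: exprn_continuous.
  by apply: lip; [move=> u; exact: integrable_cosM|exact: normr_cosB_le].
apply: (cvg_comp (esin P Y) (fun x => x ^+ 2)); last exact: exprn_continuous.
by apply: lip; [move=> u; exact: integrable_sinM|exact: normr_sinB_le].
Unshelve. all: by end_near. Qed.

(* |E e^{itY}| = 1 forces cos (t Y - th) = 1 almost surely for some phase th. *)
Lemma normc_chf_eq1 t : 0 < t -> normc (chf P Y t) = 1 ->
  exists th : R, {ae P, forall w, exists k : int, Y w = th + (pi *+ 2 / t) * k%:~R}.
Proof.
move=> t0 h; have [th hth] := modulus t; exists (th / t).
have i1 : P.-integrable [set: T] (EFin \o cst 1) by exact: finite_measure_integrable_cst.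
have i2 : P.-integrable [set: T] (EFin \o (fun w => 1 - cos (t * Y w - th))).
  exact: (integrableB _ i1 (icos t th)).
have E0 : \int[P]_w (1 - cos (t * Y w - th)) = 0.
  by rewrite RintegralB// Rintegral_probability_cst -hth h subrr.
have : (\int[P]_w `|(1 - cos (t * Y w - th))%:E| = 0)%E.
  under eq_integral do rewrite gee0_abs ?lee_fin ?subr_ge0 ?cos_le1//.
  by rewrite -[LHS]fineK ?E0//; [congr EFin; exact: E0|exact: integrable_fin_num i2].
move=> /(ae_eq_integral_abs P measurableT (measurable_int _ i2)).
apply: filterS => w /(_ Logic.I)/= [] /eqP; rewrite subr_eq0 => /eqP/esym/cos_eq1_2pi[k hk].
exists k; move: hk => /(congr1 (fun z => (z + th) / t)); rewrite subrK mulrC mulKf ?gt_eqF// => ->.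
by field; rewrite gt_eqF.
Qed.

End nonlattice_chf.

(** The modulus attains its maximum on the compact interval [r, b]. A maximum equal to 1 would put X
    almost surely on a coset of (2 pi / t0) Z, against the hypothesis. *)
Lemma chf_nonlattice {R : realType} d (T : measurableType d) (P : probability T R)
    (X : {RV P >-> R}) (a : R) : P.-integrable [set: T] (EFin \o X) ->
  nonlattice (distribution P X) -> forall r b : R, 0 < r -> r <= b ->
  exists2 lam : R, 0 < lam &
    forall t, r <= t <= b -> normc (chf P (fun w => X w - a) t) <= expR (- lam).
Proof.
move=> iX nl r b r0 rb.
pose Y w := X w - a.
have mY : measurable_fun [set: T] Y by exact: measurable_funB.
have iY : P.-integrable [set: T] (EFin \o Y).
  have ia : P.-integrable [set: T] (EFin \o cst a) by exact: finite_measure_integrable_cst.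
  exact: (integrableB _ iX ia).
have [t0 /[!in_itv]/= /andP[rt0 t0b] tmax] := EVT_max rb
  (continuous_subspaceT (continuous_normc_chf mY iY)).
have t00 : 0 < t0 by exact: lt_le_trans rt0.
have q1 : normc (chf P Y t0) < 1.
  rewrite lt_neqAle normc_chf_le1// andbT; apply/eqP => /(normc_chf_eq1 mY t00)[th hae].
  apply: nl; exists (th + a), (pi *+ 2 / t0); split; first by rewrite divr_gt0// mulrn_wgt0// pi_gt0.
  pose A : set R := [set th + a + pi *+ 2 / t0 * k%:~R | k in [set: int]].
  rewrite -/A.
  have mA : measurable A.
    apply: countable_measurable => //.
    exact: card_le_trans (card_image_le _ _) (countableP _).
  have mXA : measurable (X @^-1` A).
    by rewrite -[X in measurable X]setTI; exact: measurable_funPT.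
  have neg : P.-negligible (~` (X @^-1` A)).
    move: hae; apply: negligibleS => w /= nA [k hk]; apply: nA.
    by exists k => //; rewrite -(subrK a (X w)) -/(Y w) hk; ring.
  have P0 := measure_negligible (measurableC mXA) neg.
  have pr1 : pr P (X @^-1` A) = 1.
    by have := prC P mXA; rewrite {1}/pr P0/= => /eqP; rewrite eq_sym subr_eq0 => /eqP.
  change (P (X @^-1` A) = 1%E).
  by rewrite -prE// pr1.
(* The maximum with 1/2 covers the case where the modulus is 0, for which [ln] would return its
   default value 0 instead of a strictly negative number. *)
pose q := Num.max (normc (chf P Y t0)) 2^-1.
have q0 : 0 < q by rewrite lt_max invr_gt0 ltr0n orbT.
exists (- ln q).
  by rewrite oppr_gt0 ln_lt0// q0/= gt_max q1/= invf_lt1// ltr1n.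
move=> t trb; rewrite opprK lnK// /q le_max; apply/orP; left.
by apply: tmax; rewrite in_itv.
Qed.

(** * From interval probabilities to weak convergence *)

Section interval_convergence.
Context {R : realType}.

(** Compactness of [-A, A]. Only x is confined to the segment; y may lie slightly outside. *)
Lemma segment_unif_continuous (f : R -> R) (A e : R) : continuous f -> 0 < e ->
  exists2 dl : R, 0 < dl & forall x y, - A <= x <= A -> `|x - y| <= dl -> `|f x - f y| <= e.
Proof.
move=> cf e0.
have /compact_near_coveringP nc := @segment_compact R (- A) A.
have := nc nat \oo (fun n x => forall y, `|x - y| <= harmonic n -> `|f x - f y| <= e) _.
case.
  move=> x _.
  have e20 : 0 < e / 2 by rewrite divr_gt0.
  have /cvgrPdist_le/(_ (e / 2) e20) := cf x.
  rewrite /prop_near1 near_simpl => /nbhs_ballP[r /= r0 hr].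
  have r20 : 0 < r / 2 by rewrite divr_gt0.
  near=> x' n => y /= hy.
  have hx' : ball x (r / 2) x' by near: x'; exact: nbhsx_ballx.
  have hn : harmonic n < r / 2.
    near: n; have /cvgr0Pnorm_lt/(_ _ r20) := @cvg_harmonic R.
    by apply: filterS => n; rewrite /= ger0_norm ?invr_ge0.
  have h1 : `|f x - f x'| <= e / 2.
    by apply: hr; apply: le_ball hx'; rewrite [leRHS](splitr r) lerDl ltW.
  have h2 : `|f x - f y| <= e / 2.
    apply: hr; rewrite -ball_normE/=; rewrite -ball_normE/= in hx'.
    apply: le_lt_trans (ler_distD x' x y) _.
    by rewrite (splitr r) ltrD// (le_lt_trans hy).
  apply: le_trans (ler_distD (f x) (f x') (f y)) _.
  by rewrite (splitr e) lerD// distrC.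
move=> N _ /(_ N (leqnn N)) h.
exists (harmonic N); first exact: harmonic_gt0.
by move=> x y xA hxy; apply: h => //=; rewrite in_itv.
Unshelve. all: by end_near. Qed.

Section step.
Context d (T : measurableType d) (P : probability T R) (X : T -> R).
Hypothesis mX : measurable_fun [set: T] X.
Variables (f : R -> R) (K A e h : R) (N : nat).
Hypotheses (cf : continuous f) (fK : forall x, `|f x| <= K) (e0 : 0 <= e) (h0 : 0 <= h).

Let node k : R := - A + h * k%:R.
Let J u v (w : T) : R := \1_(`]u, v]%classic) (X w).

Let mJ u v : measurable_fun [set: T] (J u v).
Proof.
by apply: (@measurableT_comp _ _ _ _ _ _ (\1_(`]u, v]%classic) : R -> R)).
Qed.

Let J01 u v w : 0 <= J u v w <= 1.
Proof. by rewrite /J indicE; case: (_ \in _); rewrite ?lexx ?ler01. Qed.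

Let EJ u v : \int[P]_w J u v w = prob_itv P X u v.
Proof.
rewrite /J -[RHS](pr_Rintegral P (measurable_itv_event mX u v)).
by apply: eq_Rintegral => w _; rewrite !indicE !mem_setE /= in_itv.
Qed.

Let mf : measurable_fun [set: T] (f \o X).
Proof. by apply: measurableT_comp => //; exact: continuous_measurable_fun. Qed.

Let K0 : 0 <= K. Proof. exact: le_trans (normr_ge0 _) (fK 0). Qed.

Let ifJ u v : P.-integrable [set: T] (EFin \o (fun w => f (X w) * J u v w)).
Proof.
apply: (@bounded_integrable _ _ _ _ _ K); first exact: measurable_funM.
by move=> w; have /andP[j0 j1] := J01 u v w; rewrite normrM (ger0_norm j0) -[leRHS]mulr1 ler_pM.
Qed.

Let iJ c u v : P.-integrable [set: T] (EFin \o (fun w => c * J u v w)).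
Proof.
apply: (@bounded_integrable _ _ _ _ _ `|c|); first exact: measurable_funM.
by move=> w; have /andP[j0 j1] := J01 u v w; rewrite normrM (ger0_norm j0) ler_piMr.
Qed.

Let JD u v z w : u <= v -> v <= z -> J u z w = J u v w + J v z w.
Proof.
move=> uv vz; rewrite /J !indicE !mem_setE !in_itv/=.
have [h1|h1] := leP (X w) v.
  by rewrite (le_trans h1 vz)/= addr0.
by rewrite (le_lt_trans uv h1)/= add0r.
Qed.

Hypothesis fe : forall k x, (k < N)%N -> node k < x <= node k.+1 -> `|f x - f (node k)| <= e.

(** On each cell f is replaced by its value at the left node, at cost e; outside ]-A, A] it is
    discarded, at cost K times the missing mass. *)
Lemma step_approximation : node N = A ->
  `|\int[P]_w f (X w) - \sum_(k < N) f (node k) * prob_itv P X (node k) (node k.+1)| <=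
  e + K * (1 - prob_itv P X (- A) A).
Proof.
move=> NA.
have le_node k l : (k <= l)%N -> node k <= node l.
  by move=> kl; rewrite lerD2l ler_wpM2l// ler_nat.
have key k : (k <= N)%N ->
    `|\int[P]_w (f (X w) * J (node 0) (node k) w) -
      \sum_(i < k) f (node i) * prob_itv P X (node i) (node i.+1)| <=
    e * prob_itv P X (node 0) (node k).
  elim: k => [|k IH] kN.
    rewrite big_ord0 subr0 -EJ -RintegralZl//; last first.
      by rewrite (_ : J _ _ = fun w => 1 * J (node 0) (node 0) w) //; apply/funext => w; rewrite mul1r.
    apply: le_trans (le_normr_Rintegral _ _) _ => //.
    rewrite le_eqVlt; apply/orP; left; apply/eqP; apply: eq_Rintegral => w _.
    rewrite /J set_itvoc0 ?lexx//; last first.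
    by rewrite indicE in_set0 !mulr0 normr0.
  rewrite (prob_itvD P mX (le_node 0%N k (leq0n k)) (le_node k k.+1 (leqnSn k))) mulrDr.
  rewrite big_ord_recr/=.
  have -> : \int[P]_w (f (X w) * J (node 0) (node k.+1) w) =
      \int[P]_w (f (X w) * J (node 0) (node k) w) + \int[P]_w (f (X w) * J (node k) (node k.+1) w).
    rewrite -RintegralD//; apply: eq_Rintegral => w _.
    by rewrite -mulrDr -JD// le_node.
  rewrite opprD addrACA; apply: le_trans (ler_normD _ _) _; apply: lerD; first exact: IH (ltnW kN).
  rewrite -EJ -!RintegralZl//; last 2 first.
  - by have := iJ 1 (node k) (node k.+1); under eq_fun do rewrite mul1r.
  - by have := iJ 1 (node k) (node k.+1); under eq_fun do rewrite mul1r.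
  rewrite -RintegralB//; apply: le_trans (le_normr_Rintegral _ _) _ => //.
    exact: (integrableB _ (ifJ _ _) (iJ _ _ _)).
  apply: le_Rintegral => //.
    exact: integrable_norm (integrableB _ (ifJ _ _) (iJ _ _ _)).
  move=> w _; rewrite -mulrBl normrM; have /andP[j0 j1] := J01 (node k) (node k.+1) w.
  rewrite (ger0_norm j0) /J indicE; have [|_] := boolP (X w \in _); last by rewrite !mulr0.
  by rewrite inE/= in_itv/= => /fe hf; rewrite !mulr1 hf.
have n0 : node 0 = - A by rewrite /node mulr0 addr0.
have := key N (leqnn N); rewrite n0 NA => hN.
have i1 : P.-integrable [set: T] (EFin \o (f \o X)).
  by apply: (@bounded_integrable _ _ _ _ _ K) => // w; exact: fK.
have out : `|\int[P]_w f (X w) - \int[P]_w (f (X w) * J (- A) A w)| <=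
    K * (1 - prob_itv P X (- A) A).
  rewrite -EJ -[X in K * (X - _)](Rintegral_probability_cst P) .
  have i2 : P.-integrable [set: T] (EFin \o J (- A) A).
    by have := iJ 1 (- A) A; under eq_fun do rewrite mul1r.
  have i3 : P.-integrable [set: T] (EFin \o cst 1) by exact: finite_measure_integrable_cst.
  rewrite -RintegralB// -RintegralB// -RintegralZl//; last exact: (integrableB _ i3 i2).
  apply: le_trans (le_normr_Rintegral _ _) _ => //; first exact: (integrableB _ i1 (ifJ _ _)).
  apply: le_Rintegral => //.
  - exact: integrable_norm (integrableB _ i1 (ifJ _ _)).
  - exact: (integrableZl _ K (integrableB _ i3 i2)).
  move=> w _; have /andP[j0 j1] := J01 (- A) A w.
  rewrite -{1}[f (X w)]mulr1 -mulrBr normrM (@ger0_norm _ (1 - _)) ?subr_ge0//.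
  by rewrite ler_wpM2r ?subr_ge0.
have p1 : e * prob_itv P X (- A) A <= e by rewrite ler_piMr// prob_itv_le1.
have := ler_normD (\int[P]_w f (X w) - \int[P]_w (f (X w) * J (- A) A w))
  (\int[P]_w (f (X w) * J (- A) A w) -
   \sum_(k < N) f (node k) * prob_itv P X (node k) (node k.+1)).
rewrite addrA subrK; lra.
Qed.

End step.

Lemma prob_itv_tight d (T : measurableType d) (P : probability T R) (X : T -> R) (e : R) :
  measurable_fun [set: T] X -> 0 < e -> exists n : nat, 1 - e <= prob_itv P X (- n%:R) n%:R.
Proof.
move=> mX e0.
pose F (n : nat) : set T := [set w | - n%:R < X w <= n%:R].
have mF n : measurable (F n) by exact: measurable_itv_event.
have UF : \bigcup_n F n = setT.
  apply/seteqP; split => // w _.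
  exists (Num.bound `|X w|) => //.
  have := archi_boundP (normr_ge0 (X w)).
  by rewrite ltr_norml => /andP[h1 h2]; rewrite /F/= h1 ltW.
have /fine_cvgP[_] : (P \o F) n @[n --> \oo] --> (1%:E : \bar R).
  rewrite -[X in _ --> X](probability_setT P) -UF; apply: nondecreasing_cvg_mu => //.
    exact: bigcupT_measurable.
  move=> n m nm; apply/subsetPset => w /= /andP[h1 h2].
  have : n%:R <= m%:R :> R by rewrite ler_nat.
  by move=> nmR; apply/andP; split; lra.
move=> /cvgrPdist_le/(_ _ e0)[N _ /(_ N (leqnn N))/=]; rewrite ler_norml => /andP[_ h].
by exists N; rewrite /prob_itv; rewrite /F in h; lra.
Qed.

(** The grid is fixed by the limit law and f, so that finitely many interval probabilities are to
    converge. Tightness is taken from the limit and passes to X n through the interval ]-A, A]. *)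
Lemma itv_cvg_expectation d1 (T1 : measurableType d1) (P1 : probability T1 R) (X : nat -> T1 -> R)
    d2 (T2 : measurableType d2) (P2 : probability T2 R) (G : T2 -> R) (f : R -> R) (K : R) :
  (forall n, measurable_fun [set: T1] (X n)) -> measurable_fun [set: T2] G ->
  (forall u v, u <= v -> prob_itv P1 (X n) u v @[n --> \oo] --> prob_itv P2 G u v) ->
  continuous f -> (forall x, `|f x| <= K) ->
  \int[P1]_w f (X n w) @[n --> \oo] --> \int[P2]_w f (G w).
Proof.
move=> mX mG hcvg cf fK; apply/cvgrPdist_le => e/= e0.
have K0 : 0 <= K := le_trans (normr_ge0 _) (fK 0).
(* Dividing by K + 1 makes sense for K = 0 as well and makes both e1 and K e1 at most e / 4. *)
pose e1 : R := e / (4 * (K + 1)).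
have e10 : 0 < e1 by rewrite divr_gt0// mulr_gt0// ltr_wpDl.
have e1e : e1 * (K + 1) = e / 4.
  by rewrite /e1; field; rewrite gt_eqF// ltr_wpDl.
have e14 : e1 <= e / 4 by rewrite -e1e ler_peMr ?(ltW e10)// lerDr.
have [n0 hn0] := prob_itv_tight P2 mG e10.
have [dl dl0 hdl] := segment_unif_continuous n0.+1%:R cf e10.
pose A : R := n0.+1%:R.
pose N := (Num.truncn (2 * A / dl)).+1.
pose h := 2 * A / N%:R.
have N0 : 0 < N%:R :> R by rewrite ltr0n.
have A0 : 0 < A by rewrite ltr0n.
have h0 : 0 <= h by rewrite divr_ge0// mulr_ge0// ltW.
have hd : h <= dl.
  rewrite /h ler_pdivrMr// [leRHS]mulrC -ler_pdivrMr//; apply: ltW.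
  exact: truncnS_gt.
have NA : - A + h * N%:R = A by rewrite /h divfK ?gt_eqF//; ring.
have fe k x : (k < N)%N -> - A + h * k%:R < x <= - A + h * k.+1%:R ->
    `|f x - f (- A + h * k%:R)| <= e1.
  move=> kN /andP[x1 x2]; rewrite distrC; apply: hdl.
    have hk : h * k%:R <= h * N%:R by rewrite ler_wpM2l// ler_nat ltnW.
    by apply/andP; split; [rewrite lerDl mulr_ge0|lra].
  rewrite distrC ger0_norm; last by lra.
  by rewrite -natr1 in x2; lra.
pose S1 n := \sum_(k < N) f (- A + h * k%:R) *
  prob_itv P1 (X n) (- A + h * k%:R) (- A + h * k.+1%:R).
pose S2 := \sum_(k < N) f (- A + h * k%:R) * prob_itv P2 G (- A + h * k%:R) (- A + h * k.+1%:R).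
have cS : S1 n @[n --> \oo] --> S2.
  rewrite /S1 /S2; elim: (N) => [|M IH].
    rewrite big_ord0; under eq_fun do rewrite big_ord0; exact: cvg_cst.
  rewrite big_ord_recr/=; under eq_fun do rewrite big_ord_recr/=.
  apply: cvgD => //; apply: cvgM; first exact: cvg_cst.
  by apply: hcvg; rewrite lerD2l ler_wpM2l// ler_nat.
have hA : 1 - e1 <= prob_itv P2 G (- A) A.
  by apply: le_trans hn0 _; apply: le_prob_itv => //; rewrite /A ?lerN2 ler_nat.
near=> n.
have s1 := step_approximation P1 (mX n) cf fK (ltW e10) h0 fe NA.
have s2 := step_approximation P2 mG cf fK (ltW e10) h0 fe NA.
have hS : `|S2 - S1 n| <= e / 8.
  by near: n; move/cvgrPdist_le : cS; apply; rewrite divr_gt0.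
have hp : `|prob_itv P2 G (- A) A - prob_itv P1 (X n) (- A) A| <= e1.
  near: n; have /cvgrPdist_le := hcvg (- A) A ltac:(lra).
  by apply.
have hK : K * (1 - prob_itv P1 (X n) (- A) A) <= K * (2 * e1).
  by apply: ler_wpM2l => //; move: hp; rewrite ler_norml => /andP[]; lra.
have hK2 : K * (1 - prob_itv P2 G (- A) A) <= K * e1 by apply: ler_wpM2l => //; lra.
rewrite -/A -/(S1 n) in s1; rewrite -/A -/S2 in s2.
have := ler_distD S2 (\int[P2]_w f (G w)) (\int[P1]_w f (X n w)).
have := ler_distD (S1 n) S2 (\int[P1]_w f (X n w)).
rewrite (distrC (S1 n)); lra.
Unshelve. all: by end_near. Qed.

End interval_convergence.

(** * Perpetuities *)

Section near_infinity.
Context {R : realType}.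

Lemma near_sqrt_ge (C : R) : \forall n \near \oo, C <= Num.sqrt n%:R.
Proof.
near=> n; apply: le_trans (ler_norm C) _; rewrite -sqrtr_sqr.
by apply: ler_wsqrtr; near: n; exact: nbhs_infty_ger.
Unshelve. all: by end_near. Qed.

(** With y the fourth root of n: ln n = 4 ln y <= 4 y <= k y^2 as soon as y >= 4 / k. *)
Lemma near_ln_le_sqrt (k : R) : 0 < k -> \forall n \near \oo, ln n%:R <= k * Num.sqrt n%:R.
Proof.
move=> k0; near=> n.
have n0 : 0 < n%:R :> R by rewrite ltr0n; near: n; exact: nbhs_infty_gt.
have sn0 : 0 < Num.sqrt (n%:R : R) by rewrite sqrtr_gt0.
pose y := Num.sqrt (Num.sqrt (n%:R : R)).
have y0 : 0 < y by rewrite sqrtr_gt0.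
have y2 : y ^+ 2 = Num.sqrt n%:R by rewrite sqr_sqrtr// ltW.
have y4 : n%:R = y ^+ 4 by rewrite (exprM y 2 2) y2 sqr_sqrtr// ltW.
have yk : 4 / k <= y.
  rewrite /y; have : (4 / k) ^+ 2 <= Num.sqrt n%:R by near: n; exact: near_sqrt_ge.
  move=> /ler_wsqrtr; rewrite sqrtr_sqr; apply: le_trans; exact: ler_norm.
rewrite y4 lnXn// -y4 -y2 -[ln y *+ 4]mulr_natl.
have := le_ln1Dx (x := y - 1) ltac:(lra).
rewrite addrC subrK => h.
rewrite ler_pdivrMr// in yk.
have : 4 * y <= k * y ^+ 2 by rewrite expr2 mulrA ler_wpM2r ?(ltW y0)// mulrC.
lra.
Unshelve. all: by end_near. Qed.

End near_infinity.

Lemma ler_dist_itvD (R : realFieldType) (x y q r : R) :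
  0 <= x -> x <= q -> 0 <= y -> y <= q -> 0 <= r -> `|x - y| <= r + q.
Proof. by move=> *; rewrite ler_norml; apply/andP; split; lra. Qed.

(** * Interval probabilities under small perturbations *)

Section perturbation.
Context d (T : measurableType d) (R : realType) (P : probability T R).

(** Off B the two variables can lie on different sides of an endpoint only if W is within e of that
    endpoint. *)
Lemma prob_itv_perturb (X W : T -> R) (B : set T) (e u v : R) :
  measurable_fun [set: T] X -> measurable_fun [set: T] W -> measurable B ->
  (forall w, ~ B w -> `|X w - W w| <= e) ->
  `|prob_itv P X u v - prob_itv P W u v| <=
  pr P B + prob_itv P W (u - e) (u + e) + prob_itv P W (v - e) (v + e).
Proof.
move=> mX mW mB XW.
have H (X1 X2 : T -> R) : measurable_fun [set: T] X1 -> measurable_fun [set: T] X2 ->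
    (forall w, ~ B w -> u < X1 w <= v -> u < X2 w <= v \/
       u - e < W w <= u + e \/ v - e < W w <= v + e) ->
    prob_itv P X1 u v <= prob_itv P X2 u v +
      (pr P B + prob_itv P W (u - e) (u + e) + prob_itv P W (v - e) (v + e)).
  move=> m1 m2 h.
  have i1 := measurable_itv_event m2 u v.
  have i2 := measurable_itv_event mW (u - e) (u + e).
  have i3 := measurable_itv_event mW (v - e) (v + e).
  have mU1 := measurableU _ _ mB i2; have mU2 := measurableU _ _ mU1 i3.
  apply: (@le_trans _ _ (pr P ([set w | u < X2 w <= v] `|` (B `|` [set w | u - e < W w <= u + e]
      `|` [set w | v - e < W w <= v + e])))).
    apply: le_pr; [exact: measurable_itv_event|exact: measurableU|].
    move=> w /= Xw; have [Bw|nBw] := pselect (B w); first by right; left; left.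
    by case: (h w nBw Xw) => [|[|]]; [left|right; left; right|right; right].
  apply: le_trans (prU_le P i1 mU2) _; rewrite lerD2l.
  apply: le_trans (prU_le P mU1 i3) _; rewrite lerD2r.
  exact: prU_le.
have h1 w : ~ B w -> - e <= X w - W w <= e by move=> /XW; rewrite ler_norml.
rewrite ler_norml; apply/andP; split; last first.
  rewrite lerBlDl; apply: H => // w /h1 /andP[e1 e2] /andP[x1 x2].
  have [w1|w1] := leP (W w) u; first by right; left; apply/andP; split; lra.
  have [w2|w2] := leP (W w) v; first by left.
  by right; right; apply/andP; split; lra.
rewrite lerNl opprB lerBlDl; apply: H => // w /h1 /andP[e1 e2] /andP[x1 x2].
have [w1|w1] := leP (X w) u; first by right; left; apply/andP; split; lra.
have [w2|w2] := leP (X w) v; first by left.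
by right; right; apply/andP; split; lra.
Qed.

Lemma Rintegral_near_cst (g : T -> R) (E : set T) (M al be : R) :
  measurable_fun [set: T] g -> (forall w, 0 <= g w <= 1) -> measurable E ->
  (forall w, `|g w - M| <= al + be * \1_E w) ->
  `|\int[P]_w g w - M| <= al + be * pr P E.
Proof.
move=> mg g01 mE gM.
have ig : P.-integrable [set: T] (EFin \o g).
  apply: (@bounded_integrable _ _ _ _ _ 1) => // w.
  by have /andP[h1 h2] := g01 w; rewrite ger0_norm.
have ic c : P.-integrable [set: T] (EFin \o cst c) by exact: finite_measure_integrable_cst.
have iE : P.-integrable [set: T] (EFin \o (\1_E : T -> R)).
  apply: (@bounded_integrable _ _ _ _ _ 1); first exact: measurable_indic.
  by move=> w; rewrite indicE; case: (_ \in _); rewrite ?normr1 ?normr0.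
have ibE : P.-integrable [set: T] (EFin \o (fun w => be * (\1_E w : R))).
  exact: (integrableZl _ be iE).
rewrite -[X in _ - X](Rintegral_probability_cst P) -RintegralB//; last exact: ic.
apply: le_trans (le_normr_Rintegral _ _) _ => //; first exact: (integrableB _ ig (ic M)).
rewrite -pr_Rintegral// -[X in X + _](Rintegral_probability_cst P) -RintegralZl// -RintegralD//.
  apply: le_Rintegral => //.
    exact: integrable_norm (integrableB _ ig (ic M)).
  exact: (integrableD _ (ic al) ibE).
exact: ic.
Qed.

End perturbation.

(** * The perpetuity and its last block *)

Section perpetuity.
Context d (T : measurableType d) (R : realType) (P : probability T R).
Variable Z : nat -> {RV P >-> (R * R)%type}.
Hypothesis indepZ : mutually_independent Z.
Variables a s c2 : R.
Hypotheses (a0 : 0 < a) (s0 : 0 < s).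

Definition cstep (k : nat) (w : T) : R := (Z k w).1 - a.
Definition pfactor (k : nat) (w : T) : R := (Z k w).2.
Local Notation Y := cstep.
Local Notation H := pfactor.

Lemma known_cstep k (J : set nat) : J k -> known Z J (Y k).
Proof.
move=> Jk; have mg : measurable_fun [set: R * R] (fun z : R * R => z.1 - a).
  exact: measurable_funB.
exact: (measurableT_comp mg (@known_Z _ _ _ _ _ _ Z J k Jk)).
Qed.

Lemma known_pfactor k (J : set nat) : J k -> known Z J (H k).
Proof.
move=> Jk; have mg : measurable_fun [set: R * R] (fun z : R * R => z.2) by exact: measurable_snd.
exact: (measurableT_comp mg (@known_Z _ _ _ _ _ _ Z J k Jk)).
Qed.

Lemma measurable_pfactor k : measurable_fun [set: T] (H k).
Proof.
have h : known Z setT (H k) by exact: known_pfactor.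
exact: known_measurable h.
Qed.

(* In terms of the original sequence, [perp p m] is the sum of
   eta_k exp(S_k - S_p) over p < k <= p + m. *)
Definition perp (p m : nat) (w : T) : R :=
  \sum_(i < m) H (p + i) w * expR (psum Y p i.+1 w + a * i.+1%:R).

Lemma known_perp p m : known Z (block p m) (perp p m).
Proof.
apply: measurable_sum => i; apply: measurable_funM.
  by apply: known_pfactor; rewrite /block/= leq_addr ltn_add2l ltn_ord.
apply: measurableT_comp => //; apply: measurable_funD => //.
apply: (known_psum known_cstep) => k; rewrite /block/= => /andP[-> /leq_trans]; apply.
by rewrite leq_add2l.
Qed.

Lemma measurable_ln_perp p m : measurable_fun [set: T] (fun w => ln (perp p m w)).
Proof. exact: (measurableT_comp (@measurable_ln R) (known_measurable (@known_perp p m))). Qed.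

(** Isolates the last block: the perpetuity restarted at p enters multiplied by the exponential of
    the walk at p, of which it is independent. *)
Lemma perpD p m w :
  perp 0 (p + m) w = perp 0 p w + expR (psum Y 0 p w + a * p%:R) * perp p m w.
Proof.
rewrite /perp big_split_ord/=; congr (_ + _); rewrite mulr_sumr.
apply: eq_bigr => i _; rewrite !add0n mulrCA -expRD; congr (_ * expR _).
by rewrite -addnS psumD add0n natrD; ring.
Qed.

Lemma perp_le p m (u v : R) w : (forall i, (i < m)%N ->
    [/\ 0 < H (p + i) w, ln (1 + H (p + i) w) <= u & `|psum Y p i.+1 w| <= v]) ->
  perp p m w <= m%:R * expR (u + v + a * m%:R).
Proof.
move=> h; rewrite mulr_natl -[X in _ *+ X]card_ord -sumr_const.
apply: ler_sum => i _; have [H0 hu hv] := h i (ltn_ord i).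
rewrite -addrA [expR (u + _)]expRD; apply: ler_pM; rewrite ?expR_ge0 ?(ltW H0)//.
  rewrite -[leLHS]lnK ?posrE// ler_expR; apply: le_trans hu.
  by rewrite ler_ln ?posrE ?addr_gt0// lerDr.
rewrite ler_expR lerD//; first exact: le_trans (ler_norm _) hv.
by rewrite ler_pM2l// ler_nat.
Qed.

Lemma perp_ge p m j w : (forall i, (i < m)%N -> 0 < H (p + i) w) -> (j < m)%N ->
  H (p + j) w * expR (psum Y p j.+1 w + a * j.+1%:R) <= perp p m w.
Proof.
move=> h jm; rewrite /perp (bigD1 (Ordinal jm))//= lerDl sumr_ge0// => i _.
by rewrite mulr_ge0 ?expR_ge0// ltW// h.
Qed.

Lemma perp_gt0 p m w : (0 < m)%N -> (forall i, (i < m)%N -> 0 < H (p + i) w) -> 0 < perp p m w.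
Proof.
move=> m0 h; apply: lt_le_trans (perp_ge h m0).
by rewrite mulr_gt0 ?expR_gt0// h.
Qed.

Hypotheses (iY : forall k, P.-integrable [set: T] (EFin \o Y k))
  (iY2 : forall k, P.-integrable [set: T] (EFin \o (fun w => Y k w ^+ 2)))
  (EY : forall k, \int[P]_w Y k w = 0) (EY2 : forall k, \int[P]_w (Y k w ^+ 2) = s ^+ 2).
Hypothesis Hlow : forall rho : R, 0 < rho ->
  exists2 c : R, 0 < c & forall k, pr P [set w | H k w < c] <= rho.
Hypothesis Hup : forall k (L : R), 0 < L -> pr P [set w | L < ln (1 + H k w)] <= c2 / L ^+ 2.

Lemma measurable_pfactor_lt k (c : R) : measurable [set w | H k w < c].
Proof.
rewrite -[X in measurable X]setTI; apply: measurable_fun_ltr => //.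
exact: measurable_pfactor.
Qed.

Lemma measurable_ln_pfactor_gt k (c : R) : measurable [set w | c < ln (1 + H k w)].
Proof.
rewrite -[X in measurable X]setTI; apply: measurable_fun_ltr => //.
by apply: measurableT_comp => //; apply: measurable_funD => //; exact: measurable_pfactor.
Qed.

Lemma measurable_pfactor_le0 k : measurable [set w | H k w <= 0].
Proof.
rewrite -[X in measurable X]setTI; apply: measurable_fun_ler => //.
exact: measurable_pfactor.
Qed.

(** The event lies in {H k < c} for every c > 0, so [Hlow] makes its probability at most any e >
    0. *)
Lemma pr_pfactor_le0 k : pr P [set w | H k w <= 0] = 0.
Proof.
apply/eqP; rewrite eq_le pr_ge0 andbT; apply/ler_addgt0Pl => e e0; rewrite addr0.
have [c c0 hc] := Hlow e0; apply: le_trans (hc k).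
apply: le_pr; [exact: measurable_pfactor_le0|exact: measurable_pfactor_lt|].
by move=> w /= /le_lt_trans; apply.
Qed.

Definition nonpos_event p m : set T := \bigcup_(i < m) [set w | H (p + i) w <= 0].
Definition large_event p m (u : R) : set T := \bigcup_(i < m) [set w | u < ln (1 + H (p + i) w)].

Lemma measurable_nonpos_event p m : measurable (nonpos_event p m).
Proof. by apply: bigcup_measurable => i _; exact: measurable_pfactor_le0. Qed.

Lemma measurable_large_event p m u : measurable (large_event p m u).
Proof. by apply: bigcup_measurable => i _; exact: measurable_ln_pfactor_gt. Qed.

Lemma pr_nonpos_event p m : pr P (nonpos_event p m) <= 0.
Proof.
apply: le_trans (pr_bigU_le P m (fun i => measurable_pfactor_le0 (p + i))) _.
by rewrite big1// => i _; exact: pr_pfactor_le0.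
Qed.

Lemma pr_large_event p m (u : R) : 0 < u -> pr P (large_event p m u) <= m%:R * (c2 / u ^+ 2).
Proof.
move=> u0; apply: le_trans (pr_bigU_le P m (fun i => measurable_ln_pfactor_gt (p + i) u)) _.
rewrite mulr_natl -[X in _ *+ X]card_ord -sumr_const.
by apply: ler_sum => i _; exact: Hup.
Qed.

Lemma pr_exceed p m (v : R) : 0 < v -> m%:R * s ^+ 2 / (v / 2) ^+ 2 <= 2^-1 ->
  pr P (exceed Y v p m) <= 2 * (m%:R * s ^+ 2 / (v / 2) ^+ 2).
Proof.
move=> v0 hm; have v20 : 0 < v / 2 by rewrite divr_gt0.
have := ottaviani indepZ known_cstep iY iY2 EY EY2 p v20 hm.
by rewrite mulrC divfK.
Qed.

(** From above, the walk, ln (1 + eta) and the number m of terms each contribute b. From below, the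
    last term alone is enough, with its eta at least c; that this fails with fixed small probability
    is acceptable, since the block only shifts the walk. *)
Lemma perp_close p m (b c : R) : 0 < b -> 0 < c -> (0 < m)%N ->
  ln m%:R <= b -> - ln c <= b -> m%:R * s ^+ 2 / (b / 2) ^+ 2 <= 2^-1 ->
  pr P [set w | 3 * b < `|ln (perp p m w) - a * m%:R|] <=
  m%:R * (c2 / b ^+ 2) + 2 * (m%:R * s ^+ 2 / (b / 2) ^+ 2) +
  pr P [set w | H (p + m.-1) w < c].
Proof.
move=> b0 c0 m0 lnm lnc hm.
have mm : 0 < m%:R :> R by rewrite ltr0n.
pose A1 := nonpos_event p m `|` large_event p m b.
pose A2 := A1 `|` exceed Y b p m.
have mA1 : measurable A1.
  by apply: measurableU; [exact: measurable_nonpos_event|exact: measurable_large_event].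
have mE : measurable (exceed Y b p m) := measurable_exceed known_cstep _ _ (ltW b0).
have mA2 : measurable A2 by exact: measurableU.
have mL := measurable_pfactor_lt (p + m.-1) c.
apply: (@le_trans _ _ (pr P (A2 `|` [set w | H (p + m.-1) w < c]))).
  apply: le_pr.
  - apply: measurable_gt_norm; apply: measurable_funB => //; exact: measurable_ln_perp.
  - exact: measurableU.
  move=> w /=; apply: contraPP => /not_orP[/not_orP[/not_orP[n1 n2] n3] n4].
  have Hp i : (i < m)%N -> 0 < H (p + i) w.
    by move=> im; rewrite ltNge; apply/negP => h; apply: n1; exists i.
  have Hu i : (i < m)%N -> ln (1 + H (p + i) w) <= b.
    by move=> im; rewrite leNgt; apply/negP => h; apply: n2; exists i.
  have Hs i : (i <= m)%N -> `|psum Y p i w| <= b.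
    by move=> im; rewrite leNgt; apply/negP => h; apply: n3; exists i.
  apply/negP; rewrite -leNgt ler_norml; apply/andP; split.
    have := perp_ge (j := m.-1) Hp; rewrite prednK// => /(_ (leqnn m)) hge.
    rewrite lerBrDl; apply: (@le_trans _ _ (ln (c * expR (- b + a * m%:R)))).
      by rewrite lnM ?posrE ?expR_gt0// expRK; lra.
    rewrite ler_ln ?posrE ?mulr_gt0 ?expR_gt0 ?perp_gt0//.
    apply: le_trans hge; apply: ler_pM; rewrite ?expR_ge0 ?(ltW c0)//.
      by rewrite leNgt; apply/negP.
    rewrite ler_expR lerD2r; have := Hs m (leqnn m); rewrite ler_norml => /andP[]; lra.
  have hle : perp p m w <= m%:R * expR (b + b + a * m%:R).
    by apply: perp_le => i im; split; [exact: Hp|exact: Hu|exact: Hs].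
  have : ln (perp p m w) <= ln (m%:R * expR (b + b + a * m%:R)).
    by rewrite ler_ln ?posrE ?mulr_gt0 ?expR_gt0 ?perp_gt0.
  rewrite lnM ?posrE ?expR_gt0// expRK; lra.
apply: le_trans (prU_le P mA2 mL) _; rewrite lerD2r.
apply: le_trans (prU_le P mA1 mE) _; apply: lerD; last exact: pr_exceed.
apply: le_trans (prU_le P (measurable_nonpos_event p m) (measurable_large_event p m b)) _.
rewrite -[leRHS]add0r; apply: lerD; [exact: pr_nonpos_event|exact: pr_large_event].
Qed.

(** A single eta may be small with a probability that does not decay in n; for q independent ones to
    be small together is exponentially unlikely. *)
Lemma pr_all_small (c : R) p q : (forall k, pr P [set w | H k w < c] <= 2^-1) ->
  pr P (\bigcap_(i < q) [set w | H (p + i) w < c]) <= 2^-1 ^+ q.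
Proof.
move=> hc.
have sH (J : set nat) k : J k -> <<s cylinders Z J >> [set w | H k w < c].
  move=> Jk; rewrite (_ : [set w | _] = H k @^-1` `]-oo, c[%classic).
    by apply: known_preimage => //; exact: known_pfactor.
  by apply/seteqP; split => w /=; rewrite in_itv.
have sI n : <<s cylinders Z (block p n) >> (\bigcap_(i < n) [set w | H (p + i) w < c]).
  apply: (@bigcap_measurableType _ (g_sigma_algebraType (cylinders Z (block p n)))) => i /= ni.
  by apply: sH; rewrite /block/= leq_addr ltn_add2l.
elim: q => [|q IH].
  by rewrite expr0 pr_le1//; apply: bigcap_measurableType => i _; exact: measurable_pfactor_lt.
have -> : \bigcap_(i < q.+1) [set w | H (p + i) w < c] =
    (\bigcap_(i < q) [set w | H (p + i) w < c]) `&` [set w | H (p + q) w < c].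
  by rewrite !bigcap_mkord big_ord_recr.
have mq := measurable_pfactor_lt (p + q) c.
have mI : measurable (\bigcap_(i < q) [set w | H (p + i) w < c]).
  by apply: bigcap_measurableType => i _; exact: measurable_pfactor_lt.
have -> : pr P ((\bigcap_(i < q) [set w | H (p + i) w < c]) `&` [set w | H (p + q) w < c]) =
    pr P (\bigcap_(i < q) [set w | H (p + i) w < c]) * pr P [set w | H (p + q) w < c].
  apply/EFin_inj; rewrite EFinM !prE//; last exact: measurableI.
  apply: (sigma_cylinders_indep indepZ (block_disj p q 1) (sI q)).
  by apply: sH; rewrite /block/= leqnn addn1 ltnSn.
by rewrite exprSr; apply: ler_pM => //; exact: pr_ge0.
Qed.

(** Where the block is positive, this is the logarithm of the second summand in [perpD], grouped as
    the walk at p plus an independent shift. *)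
Definition ln_tail p m (w : T) : R := psum Y 0 p w + (a * p%:R + ln (perp p m w)).

Lemma measurable_ln_tail p m : measurable_fun [set: T] (ln_tail p m).
Proof.
apply: measurable_funD; first exact: (measurable_psum known_cstep).
by apply: measurable_funD => //; exact: measurable_ln_perp.
Qed.

Lemma measurable_split_event p m n (e : R) :
  measurable [set w | ~ (ln_tail p m w <= ln (perp 0 n w) <= ln_tail p m w + e)].
Proof.
rewrite (_ : [set w | _] = ~` ([set w | ln_tail p m w <= ln (perp 0 n w)] `&`
    [set w | ln (perp 0 n w) <= ln_tail p m w + e])); last first.
  apply/seteqP; split => w /= h.
    by move=> [h1 h2]; apply: (h); apply/andP.
  by move=> /andP[h1 h2]; exact: (h (conj h1 h2)).
apply: measurableC; apply: measurableI.
  rewrite -[X in measurable X]setTI; apply: measurable_fun_ler => //.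
    exact: measurable_ln_tail.
  exact: measurable_ln_perp.
rewrite -[X in measurable X]setTI; apply: measurable_fun_ler => //.
  exact: measurable_ln_perp.
by apply: measurable_funD => //; exact: measurable_ln_tail.
Qed.

(* Off the exceptional event, the walk and the ln (1 + eta) stay below v, so
   that D_p <= n e^{2v + a p}, while some eta in the last q places is at least
   c and already contributes c e^{-v + a (n - q)}. *)
Lemma ln_perp_split p m q (v c e : R) : 0 < v -> 0 < c -> 0 < e -> (q <= m)%N -> (0 < m)%N ->
  (p + m)%:R * expR (3 * v) <= e * c * expR (a * (m - q)%:R) ->
  (p + m)%:R * s ^+ 2 / (v / 2) ^+ 2 <= 2^-1 ->
  (forall k, pr P [set w | H k w < c] <= 2^-1) ->
  pr P [set w | ~ (ln_tail p m w <= ln (perp 0 (p + m) w) <= ln_tail p m w + e)] <=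
  (p + m)%:R * (c2 / v ^+ 2) + 2 * ((p + m)%:R * s ^+ 2 / (v / 2) ^+ 2) + 2^-1 ^+ q.
Proof.
move=> v0 c0 e0 qm m0 hdom hpm hc; set V := ln_tail p m; set n := (p + m)%N in hdom hpm *.
pose A1 := nonpos_event 0 n `|` large_event 0 n v.
pose A2 := A1 `|` exceed Y v 0 n.
pose A3 := \bigcap_(i < q) [set w | H ((p + (m - q)) + i) w < c].
have mA1 : measurable A1.
  by apply: measurableU; [exact: measurable_nonpos_event|exact: measurable_large_event].
have mE : measurable (exceed Y v 0 n) := measurable_exceed known_cstep _ _ (ltW v0).
have mA2 : measurable A2 by exact: measurableU.
have mA3 : measurable A3 by apply: bigcap_measurableType => i _; exact: measurable_pfactor_lt.
apply: (@le_trans _ _ (pr P (A2 `|` A3))).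
  apply: le_pr.
  - exact: measurable_split_event.
  - exact: measurableU.
  move=> w /=; apply: contraPP => /not_orP[/not_orP[/not_orP[n1 n2] n3] n4] nW; apply: nW.
  have Hp i : (i < n)%N -> 0 < H i w.
    by move=> im; rewrite ltNge; apply/negP => h; apply: n1; exists i.
  have Hu i : (i < n)%N -> ln (1 + H i w) <= v.
    by move=> im; rewrite leNgt; apply/negP => h; apply: n2; exists i.
  have Hs i : (i <= n)%N -> `|psum Y 0 i w| <= v.
    by move=> im; rewrite leNgt; apply/negP => h; apply: n3; exists i.
  have [j [jm mqj cj]] : exists j, [/\ (j < m)%N, (m - q <= j)%N & c <= H (p + j) w].
    apply: contra_notP n4 => hn i /= iq; rewrite ltNge; apply/negP => hci; apply: hn.
    exists ((m - q) + i)%N; rewrite leq_addr addnA; split => //.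
    by rewrite -ltn_subRL subKn.
  pose A := perp 0 p w; pose B := expR (psum Y 0 p w + a * p%:R) * perp p m w.
  have Hpm i : (i < m)%N -> 0 < H (p + i) w by move=> im; apply: Hp; rewrite ltn_add2l.
  have B0 : 0 < B by rewrite mulr_gt0 ?expR_gt0// perp_gt0.
  have A0 : 0 <= A.
    apply: sumr_ge0 => i _; rewrite mulr_ge0 ?expR_ge0// ltW// Hp//.
    by rewrite add0n (leq_trans (ltn_ord i))// leq_addr.
  have AB : A <= e * B.
    apply: (@le_trans _ _ (n%:R * expR (v + v + a * p%:R))).
      apply: (@le_trans _ _ (p%:R * expR (v + v + a * p%:R))).
        apply: perp_le => i ip; have inn : (i < n)%N by rewrite (leq_trans ip)// leq_addr.
        by split; [exact: Hp|exact: Hu|exact: Hs].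
      by rewrite ler_wpM2r ?expR_ge0// ler_nat leq_addr.
    have Bge : c * expR (- v + a * (p + (m - q))%:R) <= B.
      rewrite /B; apply: (@le_trans _ _ (expR (psum Y 0 p w + a * p%:R) *
          (H (p + j) w * expR (psum Y p j.+1 w + a * j.+1%:R)))); last first.
        by rewrite ler_wpM2l ?expR_ge0// perp_ge.
      rewrite mulrCA -expRD; apply: ler_pM; rewrite ?expR_ge0 ?(ltW c0)//.
      rewrite ler_expR.
      have -> : psum Y 0 p w + a * p%:R + (psum Y p j.+1 w + a * j.+1%:R) =
          psum Y 0 (p + j.+1) w + a * (p + j.+1)%:R.
        by rewrite psumD add0n natrD; ring.
      apply: lerD; last by rewrite ler_pM2l// ler_nat leq_add2l ltnW.
      have := Hs (p + j.+1)%N; rewrite leq_add2l => /(_ jm).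
      by rewrite ler_norml => /andP[].
    apply: le_trans (ler_wpM2l (ltW e0) Bge).
    have -> : v + v + a * p%:R = 3 * v + (- v + a * p%:R) by ring.
    have -> : - v + a * (p + (m - q))%:R = a * (m - q)%:R + (- v + a * p%:R).
      by rewrite natrD; ring.
    by rewrite (expRD (3 * v)) (expRD (a * _)) !mulrA ler_wpM2r ?expR_ge0.
  have lnB : ln B = V w.
    by rewrite /B lnM ?posrE ?expR_gt0 ?perp_gt0// expRK /V /ln_tail addrA.
  have AB0 : 0 < A + B by rewrite ltr_wpDl.
  rewrite -lnB perpD -/A -/B; apply/andP; split.
    by rewrite ler_ln ?posrE// lerDr.
  (* A <= e B and 1 + e <= exp e give A + B <= B exp e. *)
  have -> : ln B + e = ln (B * expR e) by rewrite lnM ?posrE ?expR_gt0// expRK.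
  have Be0 : 0 < B * expR e by apply: mulr_gt0 => //; exact: expR_gt0.
  rewrite ler_ln ?posrE//.
  have := expR_ge1Dx e => /(ler_wpM2l (ltW B0)); lra.
apply: le_trans (prU_le P mA2 mA3) _; apply: lerD; last exact: pr_all_small.
apply: le_trans (prU_le P mA1 mE) _; apply: lerD; last exact: pr_exceed.
apply: le_trans (prU_le P (measurable_nonpos_event 0 n) (measurable_large_event 0 n v)) _.
rewrite -[leRHS]add0r; apply: lerD; [exact: pr_nonpos_event|exact: pr_large_event].
Qed.

Let c20 : 0 <= c2.
Proof.
have := Hup 0 ltr01; rewrite expr1n divr1; apply: le_trans; exact: pr_ge0.
Qed.

(** A block of at most dl n steps has variance at most dl n s^2, small against (k sqrt n)^2 when dl
    is small against k^2. *)
Lemma near_perp_close (k rho : R) : 0 < k -> 0 < rho -> exists2 dl : R, 0 < dl &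
  \forall n \near \oo, forall p m, (0 < m)%N -> (m <= n)%N -> m%:R <= dl * n%:R ->
  pr P [set w | k * Num.sqrt n%:R < `|ln (perp p m w) - a * m%:R|] <= rho.
Proof.
move=> k0 rho0.
have [c c0 hc] := Hlow (divr_gt0 rho0 (ltr0Sn R 2)).
pose M := Num.min 2^-1 (rho / 6).
have M0 : 0 < M by rewrite lt_min invr_gt0 ltr0n divr_gt0.
have S0 : 0 < s ^+ 2 + c2 by rewrite ltr_pwDl// exprn_gt0.
(* With b = (k / 3) sqrt n, both Chebyshev terms of [perp_close] are at most 36 m (s^2 + c2) / (k^2
   n), hence at most M; here 36 = 9 times 4, the 4 coming from b / 2. *)
pose dl := k ^+ 2 * M / (36 * (s ^+ 2 + c2)).
have dl0 : 0 < dl by rewrite divr_gt0 ?mulr_gt0 ?exprn_gt0.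
have k30 : 0 < k / 3 by rewrite divr_gt0.
exists dl => //; near=> n => p m m0 mn mdl.
have n0 : 0 < n%:R :> R by rewrite ltr0n; near: n; exact: nbhs_infty_gt.
have sn0 : 0 < Num.sqrt (n%:R : R) by rewrite sqrtr_gt0.
pose b := k / 3 * Num.sqrt n%:R.
have b0 : 0 < b by rewrite mulr_gt0.
have lnm : ln m%:R <= b.
  apply: (@le_trans _ _ (ln n%:R)); first by rewrite ler_ln ?posrE ?ler_nat// ltr0n.
  by rewrite /b; near: n; exact: (near_ln_le_sqrt k30).
have lnc : - ln c <= b.
  by rewrite /b mulrC -ler_pdivrMr//; near: n; exact: near_sqrt_ge.
have b2 : b ^+ 2 = k ^+ 2 / 9 * n%:R.
  by rewrite /b exprMn sqr_sqrtr ?(ltW n0)//; field.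
have bb0 : 0 < k ^+ 2 / 9 * n%:R by rewrite -b2 exprn_gt0.
have k2n : 0 < k ^+ 2 * n%:R by rewrite mulr_gt0// exprn_gt0.
have key (x : R) : 0 <= x -> x <= s ^+ 2 + c2 -> m%:R * x * 36 / (k ^+ 2 * n%:R) <= M.
  move=> x0 xS; rewrite ler_pdivrMr//.
  have : m%:R * x <= dl * n%:R * (s ^+ 2 + c2).
    by apply: ler_pM => //; exact: ler0n.
  have -> : dl * n%:R * (s ^+ 2 + c2) = M * (k ^+ 2 * n%:R) / 36.
    by rewrite /dl; field; rewrite gt_eqF.
  lra.
have M2 : M <= 2^-1 by rewrite ge_min lexx.
have M6 : M <= rho / 6 by rewrite ge_min lexx orbT.
have t1 : m%:R * s ^+ 2 / (b / 2) ^+ 2 <= M.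
  have -> : m%:R * s ^+ 2 / (b / 2) ^+ 2 = m%:R * s ^+ 2 * 36 / (k ^+ 2 * n%:R).
    by rewrite expr_div_n b2; field; rewrite !gt_eqF.
  by apply: key; [exact: sqr_ge0|rewrite lerDl].
have t2 : m%:R * (c2 / b ^+ 2) <= M.
  apply: (@le_trans _ _ (m%:R * c2 * 36 / (k ^+ 2 * n%:R))).
    have -> : m%:R * (c2 / b ^+ 2) = m%:R * c2 * 9 / (k ^+ 2 * n%:R).
      by rewrite b2; field; rewrite !gt_eqF.
    rewrite ler_wpM2r ?invr_ge0 ?(ltW k2n)// ler_wpM2l ?mulr_ge0//; lra.
  by apply: key => //; rewrite lerDr sqr_ge0.
have -> : k * Num.sqrt n%:R = 3 * b by rewrite /b; field.
apply: le_trans (perp_close p b0 c0 m0 lnm lnc (le_trans t1 M2)) _.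
have := hc (p + m.-1)%N; lra.
Unshelve. all: by end_near. Qed.

(** With a block of at least dl n steps the allowed deviations are linear in n, so all exceptional
    probabilities are O(1 / n), which is below rho / sqrt n eventually. *)
Lemma near_ln_perp_split (dl e rho : R) : 0 < dl -> 0 < e -> 0 < rho ->
  \forall n \near \oo, forall p m, (p + m)%N = n -> dl * n%:R <= m%:R ->
  pr P [set w | ~ (ln_tail p m w <= ln (perp 0 n w) <= ln_tail p m w + e)] <=
  rho / Num.sqrt n%:R.
Proof.
move=> dl0 e0 rho0.
have half0 : 0 < 2^-1 :> R by rewrite invr_gt0.
have [c c0 hc] := Hlow half0.
pose C := 144 * c2 / (a * dl) ^+ 2 + 1152 * s ^+ 2 / (a * dl) ^+ 2 + 2 / dl.
have adl0 : 0 < a * dl by rewrite mulr_gt0.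
near=> n => p m pmn mdl.
have n0 : 0 < n%:R :> R by rewrite ltr0n; near: n; exact: nbhs_infty_gt.
have sn0 : 0 < Num.sqrt (n%:R : R) by rewrite sqrtr_gt0.
have dn0 : 0 < dl * n%:R by rewrite mulr_gt0.
have mR0 : 0 < m%:R :> R by exact: lt_le_trans mdl.
have m0 : (0 < m)%N by rewrite -(ltr_nat R).
(* With q = m / 2 rounded down, the remaining drift a (m - q) is at least a m / 2 = 6 v: one factor
   exp(3 v) outweighs the walk and eta, the other outweighs the n terms. *)
pose v := a * m%:R / 12.
have v0 : 0 < v by rewrite divr_gt0// mulr_gt0.
have am : a * dl * n%:R <= a * m%:R by rewrite -mulrA ler_pM2l.
have am2 : (a * dl * n%:R) ^+ 2 <= (a * m%:R) ^+ 2.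
  by apply: lerXn2r => //; rewrite nnegrE ltW// mulr_gt0.
have q1 : (m./2 <= m)%N by rewrite -[leqRHS]odd_double_half -addnn addnA leq_addl.
have mq : m%:R / 2 <= (m - m./2)%:R :> R.
  rewrite natrB// lerBrDr; have : (m./2).*2%:R <= m%:R :> R.
    by rewrite ler_nat -[leqRHS]odd_double_half leq_addl.
  by rewrite -muln2 natrM; lra.
have dom : (p + m)%:R * expR (3 * v) <= e * c * expR (a * (m - m./2)%:R).
  have E1 : expR (3 * v) * expR (3 * v) <= expR (a * (m - m./2)%:R).
    rewrite -expRD ler_expR /v.
    have := ler_wpM2l (ltW a0) mq; lra.
  apply: le_trans (ler_wpM2l (mulr_ge0 (ltW e0) (ltW c0)) E1).
  rewrite [leRHS]mulrA ler_wpM2r ?expR_ge0// pmn.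
  have E2 : (3 * v) ^+ 2 / 2 <= expR (3 * v).
    have v30 : 0 <= 3 * v by rewrite mulr_ge0// ltW.
    by have := expR_ge_sqr v30; lra.
  apply: le_trans (ler_wpM2l (mulr_ge0 (ltW e0) (ltW c0)) E2).
  have E3 : (3 * v) ^+ 2 = (a * m%:R) ^+ 2 / 16 by rewrite /v; field.
  rewrite E3; apply: (@le_trans _ _ (e * c * ((a * dl * n%:R) ^+ 2 / 16 / 2))); last first.
    by rewrite ler_wpM2l ?mulr_ge0 ?(ltW e0) ?(ltW c0)//; lra.
  rewrite (_ : e * c * _ = n%:R * (n%:R * (e * c * (a * dl) ^+ 2 / 32))); last by field.
  rewrite ler_peMr ?(ltW n0)// -ler_pdivrMr ?divr_gt0 ?mulr_gt0 ?exprn_gt0// div1r.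
  by near: n; exact: nbhs_infty_ger.
have adn0 : 0 < (a * dl) ^+ 2 * n%:R by rewrite mulr_gt0// exprn_gt0.
have am20 : 0 < (a * m%:R) ^+ 2 by rewrite exprn_gt0// mulr_gt0.
have frac (x K : R) : 0 <= x -> 0 <= K -> n%:R * x * K / (a * m%:R) ^+ 2 <= K * x / ((a * dl) ^+ 2 * n%:R).
  move=> x0 K0; rewrite ler_pdivrMr// [leRHS]mulrAC ler_pdivlMr//.
  have := ler_wpM2l (mulr_ge0 K0 x0) am2; rewrite exprMn; lra.
have t1 : (p + m)%:R * s ^+ 2 / (v / 2) ^+ 2 <= 576 * s ^+ 2 / ((a * dl) ^+ 2 * n%:R).
  rewrite pmn; have -> : n%:R * s ^+ 2 / (v / 2) ^+ 2 = n%:R * s ^+ 2 * 576 / (a * m%:R) ^+ 2.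
    by rewrite /v; field; rewrite !gt_eqF.
  exact: frac (sqr_ge0 s) (ler0n R 576).
have t2 : (p + m)%:R * (c2 / v ^+ 2) <= 144 * c2 / ((a * dl) ^+ 2 * n%:R).
  rewrite pmn; have -> : n%:R * (c2 / v ^+ 2) = n%:R * c2 * 144 / (a * m%:R) ^+ 2.
    by rewrite /v; field; rewrite !gt_eqF.
  exact: frac c20 (ler0n R 144).
have t12 : (p + m)%:R * s ^+ 2 / (v / 2) ^+ 2 <= 2^-1.
  apply: le_trans t1 _; rewrite ler_pdivrMr//.
  rewrite [leRHS](_ : _ = (a * dl) ^+ 2 / 2 * n%:R); last by ring.
  rewrite mulrC -[leLHS]mulrC -ler_pdivrMl ?divr_gt0 ?exprn_gt0//.
  by near: n; exact: nbhs_infty_ger.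
(* The bound k < 2^k suffices to reach the order 1 / n of the other terms. *)
have t3 : (2^-1 : R) ^+ m./2 <= 2 / (dl * n%:R).
  rewrite exprVn -[X in _ <= X]invrK lef_pV2 ?posrE ?exprn_gt0 ?invr_gt0 ?divr_gt0//.
  rewrite invf_div; apply: (@le_trans _ _ (m%:R / 2)); first by lra.
  apply: (@le_trans _ _ ((m./2).+1%:R)).
    rewrite ler_pdivrMr// -natrM ler_nat muln2 -{1}(odd_double_half m) doubleS.
    by rewrite -addn2 addnC leq_add2l; case: (odd m).
  by rewrite -natrX ler_nat ltn_expl.
rewrite -pmn.
apply: le_trans (ln_perp_split v0 c0 e0 q1 m0 dom t12 hc) _.
apply: (@le_trans _ _ (C / n%:R)).
  have -> : C / n%:R = 144 * c2 / ((a * dl) ^+ 2 * n%:R) +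
      2 * (576 * s ^+ 2 / ((a * dl) ^+ 2 * n%:R)) + 2 / (dl * n%:R).
    by rewrite /C; field; rewrite !gt_eqF.
  lra.
rewrite pmn ler_pdivrMr// -{2}(sqr_sqrtr (ltW n0)).
rewrite expr2 mulrA divfK ?gt_eqF// mulrC -ler_pdivrMr//.
by near: n; exact: near_sqrt_ge.
Unshelve. all: by end_near. Qed.

Local Notation G n := (fun x : measurableTypeR R => s * Num.sqrt n%:R * x).
Local Notation N01 := (normal_prob (0 : R) 1).

Let mS p m : measurable_fun [set: T] (psum Y p m).
Proof. exact: (measurable_psum known_cstep). Qed.

Let mlnp p m : measurable_fun [set: T] (fun w => ln (perp p m w)).
Proof. exact: measurable_ln_perp. Qed.

(** The block length is the integer part of kappa n; once kappa n >= 2, rounding loses at most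
    half. *)
Let block_split (kappa : R) : 0 < kappa -> kappa <= 1 -> \forall n \near \oo,
  exists p m, [/\ (p + m)%N = n, (0 < m)%N, (m <= n)%N, m%:R <= kappa * n%:R &
    kappa / 2 * n%:R <= m%:R].
Proof.
move=> k0 k1; near=> n.
have kn0 : 0 <= kappa * n%:R by rewrite mulr_ge0// ltW.
have kn2 : 2 <= kappa * n%:R.
  by rewrite mulrC -ler_pdivrMr//; near: n; exact: nbhs_infty_ger.
pose m := Num.truncn (kappa * n%:R).
have m1 : m%:R <= kappa * n%:R by rewrite truncn_le.
have m2 : kappa * n%:R < m.+1%:R by exact: truncnS_gt.
rewrite -natr1 in m2.
have mn : (m <= n)%N by rewrite -(ler_nat R) (le_trans m1)// ler_piMl.
exists (n - m)%N, m; split => //; [by rewrite subnK| |lra].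
by rewrite -(ltr_nat R); lra.
Unshelve. all: by end_near. Qed.

(** * Central limit theorem for the logarithm of the perpetuity *)

Section clt.
Hypothesis cltS : forall L e : R, 0 <= L -> 0 < e -> \forall n \near \oo, forall x,
  `|prob_itv P (psum Y 0 n) x (x + L * Num.sqrt n%:R) -
    prob_itv N01 (G n) x (x + L * Num.sqrt n%:R)| <= e.

(** The centred logarithm stays within 3 k sqrt n of the walk: k sqrt n for the perpetuity of the
    block, k sqrt n for the walk inside the block, and the splitting error 1, eventually below k
    sqrt n. *)
Lemma ln_perp_clt (u v : R) : u <= v ->
  prob_itv P (fun w => (ln (perp 0 n w) - a * n%:R) / (s * Num.sqrt n%:R)) u v
    @[n --> \oo] --> prob_itv N01 id u v.
Proof.
move=> uv; apply/cvgrPdist_le => e/= e0.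
(* Chosen so that the normal mass 6 k / s around each endpoint is e / 16. *)
pose k : R := e * s / 96; have k0 : 0 < k by rewrite divr_gt0// mulr_gt0.
pose r : R := e / 8; have r0 : 0 < r by rewrite divr_gt0.
have [dl dl0 hcl] := near_perp_close k0 r0.
(* The last entry bounds, by Chebyshev, the walk inside the block. *)
pose kappa := Num.min 1 (Num.min dl (k ^+ 2 * r / s ^+ 2)).
have kap0 : 0 < kappa by rewrite !lt_min ltr01 dl0 divr_gt0 ?mulr_gt0 ?exprn_gt0.
have kap1 : kappa <= 1 by rewrite ge_min lexx.
have hsp := near_ln_perp_split
  (divr_gt0 kap0 (ltr0Sn R 1)) ltr01 r0.
have L10 : 0 <= 6 * k by rewrite mulr_ge0// ltW.
have L20 : 0 <= (v - u) * s by rewrite mulr_ge0 ?subr_ge0// ltW.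
near=> n.
have n0 : 0 < n%:R :> R by rewrite ltr0n; near: n; exact: nbhs_infty_gt.
have sn0 : 0 < Num.sqrt (n%:R : R) by rewrite sqrtr_gt0.
have sn1 : 1 <= Num.sqrt (n%:R : R) by near: n; exact: near_sqrt_ge.
have sk1 : 1 <= k * Num.sqrt n%:R.
  by rewrite mulrC -ler_pdivrMr//; near: n; exact: near_sqrt_ge.
have ssn0 : 0 < s * Num.sqrt n%:R by rewrite mulr_gt0.
have [p [m [pmn m0 mn mk km]]] : exists p m, [/\ (p + m)%N = n, (0 < m)%N, (m <= n)%N,
    m%:R <= kappa * n%:R & kappa / 2 * n%:R <= m%:R].
  by near: n; exact: block_split.
have mdl : m%:R <= dl * n%:R.
  by apply: le_trans mk _; rewrite ler_wpM2r// !ge_min lexx orbT.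
pose E1 := [set w | k * Num.sqrt n%:R < `|ln (perp p m w) - a * m%:R|].
pose E2 := [set w | ~ (ln_tail p m w <= ln (perp 0 n w) <= ln_tail p m w + 1)].
pose E3 := [set w | k * Num.sqrt n%:R < `|psum Y p m w|].
have mE1 : measurable E1 by apply: measurable_gt_norm; exact: measurable_funB.
have mE2 : measurable E2 by exact: measurable_split_event.
have mE3 : measurable E3 by exact: measurable_gt_norm.
have pE1 : pr P E1 <= r.
  have hcl' : forall p m, (0 < m)%N -> (m <= n)%N -> m%:R <= dl * n%:R ->
    pr P [set w | k * Num.sqrt n%:R < `|ln (perp p m w) - a * m%:R|] <= r by near: n.
  exact: hcl'.
have pE2 : pr P E2 <= r.
  have hsp' : forall p m, (p + m)%N = n -> kappa / 2 * n%:R <= m%:R ->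
    pr P [set w | ~ (ln_tail p m w <= ln (perp 0 n w) <= ln_tail p m w + 1)] <=
    r / Num.sqrt n%:R by near: n.
  apply: le_trans (hsp' p m pmn km) _; rewrite ler_pdivrMr// ler_peMr// ltW//.
have pE3 : pr P E3 <= r.
  apply: le_trans (psum_chebyshev indepZ known_cstep iY iY2 EY EY2 p m (mulr_gt0 k0 sn0)) _.
  have n0' := ltW n0.
  rewrite exprMn sqr_sqrtr// ler_pdivrMr ?mulr_gt0 ?exprn_gt0// -ler_pdivlMr ?exprn_gt0//.
  apply: le_trans mk _.
  rewrite (_ : r * _ / _ = k ^+ 2 * r / s ^+ 2 * n%:R); last by field; rewrite gt_eqF.
  by rewrite ler_wpM2r// !ge_min lexx !orbT.
pose B := E1 `|` E2 `|` E3.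
have mE12 := measurableU _ _ mE1 mE2.
have mB : measurable B by exact: measurableU.
have pB : pr P B <= 3 * r.
  apply: le_trans (prU_le P mE12 mE3) _.
  have := prU_le P mE1 mE2; lra.
pose X w := ln (perp 0 n w) - a * n%:R.
have mX : measurable_fun [set: T] X by exact: measurable_funB.
have XS w : ~ B w -> `|X w - psum Y 0 n w| <= 3 * k * Num.sqrt n%:R.
  move=> /not_orP[/not_orP[n1 /contrapT n2] n3].
  have {}n1 : `|ln (perp p m w) - a * m%:R| <= k * Num.sqrt n%:R.
    by rewrite leNgt; apply/negP.
  have {}n3 : `|psum Y p m w| <= k * Num.sqrt n%:R by rewrite leNgt; apply/negP.
  have nE : n%:R = p%:R + m%:R :> R by rewrite -pmn natrD.
  have -> : psum Y 0 n w = psum Y 0 p w + psum Y p m w by rewrite -pmn psumD.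
  move: n2 => /= /andP[]; rewrite /ln_tail /X (_ : a * n%:R = a * p%:R + a * m%:R); last by rewrite nE mulrDr.
  move: n1 n3; rewrite !ler_norml => /andP[? ?] /andP[? ?] ? ?.
  by apply/andP; split; lra.
have hS : forall x, `|prob_itv P (psum Y 0 n) x (x + 6 * k * Num.sqrt n%:R) -
    prob_itv N01 (G n) x (x + 6 * k * Num.sqrt n%:R)| <= r.
  by near: n; exact: cltS.
have hS2 : forall x, `|prob_itv P (psum Y 0 n) x (x + (v - u) * s * Num.sqrt n%:R) -
    prob_itv N01 (G n) x (x + (v - u) * s * Num.sqrt n%:R)| <= r.
  by near: n; exact: cltS.
have edge x : prob_itv P (psum Y 0 n) (x - 3 * k * Num.sqrt n%:R) (x + 3 * k * Num.sqrt n%:R) <=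
    r + 6 * k / s.
  have := hS (x - 3 * k * Num.sqrt n%:R).
  have -> : x - 3 * k * Num.sqrt n%:R + 6 * k * Num.sqrt n%:R = x + 3 * k * Num.sqrt n%:R by ring.
  rewrite ler_norml => /andP[_ h].
  have := @prob_itv_scaled_normal_le R _ ssn0 (x - 3 * k * Num.sqrt n%:R)
    (6 * k * Num.sqrt n%:R) (mulr_ge0 L10 (ltW sn0)).
  have -> : x - 3 * k * Num.sqrt n%:R + 6 * k * Num.sqrt n%:R = x + 3 * k * Num.sqrt n%:R by ring.
  have -> : (s * Num.sqrt n%:R)^-1 * (6 * k * Num.sqrt n%:R) = 6 * k / s.
    by field; rewrite !gt_eqF.
  lra.
have XE : prob_itv P (fun w => (ln (perp 0 n w) - a * n%:R) / (s * Num.sqrt n%:R)) u v =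
    prob_itv P X (s * Num.sqrt n%:R * u) (s * Num.sqrt n%:R * v).
  have -> : X = (fun w => s * Num.sqrt n%:R * (X w / (s * Num.sqrt n%:R))).
    by apply/funext => w; rewrite mulrCA mulfV ?mulr1// gt_eqF.
  by rewrite (prob_itv_scale ssn0 P) !mulKf// gt_eqF.
have NE : prob_itv N01 id u v = prob_itv N01 (G n) (s * Num.sqrt n%:R * u) (s * Num.sqrt n%:R * v).
  by rewrite (prob_itv_scale ssn0 N01 id) !mulKf// gt_eqF.
rewrite XE NE.
have := @prob_itv_perturb _ _ _ P _ _ _ _ (s * Num.sqrt n%:R * u) (s * Num.sqrt n%:R * v) mX (mS 0 n) mB XS.
have := edge (s * Num.sqrt n%:R * u); have := edge (s * Num.sqrt n%:R * v).
have := hS2 (s * Num.sqrt n%:R * u).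
have -> : s * Num.sqrt n%:R * u + (v - u) * s * Num.sqrt n%:R = s * Num.sqrt n%:R * v by ring.
have ks : 6 * k / s = e / 16 by rewrite /k; field; rewrite gt_eqF.
rewrite ks => h1 h2 h3 h4.
have := ler_distD (prob_itv P (psum Y 0 n) (s * Num.sqrt n%:R * u) (s * Num.sqrt n%:R * v))
  (prob_itv P X (s * Num.sqrt n%:R * u) (s * Num.sqrt n%:R * v))
  (prob_itv N01 (G n) (s * Num.sqrt n%:R * u) (s * Num.sqrt n%:R * v)).
rewrite distrC /r in h1 h2 h3 h4 pB *; lra.
Unshelve. all: by end_near. Qed.

End clt.

(** * Local limit theorem for the logarithm of the perpetuity *)

Section llt.
Hypothesis lltS : forall L e : R, 0 <= L -> 0 < e -> exists2 kappa : R, 0 < kappa &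
  \forall n \near \oo, forall p, (p <= n)%N -> (n - p)%:R <= kappa * n%:R -> forall x,
  `|prob_itv P (psum Y 0 p) x (x + L) - prob_itv N01 (G n) x (x + L)| <= e / Num.sqrt n%:R.

Local Notation c n := (s * Num.sqrt n%:R)^-1.
Let pdfn (n : nat) (y : R) : R := normal_pdf 0 1 (c n * (y - a * n%:R)).

(** Conditioning on the shift V reduces to the walk on ]y - V, y - V + L]. Off E, V differs from a n
    by at most k sqrt n, and the Lipschitz normal density replaces V by a n at cost O(k / sqrt n).
    On E the density bound still supplies 1 / sqrt n, so a small fixed probability of E is
    enough. *)
Lemma ln_tail_llt (L e : R) : 0 <= L -> 0 < e -> exists2 kappa : R, 0 < kappa &
  \forall n \near \oo, forall p m, (p + m)%N = n -> (0 < m)%N -> m%:R <= kappa * n%:R ->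
  forall y, `|prob_itv P (ln_tail p m) y (y + L) - c n * L * pdfn n y| <=
    e / Num.sqrt n%:R.
Proof.
move=> L0 e0; have e40 : 0 < e / 4 by rewrite divr_gt0.
have L10 : 0 < L + 1 by rewrite ltr_wpDl.
have [kap1 kap10 hS] := lltS L0 e40.
(* [k] and [r] give e / 4 each to the Lipschitz term and to the event E, after multiplication by
   sqrt n; L + 1 keeps the denominators positive. *)
pose k : R := e * s ^+ 2 / (4 * (L + 1)).
have k0 : 0 < k by rewrite divr_gt0 ?mulr_gt0 ?exprn_gt0.
pose r : R := e * s / (4 * (L + 1)).
have r0 : 0 < r by rewrite divr_gt0 ?mulr_gt0.
have [dl dl0 hcl] := near_perp_close k0 r0.
exists (Num.min kap1 dl); first by rewrite lt_min kap10.
near=> n => p m pmn m0 mk y.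
have n0 : 0 < n%:R :> R by rewrite ltr0n; near: n; exact: nbhs_infty_gt.
have sn0 : 0 < Num.sqrt (n%:R : R) by rewrite sqrtr_gt0.
have ssn0 : 0 < s * Num.sqrt n%:R by rewrite mulr_gt0.
have mk1 : (n - p)%:R <= kap1 * n%:R.
  by rewrite -pmn addKn pmn (le_trans mk)// ler_wpM2r// ge_min lexx.
have mdl : m%:R <= dl * n%:R.
  by rewrite (le_trans mk)// ler_wpM2r// ge_min lexx orbT.
have pn : (p <= n)%N by rewrite -pmn leq_addr.
have mn : (m <= n)%N by rewrite -pmn leq_addl.
pose E := [set w | k * Num.sqrt n%:R < `|ln (perp p m w) - a * m%:R|].
have mE : measurable E by apply: measurable_gt_norm; exact: measurable_funB.
have pE : pr P E <= r.
  have hcl' : forall p m, (0 < m)%N -> (m <= n)%N -> m%:R <= dl * n%:R ->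
    pr P [set w | k * Num.sqrt n%:R < `|ln (perp p m w) - a * m%:R|] <= r by near: n.
  exact: hcl'.
have hS' : forall p, (p <= n)%N -> (n - p)%:R <= kap1 * n%:R -> forall x,
  `|prob_itv P (psum Y 0 p) x (x + L) - prob_itv N01 (G n) x (x + L)| <= e / 4 / Num.sqrt n%:R.
  by near: n.
pose V w := a * p%:R + ln (perp p m w).
have mV : measurable_fun [set: T] V by exact: measurable_funD.
have ind : indep2 P (psum Y 0 p) V.
  apply: (known_indep2 indepZ (J := block 0 p) (K := block (0 + p) m)).
  - exact: block_disj.
  - exact: (known_psum known_cstep).
  - apply: (@measurable_funD _ (g_sigma_algebraType (cylinders Z (block (0 + p) m)))) => //.
    exact: (measurableT_comp (@measurable_ln R) (@known_perp p m)).
have -> : prob_itv P (ln_tail p m) y (y + L) =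
    \int[P]_w prob_itv P (psum Y 0 p) (y - V w) (y + L - V w).
  by rewrite -(prob_itv_sum (mS 0 p) mV ind).
pose al := e / 4 / Num.sqrt n%:R + c n ^+ 2 * L * (k * Num.sqrt n%:R + L).
have ci0 : 0 <= c n by rewrite invr_ge0 ltW.
apply: (@le_trans _ _ (al + c n * L * pr P E)).
  apply: Rintegral_near_cst => //.
  - exact: (measurable_prob_itv_sub P (mS 0 p) mV).
  - by move=> w; rewrite prob_itv_ge0 prob_itv_le1//; exact: mS.
  move=> w; have -> : y + L - V w = (y - V w) + L by ring.
  apply: le_trans (ler_distD (prob_itv N01 (G n) (y - V w) (y - V w + L)) _ _) _.
  rewrite /al -[leRHS]addrA; apply: lerD; first exact: hS'.
  rewrite indicE; have [wE|/negP wE] := boolP (w \in E).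
    have N1 := prob_itv_ge0 N01 (G n) (y - V w) (y - V w + L).
    have N2 := @prob_itv_scaled_normal_le R _ ssn0 (y - V w) L L0.
    have D1 : 0 <= c n * L * pdfn n y by rewrite !mulr_ge0// normal_pdf_ge0.
    have D2 : c n * L * pdfn n y <= c n * L.
      rewrite ler_piMr ?mulr_ge0// /pdfn.
      apply: le_trans (normal_pdf_ub _ _ (oner_neq0 R)) _.
      by have := @normal_peak_le R 1 ltr01; rewrite invr1.
    have Q : 0 <= c n ^+ 2 * L * (k * Num.sqrt n%:R + L).
      apply: mulr_ge0; first by rewrite mulr_ge0 ?sqr_ge0.
      by rewrite addr_ge0// mulr_ge0// ltW.
    by rewrite (_ : true%:R = 1 :> R)// mulr1; exact: ler_dist_itvD.
  rewrite mulr0 addr0.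
  apply: le_trans (@prob_itv_scaled_normal_dist R _ ssn0 (y - V w) L (y - a * n%:R) L0) _.
  rewrite -exprVn ler_wpM2l ?mulr_ge0 ?sqr_ge0// lerD2r.
  have -> : y - V w - (y - a * n%:R) = - (ln (perp p m w) - a * m%:R).
    by rewrite /V -pmn natrD; ring.
  by rewrite normrN leNgt; apply/negP => h; apply: wE; rewrite inE.
rewrite ler_pdivlMr// /al.
have t1 : c n * L * pr P E * Num.sqrt n%:R <= e / 4.
  have -> : c n * L * pr P E * Num.sqrt n%:R = L / s * pr P E by field; rewrite !gt_eqF.
  apply: (@le_trans _ _ ((L + 1) / s * r)).
    apply: ler_pM => //; rewrite ?pr_ge0 ?divr_ge0 ?(ltW s0)//.
    by rewrite ler_wpM2r ?invr_ge0 ?(ltW s0)// lerDl.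
  rewrite le_eqVlt; apply/orP; left; apply/eqP; rewrite /r; field; rewrite !gt_eqF//.
have sq : Num.sqrt n%:R ^+ 2 = n%:R :> R by rewrite sqr_sqrtr// ltW.
have t2 : c n ^+ 2 * L * (k * Num.sqrt n%:R) * Num.sqrt n%:R <= e / 4.
  have -> : c n ^+ 2 * L * (k * Num.sqrt n%:R) * Num.sqrt n%:R = L * k / s ^+ 2.
    by field; rewrite !gt_eqF.
  rewrite ler_pdivrMr ?exprn_gt0//; apply: (@le_trans _ _ ((L + 1) * k)).
    by rewrite ler_wpM2r ?(ltW k0)// lerDl.
  by rewrite le_eqVlt; apply/orP; left; apply/eqP; rewrite /k; field; rewrite gt_eqF.
have t3 : c n ^+ 2 * L * L * Num.sqrt n%:R <= e / 4.
  have -> : c n ^+ 2 * L * L * Num.sqrt n%:R = L ^+ 2 / s ^+ 2 / Num.sqrt n%:R.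
    by field; rewrite !gt_eqF.
  rewrite ler_pdivrMr// [leRHS]mulrC -ler_pdivrMr//.
  by near: n; exact: near_sqrt_ge.
have t4 : e / 4 / Num.sqrt n%:R * Num.sqrt n%:R = e / 4 by rewrite divfK// gt_eqF.
lra.
Unshelve. all: by end_near. Qed.

(** Passing from [ln_tail] to the full logarithm costs the mass of two intervals of fixed length 2
    dx, estimated by [ln_tail_llt] itself, plus the exceptional event of the splitting. *)
Lemma ln_perp_llt (L e : R) : 0 <= L -> 0 < e -> \forall n \near \oo, forall y,
  `|prob_itv P (fun w => ln (perp 0 n w)) y (y + L) - c n * L * pdfn n y| <=
  e / Num.sqrt n%:R.
Proof.
move=> L0 e0.
pose e1 : R := e / 8; have e10 : 0 < e1 by rewrite divr_gt0.
(* The density bound 1 / (s sqrt n) gives an interval of length 2 dx mass at most e / (8 sqrt n), up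
   to the error of the local theorem. *)
pose dx : R := e * s / 16; have dx0 : 0 < dx by rewrite divr_gt0 ?mulr_gt0.
have dx20 : 0 <= 2 * dx by rewrite mulr_ge0// ltW.
have [k1 k10 h1] := ln_tail_llt L0 e10.
have [k2 k20 h2] := ln_tail_llt dx20 e10.
pose kappa := Num.min 1 (Num.min k1 k2).
have kap0 : 0 < kappa by rewrite !lt_min ltr01 k10.
have kap1 : kappa <= 1 by rewrite ge_min lexx.
have hsp := near_ln_perp_split
  (divr_gt0 kap0 (ltr0Sn R 1)) dx0 e10.
near=> n => y.
have n0 : 0 < n%:R :> R by rewrite ltr0n; near: n; exact: nbhs_infty_gt.
have sn0 : 0 < Num.sqrt (n%:R : R) by rewrite sqrtr_gt0.
have ssn0 : 0 < s * Num.sqrt n%:R by rewrite mulr_gt0.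
have ci0 : 0 <= c n by rewrite invr_ge0 ltW.
have [p [m [pmn m0 mn mk km]]] : exists p m, [/\ (p + m)%N = n, (0 < m)%N, (m <= n)%N,
    m%:R <= kappa * n%:R & kappa / 2 * n%:R <= m%:R].
  by near: n; exact: block_split.
have mk1 : m%:R <= k1 * n%:R.
  by apply: le_trans mk _; rewrite ler_wpM2r// !ge_min lexx orbT.
have mk2 : m%:R <= k2 * n%:R.
  by apply: le_trans mk _; rewrite ler_wpM2r// !ge_min lexx !orbT.
have g1 : forall p m, (p + m)%N = n -> (0 < m)%N -> m%:R <= k1 * n%:R ->
  forall y, `|prob_itv P (ln_tail p m) y (y + L) - c n * L * pdfn n y| <=
    e1 / Num.sqrt n%:R by near: n.
have g2 : forall p m, (p + m)%N = n -> (0 < m)%N -> m%:R <= k2 * n%:R ->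
  forall y, `|prob_itv P (ln_tail p m) y (y + 2 * dx) - c n * (2 * dx) * pdfn n y| <=
    e1 / Num.sqrt n%:R by near: n.
pose E := [set w | ~ (ln_tail p m w <= ln (perp 0 n w) <= ln_tail p m w + dx)].
have mE : measurable E by exact: measurable_split_event.
have pE : pr P E <= e1 / Num.sqrt n%:R.
  have hsp' : forall p m, (p + m)%N = n -> kappa / 2 * n%:R <= m%:R ->
    pr P [set w | ~ (ln_tail p m w <= ln (perp 0 n w) <= ln_tail p m w + dx)] <=
    e1 / Num.sqrt n%:R by near: n.
  exact: hsp'.
have XW w : ~ E w -> `|ln (perp 0 n w) - ln_tail p m w| <= dx.
  by move=> /contrapT /andP[? ?]; rewrite ler_norml; apply/andP; split; have := ltW dx0; lra.
have edge x : prob_itv P (ln_tail p m) (x - dx) (x + dx) <= e / 4 / Num.sqrt n%:R.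
  have := g2 p m pmn m0 mk2 (x - dx).
  have -> : x - dx + 2 * dx = x + dx by ring.
  rewrite ler_norml => /andP[_ h].
  have D2 : c n * (2 * dx) * pdfn n (x - dx) <= c n * (2 * dx).
    apply: ler_piMr; first exact: mulr_ge0.
    rewrite /pdfn.
    apply: le_trans (normal_pdf_ub _ _ (oner_neq0 R)) _.
    by have := @normal_peak_le R 1 ltr01; rewrite invr1.
  have D3 : c n * (2 * dx) = e / 8 / Num.sqrt n%:R.
    by rewrite /dx; field; rewrite !gt_eqF.
  have -> : e / 4 / Num.sqrt n%:R = e / 8 / Num.sqrt n%:R + e1 / Num.sqrt n%:R.
    by rewrite /e1; field; rewrite gt_eqF.
  lra.
have := @prob_itv_perturb _ _ _ P _ _ _ _ y (y + L) (mlnp 0 n) (measurable_ln_tail p m) mE XW.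
have := edge y; have := edge (y + L); have := g1 p m pmn m0 mk1 y.
have := ler_distD (prob_itv P (ln_tail p m) y (y + L))
  (prob_itv P (fun w => ln (perp 0 n w)) y (y + L)) (c n * L * pdfn n y).
have E4 : e / 4 / Num.sqrt n%:R = (e / Num.sqrt n%:R) / 4 by rewrite mulrAC.
have E8 : e1 / Num.sqrt n%:R = (e / Num.sqrt n%:R) / 8 by rewrite /e1 mulrAC.
rewrite E4 E8 in pE *; have e' : 0 <= e / Num.sqrt n%:R by rewrite divr_ge0 ?ltW.
lra.
Unshelve. all: by end_near. Qed.

End llt.
End perpetuity.

(** * Transfer of probabilities and expectations between equal laws *)

Section same_law_transfer.
Context d d' (T : measurableType d) (T' : measurableType d') (R : realType)
  (P : probability T R) (X V : {RV P >-> T'}).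
Hypothesis XV : same_law X V.

Lemma same_law_pr (A : set T') : measurable A ->
  pr P (X @^-1` A) = pr P (V @^-1` A).
Proof. by move=> mA; rewrite /pr; congr fine; exact: XV. Qed.

Lemma same_law_ge0_integral (f : T' -> \bar R) : measurable_fun [set: T'] f ->
  (forall y, 0 <= f y)%E -> (\int[P]_w f (X w) = \int[P]_w f (V w))%E.
Proof.
move=> mf f0.
have := ge0_integral_distribution X mf f0; rewrite /comp => <-.
have := ge0_integral_distribution V mf f0; rewrite /comp => <-.
by apply: eq_measure_integral => A mA _; exact: XV.
Qed.

Lemma same_law_integrable (f : T' -> R) : measurable_fun [set: T'] f ->
  P.-integrable [set: T] (EFin \o (fun w => f (V w))) ->
  P.-integrable [set: T] (EFin \o (fun w => f (X w))).
Proof.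
move=> mf /integrableP[_ fV]; apply/integrableP; split.
  apply/measurable_EFinP; apply: measurableT_comp => //; exact: measurable_funPT.
rewrite (same_law_ge0_integral (f := fun y => `|(f y)%:E|%E))//.
by apply: measurableT_comp => //; exact/measurable_EFinP.
Qed.

Lemma same_law_Rintegral (f : T' -> R) : measurable_fun [set: T'] f ->
  P.-integrable [set: T] (EFin \o (fun w => f (V w))) ->
  \int[P]_w f (X w) = \int[P]_w f (V w).
Proof.
move=> mf fV; have fX := same_law_integrable mf fV.
have mEf : measurable_fun [set: T'] (fun y => (f y)%:E) by exact/measurable_EFinP.
rewrite /Rintegral; congr fine.
have := @integral_distribution _ _ _ _ _ P X _ mEf fX; rewrite /comp => <-.
have := @integral_distribution _ _ _ _ _ P V _ mEf fV; rewrite /comp => <-.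
by apply: eq_measure_integral => A mA _; exact: XV.
Qed.

Lemma same_law_chf (f : T' -> R) (t : R) : measurable_fun [set: T'] f ->
  chf P (fun w => f (X w)) t = chf P (fun w => f (V w)) t.
Proof.
move=> mf.
have bi (h : R -> R) : measurable_fun [set: R] h -> (forall x, `|h x| <= 1) ->
    \int[P]_w h (t * f (X w)) = \int[P]_w h (t * f (V w)).
  move=> mh h1; have mg : measurable_fun [set: T'] (fun y => h (t * f y)).
    apply: measurableT_comp => //; exact: measurable_funM.
  apply: (same_law_Rintegral mg).
  apply: (@bounded_integrable _ _ _ _ _ 1) => //.
  apply: (measurableT_comp mg); exact: measurable_funPT.
rewrite /chf /ecos /esin; congr (_ +i* _)%C; apply: bi => //.
- apply: continuous_measurable_fun; exact: continuous_cos.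
- exact: cos_max.
- apply: continuous_measurable_fun; exact: continuous_sin.
- exact: sin_max.
Qed.

End same_law_transfer.

(** Continuity from above: the events X < 1 / (n + 1) decrease to a null event. *)
Lemma pr_lt_ae_gt0 d (T : measurableType d) (R : realType) (P : probability T R)
    (X : T -> R) (rho : R) :
  measurable_fun [set: T] X -> {ae P, forall w, 0 < X w} -> 0 < rho ->
  exists2 c : R, 0 < c & pr P [set w | X w < c] <= rho.
Proof.
move=> mX X0 rho0.
pose F (n : nat) := [set w | X w < n.+1%:R^-1].
have mlt (c : R) : measurable [set w | X w < c].
  have := mX measurableT _ (measurable_itv `]-oo, c[); rewrite setTI.
  by congr (measurable _); apply/seteqP; split => w /=; rewrite in_itv.
have mF n : measurable (F n) by exact: mlt.
have mI : measurable (\bigcap_n F n) by exact: bigcap_measurable.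
have F0 : P (\bigcap_n F n) = 0%E.
  apply: measure_negligible => //; apply: negligibleS X0 => w /= Fw Xw.
  have [n _ /=] := near_infty_natSinv_lt (PosNum Xw).
  by move/(_ n (leqnn n)) => /=; move/lt_trans/(_ (Fw n I)); rewrite ltxx.
have Fd : {homo F : n m / (n <= m)%N >-> (m <= n)%O}.
  move=> n m nm; apply/subsetPset => w /= /lt_le_trans; apply.
  by rewrite lef_pV2 ?posrE// ler_nat ltnS.
have PF0 : (P (F 0%N) < +oo)%E by rewrite ltey_eq fin_num_measure.
have PF : (P (F n) @[n --> \oo] --> 0%E)%E.
  by rewrite -F0; exact: nonincreasing_cvg_mu PF0 mF mI Fd.
have [n _ /(_ n (leqnn n)) /= /ltW Pn] := cvgr_lt _ (fine_cvg PF) _ rho0.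
by exists n.+1%:R^-1.
Qed.

(** * The estimates for the copies, from moments of the common law *)

Section copies.
Context d (T : measurableType d) (R : realType) (P : probability T R)
  (V : {RV P >-> (R * R)%type}) (Z : nat -> {RV P >-> (R * R)%type}) (a s : R).
Hypothesis indepZ : mutually_independent Z.
Hypothesis ZV : forall k, same_law (Z k) V.
Hypotheses (a0 : 0 < a) (s0 : 0 < s).
Local Notation U := (fun w : T => (V w).1 - a).
Hypotheses (iU : P.-integrable [set: T] (EFin \o U))
  (iU2 : P.-integrable [set: T] (EFin \o (fun w => U w ^+ 2)))
  (EU : \int[P]_w U w = 0) (EU2 : \int[P]_w (U w ^+ 2) = s ^+ 2).
Hypothesis V2_gt0 : {ae P, forall w, 0 < (V w).2}.
Hypothesis iln : P.-integrable [set: T] (EFin \o (fun w => ln (1 + (V w).2) ^+ 2)).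

Let f (y : R * R) : R := y.1 - a.
Let mf : measurable_fun [set: R * R] f. Proof. exact: measurable_funB. Qed.
Let mf2 : measurable_fun [set: R * R] (fun y => f y ^+ 2).
Proof. exact: measurable_funX. Qed.

Let iY k : P.-integrable [set: T] (EFin \o cstep Z a k).
Proof. exact: (same_law_integrable (ZV k) mf). Qed.

Let iY2 k : P.-integrable [set: T] (EFin \o (fun w => cstep Z a k w ^+ 2)).
Proof. exact: (same_law_integrable (ZV k) mf2). Qed.

Let EY k : \int[P]_w cstep Z a k w = 0.
Proof. by rewrite -EU; exact: (same_law_Rintegral (ZV k) mf). Qed.

Let EY2 k : \int[P]_w (cstep Z a k w ^+ 2) = s ^+ 2.
Proof. by rewrite -EU2; exact: (same_law_Rintegral (ZV k) mf2). Qed.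

Let chfY k t : chf P (cstep Z a k) t = chf P U t.
Proof. exact: (same_law_chf (ZV k) t mf). Qed.

Let mV : measurable_fun [set: T] V. Proof. exact: measurable_funPT. Qed.
Let mV2 : measurable_fun [set: T] (fun w => (V w).2).
Proof. exact: (measurableT_comp (measurable_snd) mV). Qed.

Let Hlow (rho : R) : 0 < rho ->
  exists2 c : R, 0 < c & forall k, pr P [set w | pfactor Z k w < c] <= rho.
Proof.
move=> /(pr_lt_ae_gt0 mV2 V2_gt0) [c c0 cV]; exists c => // k.
apply: le_trans cV; rewrite le_eqVlt; apply/orP; left; apply/eqP.
apply: (same_law_pr (ZV k) (A := [set y | y.2 < c])).
have := (@measurable_snd _ _ R R) measurableT _ (measurable_itv `]-oo, c[); rewrite setTI.
by congr (measurable _); apply/seteqP; split => w /=; rewrite in_itv.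
Qed.

(** Chebyshev for ln (1 + eta): the second logarithmic moment is the constant [c2] of the perpetuity
    estimates. *)
Let Hup k (L : R) : 0 < L -> pr P [set w | L < ln (1 + pfactor Z k w)] <=
  (\int[P]_w (ln (1 + (V w).2) ^+ 2)) / L ^+ 2.
Proof.
move=> L0.
have mg : measurable_fun [set: R * R] (fun y => ln (1 + y.2) : R).
  apply: measurableT_comp => //; exact: measurable_funD.
have mA : measurable [set y : R * R | L < ln (1 + y.2)].
  have := mg measurableT _ (measurable_itv `]L, +oo[); rewrite setTI.
  by congr (measurable _); apply/seteqP; split => w /=; rewrite in_itv /= andbT.
have mW : measurable_fun [set: T] (fun w => ln (1 + (V w).2)) by exact: (measurableT_comp mg mV).
rewrite [leLHS](same_law_pr (ZV k) mA).
apply: le_trans (pr_chebyshev mW L0 iln); apply: le_pr.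
- rewrite -[X in measurable X]setTI; exact: mV.
- exact: measurable_gt_norm.
- by move=> w /= h; apply: lt_le_trans h _; exact: ler_norm.
Qed.

Let mU : measurable_fun [set: T] U. Proof. exact: (measurableT_comp mf mV). Qed.

Lemma copies_ln_perp_clt (u v : R) : u <= v ->
  prob_itv P (fun w => (ln (perp Z a 0 n w) - a * n%:R) / (s * Num.sqrt n%:R)) u v
    @[n --> \oo] --> prob_itv (normal_prob 0 1) id u v.
Proof.
apply: (ln_perp_clt indepZ a0 s0 iY iY2 EY EY2 Hlow Hup) => L e L0 e0.
exact: (psum_clt indepZ (@known_cstep _ _ _ P Z a) s0 chfY (chf_small mU iU iU2 EU EU2)).
Qed.

Lemma copies_ln_perp_llt :
  (forall r b : R, 0 < r -> r <= b -> exists2 lam : R, 0 < lam &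
    forall t, r <= t <= b -> normc (chf P U t) <= expR (- lam)) ->
  forall L e : R, 0 <= L -> 0 < e -> \forall n \near \oo, forall y,
  `|prob_itv P (fun w => ln (perp Z a 0 n w)) y (y + L) -
    (s * Num.sqrt n%:R)^-1 * L *
    normal_pdf 0 1 ((s * Num.sqrt n%:R)^-1 * (y - a * n%:R))| <= e / Num.sqrt n%:R.
Proof.
move=> off0; apply: (ln_perp_llt indepZ a0 s0 iY iY2 EY EY2 Hlow Hup) => L e L0 e0.
exact: (psum_llt indepZ (@known_cstep _ _ _ P Z a) s0 chfY (chf_small mU iU iU2 EU EU2) off0).
Qed.

End copies.

Lemma RintegralEFin d (T : measurableType d) (R : realType)
    (mu : {measure set T -> \bar R}) (f : T -> R) :
  mu.-integrable [set: T] (EFin \o f) ->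
  ((\int[mu]_w f w)%:E = \int[mu]_w (f w)%:E)%E.
Proof. by move=> i; rewrite fineK//; exact: integrable_fin_num i. Qed.

Lemma D_perp d (T : measurableType d) (R : realType) (P : probability T R)
    (xis etas : nat -> {RV P >-> R}) (a : R) (n : nat) (w : T) :
  D xis etas n w =
  perp (fun k => random_vector (xis k) (etas k) : {RV P >-> (R * R)%type}) a 0 n w.
Proof.
rewrite /D /perp; apply: eq_bigr => k _; congr (_ * expR _).
rewrite /walk /psum /cstep sumrB/= sumr_const card_ord mulr_natr subrK.
exact: eq_bigr.
Qed.

(** * Both limit theorems for log D_n *)

Section logD_limits.
Context d (T : measurableType d) (R : realType) (P : probability T R)
  (xi eta : {RV P >-> R}) (xis etas : nat -> {RV P >-> R}) (a sigma : R).
Hypotheses (Hindep : mutually_independent (fun k : nat =>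
      random_vector (xis k) (etas k) : {RV P >-> (R * R)%type}))
    (Hcopy : forall k : nat,
      same_law (random_vector (xis k) (etas k) : {RV P >-> (R * R)%type})
               (random_vector xi eta : {RV P >-> (R * R)%type}))
    (Ha : 0 < a) (Hsigma : 0 < sigma).
Hypotheses (iU : P.-integrable [set: T] (EFin \o (fun w => xi w - a)))
  (iU2 : P.-integrable [set: T] (EFin \o (fun w => (xi w - a) ^+ 2)))
  (EU : \int[P]_w (xi w - a) = 0) (EU2 : \int[P]_w ((xi w - a) ^+ 2) = sigma ^+ 2).
Hypothesis Heta : {ae P, forall t, 0 < eta t}.
Hypothesis iln : P.-integrable [set: T] (EFin \o (fun w => ln (1 + eta w) ^+ 2)).
Local Notation V := (random_vector xi eta : {RV P >-> (R * R)%type}).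

Lemma logD_weak_cvg :
  weak_cvg
    (fun n => distribution P
       (standardize (a * n%:R) (Num.sqrt (n%:R * sigma ^+ 2)) (logD xis etas n)))
    (normal_prob 0 1).
Proof.
move=> f cf [M [_ fM]].
(* [bounded_fun] guarantees the bound only strictly above M. *)
have fK x : `|f x| <= M + 1 by apply: fM => //; rewrite ltrDl.
have mf : measurable_fun [set: R] f by exact: continuous_measurable_fun.
have mEf : measurable_fun [set: R] (fun x => (f x)%:E) by exact/measurable_EFinP.
have SE n : (standardize (a * n%:R) (Num.sqrt (n%:R * sigma ^+ 2)) (logD xis etas n) : T -> R) =
    (fun w => (ln (perp (fun k => random_vector (xis k) (etas k) : {RV P >-> (R * R)%type})
      a 0 n w) - a * n%:R) / (sigma * Num.sqrt n%:R)).
  apply/funext => w; rewrite /standardize /= -(D_perp xis etas a n w).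
  by rewrite sqrtrM// sqrtr_sqr (gtr0_norm Hsigma) [_ * sigma]mulrC.
have mS n : measurable_fun [set: T]
    (standardize (a * n%:R) (Num.sqrt (n%:R * sigma ^+ 2)) (logD xis etas n)).
  exact: measurable_funPT.
have ifS n : P.-integrable [set: T] (EFin \o (fun w => f
    (standardize (a * n%:R) (Num.sqrt (n%:R * sigma ^+ 2)) (logD xis etas n) w))).
  by apply: (@bounded_integrable _ _ _ _ _ (M + 1)) => //; exact: measurableT_comp.
have H := @itv_cvg_expectation R _ T P _ _ _ (normal_prob (0 : R) 1) id f (M + 1) mS
  (@measurable_id _ _ _).
have iN : (normal_prob (0 : R) 1).-integrable [set: _] (EFin \o f).
  exact: (@bounded_integrable _ _ _ _ _ (M + 1)).
rewrite -(RintegralEFin iN).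
rewrite (_ : (fun n => _) = (fun n => (\int[P]_w f
    (standardize (a * n%:R) (Num.sqrt (n%:R * sigma ^+ 2)) (logD xis etas n) w))%:E)).
  apply: cvg_EFin; first by near=> n.
  apply: H => // u v uv; under eq_fun do rewrite SE.
  exact: (copies_ln_perp_clt (V := V) Hindep Hcopy Ha Hsigma iU iU2 EU EU2 Heta iln uv).
apply/funext => n; rewrite (RintegralEFin (ifS n)).
exact: (integral_distribution mEf (ifS n)).
Unshelve. all: by end_near. Qed.

Lemma logD_local_limit : nonlattice (distribution P xi) ->
  forall Delta : R, 0 < Delta -> forall eps : R, 0 < eps ->
  \forall n \near \oo, forall x : R,
    `| fine (P [set t | x < logD xis etas n t <= x + Delta])
       - Delta / Num.sqrt (2 * pi * sigma ^+ 2 * n%:R)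
         * expR (- ((x - n%:R * a) ^+ 2 / (2 * n%:R * sigma ^+ 2))) |
    <= eps / Num.sqrt n%:R.
Proof.
move=> nl Delta D0 eps e0.
have ixi : P.-integrable [set: T] (EFin \o xi).
  have ia : P.-integrable [set: T] (EFin \o cst a) by exact: finite_measure_integrable_cst.
  apply: eq_integrable (integrableD measurableT iU ia) => // w _ /=.
  by rewrite -EFinD subrK.
have off0 := chf_nonlattice a ixi nl.
have := copies_ln_perp_llt (V := V) Hindep Hcopy Ha Hsigma iU iU2 EU EU2 Heta iln off0
  (ltW D0) e0.
apply: filterS2 (nbhs_infty_gt 0) => n n0 h x.
have {}n0 : 0 < n%:R :> R by rewrite ltr0n.
have sn0 : 0 < Num.sqrt (n%:R : R) by rewrite sqrtr_gt0.
have sq : Num.sqrt n%:R ^+ 2 = n%:R :> R by rewrite sqr_sqrtr// ltW.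
have := h x; rewrite normal_pdf0E// /prob_itv.
rewrite (_ : [set w | _ < ln _ <= _] = [set t | x < logD xis etas n t <= x + Delta]); last first.
  by apply/seteqP; split => w /=; rewrite -(D_perp xis etas a n w).
congr (`|_ - _| <= _).
have -> : Num.sqrt (2 * pi * sigma ^+ 2 * n%:R) = sigma * Num.sqrt n%:R * Num.sqrt (pi *+ 2).
  rewrite (_ : 2 * pi * sigma ^+ 2 * n%:R = sigma ^+ 2 * n%:R * (pi *+ 2)); last by ring.
  rewrite sqrtrM; last by apply: mulr_ge0; rewrite ?sqr_ge0.
  by rewrite sqrtrM ?sqr_ge0// sqrtr_sqr (gtr0_norm Hsigma).
have -> : (x - n%:R * a) ^+ 2 / (2 * n%:R * sigma ^+ 2) =
    ((sigma * Num.sqrt n%:R)^-1 * (x - a * n%:R)) ^+ 2 / (1 ^+ 2 *+ 2).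
  by rewrite [in RHS]exprMn exprVn exprMn sq; field; rewrite !gt_eqF.
by rewrite /normal_peak expr1n mul1r !invfM; ring.
Qed.

End logD_limits.

(** * Reduction of the shifted perpetuity *)

Section tilt.
Context d (T : measurableType d) (R : realType).

Definition tilt (X H : {mfun T >-> R}) : T -> R := fun w => H w * expR (- X w).

Lemma measurable_tilt (X H : {mfun T >-> R}) : measurable_fun [set: T] (tilt X H).
Proof.
apply: measurable_funM; first exact: measurable_funPT.
apply: measurableT_comp => //; apply: measurable_funN; exact: measurable_funPT.
Qed.

HB.instance Definition _ (X H : {mfun T >-> R}) :=
  isMeasurableFun.Build _ _ _ _ (tilt X H) (measurable_tilt X H).

Lemma Dtilde_tilt (X H : nat -> {mfun T >-> R}) :
  Dtilde X H = D X (fun k => tilt (X k) (H k)).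
Proof.
apply/funext => n; apply/funext => w; rewrite /Dtilde /D; apply: eq_bigr => k _.
rewrite /tilt /= -mulrA -expRD; congr (_ * expR _).
by rewrite /walk big_ord_recr/= [RHS]addrC addrK.
Qed.

(** The tilted vector is the image of the original one under this fixed measurable map, so
    independence and equality in law carry over by taking preimages. *)
Definition tilt_pair (y : R * R) : R * R := (y.1, y.2 * expR (- y.1)).

Lemma measurable_tilt_pair : measurable_fun [set: R * R] tilt_pair.
Proof.
apply/measurable_fun_pairP; split; first exact: measurable_fst.
apply: measurable_funM => //; apply: measurableT_comp => //.
exact: measurable_funN.
Qed.

Lemma measurable_preimage_tilt_pair (A : set (R * R)) : measurable A ->
  measurable (tilt_pair @^-1` A).
Proof. by move=> mA; rewrite -[X in measurable X]setTI; exact: measurable_tilt_pair. Qed.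

Context (P : probability T R).

Lemma tilt_independent (X H : nat -> {RV P >-> R}) :
  mutually_independent (fun k => random_vector (X k) (H k) : {RV P >-> (R * R)%type}) ->
  mutually_independent (fun k => random_vector (X k) (tilt (X k) (H k)) :
    {RV P >-> (R * R)%type}).
Proof.
move=> ind J A mA.
exact: (ind J (fun i => tilt_pair @^-1` A i)) (fun i => measurable_preimage_tilt_pair (mA i)).
Qed.

Lemma tilt_same_law (X H X' H' : {RV P >-> R}) :
  same_law (random_vector X H : {RV P >-> (R * R)%type})
    (random_vector X' H' : {RV P >-> (R * R)%type}) ->
  same_law (random_vector X (tilt X H) : {RV P >-> (R * R)%type})
    (random_vector X' (tilt X' H') : {RV P >-> (R * R)%type}).
Proof. by move=> law A mA; exact: (law _ (measurable_preimage_tilt_pair mA)). Qed.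

Lemma tilt_ae_gt0 (X H : {RV P >-> R}) : {ae P, forall w, 0 < H w} ->
  {ae P, forall w, 0 < tilt X H w}.
Proof.
apply: filterS => w H0; by rewrite /tilt mulr_gt0// expR_gt0.
Qed.

(* ln (1 + y e^{-x}) <= ln (1 + y) + |x| *)
Lemma tilt_integrable_ln (X H : {RV P >-> R}) (a : R) :
  P.-integrable [set: T] (EFin \o (fun w => (X w - a) ^+ 2)) ->
  {ae P, forall w, 0 < H w} ->
  P.-integrable [set: T] (EFin \o (fun w => ln (1 + H w) ^+ 2)) ->
  P.-integrable [set: T] (EFin \o (fun w => ln (1 + tilt X H w) ^+ 2)).
Proof.
move=> iX H0 iH.
(* The square of ln (1 + H) + |X| is at most twice the sum of squares, and X^2 <= 2 (X - a)^2 + 2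
   a^2. *)
pose g w := 2 * ln (1 + H w) ^+ 2 + (4 * (X w - a) ^+ 2 + 4 * a ^+ 2).
have mX : measurable_fun [set: T] X by exact: measurable_funPT.
have mlt : measurable_fun [set: T] (fun w => ln (1 + tilt X H w) ^+ 2).
  apply: measurable_funX; apply: measurableT_comp => //.
  by apply: measurable_funD => //; exact: measurable_tilt.
have ia (c : R) : P.-integrable [set: T] (EFin \o cst c) by exact: finite_measure_integrable_cst.
have i1 : P.-integrable [set: T] (EFin \o (fun w => 2 * ln (1 + H w) ^+ 2)).
  exact: (integrableZl _ 2 iH).
have i2 : P.-integrable [set: T] (EFin \o (fun w => 4 * (X w - a) ^+ 2)).
  exact: (integrableZl _ 4 iX).
have i3 : P.-integrable [set: T] (EFin \o (fun w => 4 * (X w - a) ^+ 2 + 4 * a ^+ 2)).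
  exact: (integrableD _ i2 (ia _)).
have ig : P.-integrable [set: T] (EFin \o g) by exact: (integrableD _ i1 i3).
have mg : measurable_fun [set: T] (EFin \o g) by exact: measurable_int ig.
apply/integrableP; split; first exact/measurable_EFinP.
have /integrableP[_] := ig; apply: le_lt_trans.
apply: ae_ge0_le_integral => //.
- by apply: measurableT_comp => //; exact/measurable_EFinP.
- exact: measurableT_comp.
apply: filterS H0 => w Hw _; rewrite /= !lee_fin ger0_norm ?sqr_ge0//.
apply: le_trans (ler_norm _); rewrite /g.
have t0 : 0 < tilt X H w by rewrite /tilt mulr_gt0// expR_gt0.
have l0 : 0 <= ln (1 + tilt X H w) by rewrite ln_ge0// lerDl ltW.
have l1 : 0 <= ln (1 + H w) by rewrite ln_ge0// lerDl ltW.
have le : ln (1 + tilt X H w) <= ln (1 + H w) + `|X w|.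
  rewrite -(expRK `|X w|) -lnM ?posrE ?expR_gt0 ?addr_gt0//.
  rewrite ler_ln ?posrE ?mulr_gt0 ?expR_gt0 ?addr_gt0// mulrDl mul1r lerD//.
    by rewrite -[leLHS]expR0 ler_expR.
  by rewrite /tilt ler_wpM2l ?(ltW Hw)// ler_expR -normrN ler_norm.
have : ln (1 + tilt X H w) ^+ 2 <= (ln (1 + H w) + `|X w|) ^+ 2.
  by rewrite ler_sqr ?nnegrE// addr_ge0.
move/le_trans; apply.
have := sqr_ge0 (ln (1 + H w) - `|X w|); have := sqr_ge0 (X w - a - a).
have : `|X w| ^+ 2 = X w ^+ 2 by rewrite real_normK ?num_real.
move: (X w) `|X w| (ln (1 + H w)) => x m l mx h1 h2.
have -> : 4 * (x - a) ^+ 2 + 4 * a ^+ 2 = 2 * m ^+ 2 + 2 * (x - a - a) ^+ 2 by rewrite mx; ring.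
have -> : (l + m) ^+ 2 = 2 * l ^+ 2 + 2 * m ^+ 2 - (l - m) ^+ 2 by ring.
lra.
Qed.

End tilt.

Theorem theorem8 (R : realType) (d : measure_display) (T : measurableType d)
    (P : probability T R)
    (xi eta : {RV P >-> R}) (xis etas : nat -> {RV P >-> R}) (a sigma : R)
    (Hindep : mutually_independent (fun k : nat =>
      random_vector (xis k) (etas k) : {RV P >-> (R * R)%type}))
    (Hcopy : forall k : nat,
      same_law (random_vector (xis k) (etas k) : {RV P >-> (R * R)%type})
               (random_vector xi eta : {RV P >-> (R * R)%type}))
    (Heta : {ae P, forall t, 0 < eta t})
    (Hint : P.-integrable [set: T] (EFin \o xi))
    (Hmean : ('E_P[xi] = a%:E)%E) (Ha : 0 < a)
    (Hvar : ('V_P[xi] = (sigma ^+ 2)%:E)%E) (Hsigma : 0 < sigma)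
    (Hlog : ('E_P[fun t => (ln (1 + eta t) ^+ 2)%R] < +oo)%E) :
  [/\ weak_cvg
        (fun n => distribution P
           (standardize (a * n%:R) (Num.sqrt (n%:R * sigma ^+ 2))
              (logD xis etas n)))
        (normal_prob 0 1),
      nonlattice (distribution P xi) ->
        forall Delta : R, 0 < Delta ->
        forall eps : R, 0 < eps ->
        \forall n \near \oo, forall x : R,
          `| fine (P [set t | x < logD xis etas n t <= x + Delta])
             - Delta / Num.sqrt (2 * pi * sigma ^+ 2 * n%:R)
               * expR (- ((x - n%:R * a) ^+ 2 / (2 * n%:R * sigma ^+ 2))) |
          <= eps / Num.sqrt n%:R,
      weak_cvg
        (fun n => distribution P
           (standardize (a * n%:R) (Num.sqrt (n%:R * sigma ^+ 2))
              (logDtilde xis etas n)))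
        (normal_prob 0 1) &
      nonlattice (distribution P xi) ->
        forall Delta : R, 0 < Delta ->
        forall eps : R, 0 < eps ->
        \forall n \near \oo, forall x : R,
          `| fine (P [set t | x < logDtilde xis etas n t <= x + Delta])
             - Delta / Num.sqrt (2 * pi * sigma ^+ 2 * n%:R)
               * expR (- ((x - n%:R * a) ^+ 2 / (2 * n%:R * sigma ^+ 2))) |
          <= eps / Num.sqrt n%:R].
Proof.
have ia : P.-integrable [set: T] (EFin \o cst a) by exact: finite_measure_integrable_cst.
have iU : P.-integrable [set: T] (EFin \o (fun w => xi w - a)).
  exact: (integrableB _ Hint ia).
have mU : measurable_fun [set: T] (fun w => xi w - a).
  by apply: measurable_funB => //; exact: measurable_funPT.
have EU : \int[P]_w (xi w - a) = 0.
  move: Hmean; rewrite expectation.unlock => Exi.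
  by rewrite (RintegralB _ Hint ia)// Rintegral_probability_cst /Rintegral Exi subrr.
have VU : (\int[P]_w ((xi w - a) ^+ 2)%:E = (sigma ^+ 2)%:E)%E.
  by move: Hvar; rewrite /variance covariance.unlock Hmean expectation.unlock.
(* Integrability is read off from the variance: the extended integral of this nonnegative function
   equals a real number. *)
have iU2 : P.-integrable [set: T] (EFin \o (fun w => (xi w - a) ^+ 2)).
  apply/integrableP; split; first by apply/measurable_EFinP; exact: measurable_funX.
  under eq_integral => w _ do rewrite /= ger0_norm ?sqr_ge0//.
  by rewrite VU ltry.
have EU2 : \int[P]_w ((xi w - a) ^+ 2) = sigma ^+ 2 by rewrite /Rintegral VU.
have iln : P.-integrable [set: T] (EFin \o (fun w => ln (1 + eta w) ^+ 2)).
  apply/integrableP; split.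
    apply/measurable_EFinP/measurable_funX; apply: measurableT_comp => //.
    by apply: measurable_funD => //; exact: measurable_funPT.
  under eq_integral => w _ do rewrite /= ger0_norm ?sqr_ge0//.
  by move: Hlog; rewrite expectation.unlock.
have Hindep' := tilt_independent Hindep.
have Hcopy' k := tilt_same_law (Hcopy k).
have Heta' := tilt_ae_gt0 xi Heta.
have iln' := tilt_integrable_ln iU2 Heta iln.
split.
- exact: (logD_weak_cvg Hindep Hcopy Ha Hsigma iU iU2 EU EU2 Heta iln).
- exact: (logD_local_limit Hindep Hcopy Ha Hsigma iU iU2 EU EU2 Heta iln).
- move=> f cf bf.
  have := logD_weak_cvg Hindep' Hcopy' Ha Hsigma iU iU2 EU EU2 Heta' iln' cf bf.
  (* For each n the two laws coincide, the underlying variables being equal pointwise by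
     [Dtilde_tilt]. *)
  apply: cvg_trans; apply: near_eq_cvg; apply: nearW => n; apply: eq_measure_integral => A _ _.
  congr (P (_ @^-1` A)); apply/funext => w; congr ((_ - _) / _).
  by rewrite /= /logDtilde Dtilde_tilt.
- have := logD_local_limit Hindep' Hcopy' Ha Hsigma iU iU2 EU EU2 Heta' iln'.
  by rewrite /logDtilde Dtilde_tilt.
Qed.
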